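(* $\lim_{n\to\infty}p_{\mathrm{max}}(\mathbb{Z}^n)\le 0.5847$.
   Context: $\mathbb{Z}^n$ denotes the $n$-dimensional lattice graph: its vertices are the points with integer coordinates, and two vertices are adjacent iff they are at Euclidean distance $1$. A bond percolation model on a (possibly infinite) graph $G$ is a probability distribution on the spanning subgraphs of $G$; an edge is open if it is present in the random subgraph and closed otherwise. The model is 1-independent if, for any two disjoint sets of edges $S_1$, $S_2$ of $G$ such that no edge in $S_1$ shares a vertex with an edge in $S_2$, the states (open or closed) of the edges in $S_1$ are independent of the states of the edges in $S_2$. A model on an infinite graph percolates if the random subgraph has an infinite component with positive probability. $\mathcal{D}_{\ge p}(G)$ is the class of 1-independent bond percolation models on $G$ in which each edge is open with probability at least $p$, and $$p_{\mathrm{max}}(G)=\sup\{p : \text{some model in } \mathcal{D}_{\ge p}(G) \text{ does not percolate}\}.$$ The sequence $p_{\mathrm{max}}(\mathbb{Z}^n)$ is non-increasing in $n$ (a non-percolating model on $\mathbb{Z}^n$ restricts to a non-percolating model on a copy of $\mathbb{Z}^{n-1}$), so the limit exists. *)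

(* Defs.v *)
From HB Require Import structures.
From mathcomp Require Import all_boot all_order all_algebra.
From mathcomp Require Import all_classical all_reals all_analysis.
Set Implicit Arguments.
Unset Strict Implicit.
Unset Printing Implicit Defensive.
Import Order.TTheory GRing.Theory Num.Theory.
Import numFieldNormedType.Exports.
Local Open Scope classical_set_scope.
Local Open Scope ring_scope.

Record graph := Graph {
  vertex : Type;
  adj : vertex -> vertex -> Prop;
  adj_sym : forall x y, adj x y -> adj y x;
  adj_irr : forall x, ~ adj x x
}.

Definition edge_set (G : graph) : set (set (vertex G)) :=
  [set e | exists x y, adj x y /\ e = [set x; y]].
Arguments edge_set : clear implicits.

Definition edge (G : graph) : Type := set_type (edge_set G).

(* A spanning subgraph is identified with its set of (open) edges. *)
Definition spanning (G : graph) : Type := set (edge G).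

Definition is_open (G : graph) (e : edge G) : set (spanning G) :=
  [set H | H e].

Definition open_events (G : graph) (S : set (edge G)) :
    set (set (spanning G)) :=
  [set is_open e | e in S].

(* The events that depend on the states of the edges of S only. *)
Definition sigma_states (G : graph) (S : set (edge G)) :
    set (set (spanning G)) :=
  <<s open_events S >>.

(* The spanning subgraphs carry the product sigma-algebra, i.e. the one
   generated by the states of all the edges. *)
Definition config (G : graph) :=
  g_sigma_algebraType (open_events [set: edge G]).

Definition model (R : realType) (G : graph) := probability (config G) R.

Definition share_vertex (G : graph) (e f : edge G) : Prop :=
  (\val e `&` \val f) !=set0.

Definition one_independent (R : realType) (G : graph) (P : model R G) : Prop :=
  forall S1 S2 : set (edge G),
    S1 `&` S2 = set0 ->
    (forall e f, S1 e -> S2 f -> ~ share_vertex e f) ->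
    forall A B : set (spanning G), sigma_states S1 A -> sigma_states S2 B ->
      P (A `&` B) = (P A * P B)%E.

Definition sub_adj (G : graph) (H : spanning G) : rel (vertex G) :=
  fun x y => `[< exists e : edge G, H e /\ \val e = [set x; y] >].

Definition component (G : graph) (H : spanning G) (x : vertex G) :
    set (vertex G) :=
  [set y | exists s : seq (vertex G), path (sub_adj H) x s /\ last x s = y].

Definition has_infinite_component (G : graph) : set (spanning G) :=
  [set H | exists x, infinite_set (component H x)].
Arguments has_infinite_component : clear implicits.

(* When the vertex set is countable, has_infinite_component is measurable:
   it is obtained by countable unions and intersections from the events
   "x and y are joined by an open path". *)
Definition percolates (R : realType) (G : graph) (P : model R G) : Prop :=
  (0 < P (has_infinite_component G))%E.

Definition D_ge (R : realType) (G : graph) (p : R) : set (model R G) :=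
  [set P | one_independent P /\ forall e : edge G, (p%:E <= P (is_open e))%E].

(* The bounds 0 <= p <= 1 make the real supremum meaningful: sup is 0 by
   convention on sets that are not bounded above, which would otherwise be the
   case for a graph without edges. *)
Definition pmax (R : realType) (G : graph) : R :=
  sup [set p : R | 0 <= p <= 1 /\
                   exists P : model R G, D_ge p P /\ ~ percolates P].

Section Lattice.
Variables (R : realType) (n : nat).
Implicit Types x y : 'rV[int]_n.

Definition euclid_dist x y : R :=
  Num.sqrt (\sum_(i < n) ((x ord0 i)%:~R - (y ord0 i)%:~R) ^+ 2).

Lemma euclid_dist_sym x y : euclid_dist x y = 1 -> euclid_dist y x = 1.
Proof.
by rewrite /euclid_dist; under eq_bigr do rewrite -sqrrN opprB.
Qed.

Lemma euclid_dist_irr x : euclid_dist x x <> 1.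
Proof.
rewrite /euclid_dist big1 => [|i _]; last by rewrite subrr expr0n.
by rewrite sqrtr0 => /eqP; rewrite eq_sym oner_eq0.
Qed.

Definition lattice : graph := Graph euclid_dist_sym euclid_dist_irr.
End Lattice.

(* Main.v *)
(** Fix an edge wv of a cube and a third direction t.  If wv and the parallel edge between w + t and v + t are both
    open, then w is joined to w + t if and only if v is joined to v + t.  Let q and q' be the conditional
    probabilities, inside two disjoint parallel subcubes, of these two events given the edges that avoid w + t and
    v + t.  Since the parallel edge is independent of the rest, E[q q' + (1 - q)(1 - q')] >= p on the event that wv
    is open, up to a stability error, so there q and q' mostly lie on the same side of 1/2.  As t varies, the signs
    of q - 1/2 at w and at v form two independent vectors that agree with large probability; hence both are almost
    deterministic, and w is "good" (q > 1/2 for nearly all t in a large set D) with probability more than 1/2.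

    If w is good, then for most pairs s, t in D the conditional probability that w is joined to w + s + t is more
    than the square root of 1 - p.  So for adjacent good vertices w and v, the event that w is joined to w + s + t
    and v to v + s + t is more likely than the event that the edge between w + s + t and v + s + t is closed.
    Testing many disjoint pairs one after the other shows that w and v are joined with probability close to 1.  The
    stability errors are controlled by the energy E[q^2], which is at most 1 and nondecreasing in the subcube: for
    each vertex all but a bounded number of directions can be added at little cost.

    Moving through good vertices only, one crosses every edge of Z^2 x {0} by a connection that uses edges near it
    and fails with arbitrarily small probability.  A multiscale renormalization in a quadrant then yields
    percolation for p = 7/12 in one lattice Z^n, and restriction to hyperplanes shows that p_max is nonincreasing. *)

Require Import Defs.
From HB Require Import structures.
From Stdlib Require Import Classical.
From mathcomp Require Import all_boot all_order all_algebra.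
From mathcomp Require Import ring lra zify.
Set Implicit Arguments.
Unset Strict Implicit.
Unset Printing Implicit Defensive.
Import Order.TTheory GRing.Theory Num.Theory.
Local Open Scope ring_scope.

(** * Conditional expectations over finite edge configurations *)

(** Nothing is known about edges sharing a vertex, so neither positive correlation nor finite energy
    is available: every estimate has to be reduced to independence on disjoint vertex sets. Energy
    stability supplies the missing near-independence: where the energy is almost constant, further
    conditioning hardly changes a prediction.

    For a pair of directions [s], [t] the arithmetic bounds only [a b y ^ 2] from below, where [a],
    [b], [y] are the conditional probabilities of reaching [w + s], [w + t] and [w + s + t]. Hence
    three families of targets are tested in parallel; where both endpoints satisfy the bound, at
    least one of the three tests is positive. The threshold [21 / 50] lies just above
    [1 - p0 = 5 / 12].

    Goodness of [w] is judged with directions that depend on [w], and a step in direction [r] is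
    controlled only if [r] is not one of them. So two groups of directions are used in turn:
    elements of one are moved while goodness is judged with the other. The directions in [Ms] serve
    to repeat attempts, and the large pool [Pl] contains the stable sets of directions. *)

Section Configurations.
Variable V : finType.

Definition conf := {ffun V * V -> bool}.
Implicit Types (o : conf) (K L : rel V) (A B : {set V}).

(* A configuration assigns a bit to every ordered pair; the edge [xy] is open if one of its two bits is set. *)
Definition op o : rel V := fun x y => o (x, y) || o (y, x).

Lemma opC o x y : op o x y = op o y x.
Proof. by rewrite /op orbC. Qed.

Definition agree K o o' := [forall x, forall y, K x y ==> (op o x y == op o' x y)].

Lemma agreeP K o o' :
  reflect (forall x y, K x y -> op o x y = op o' x y) (agree K o o').
Proof.
apply: (iffP forallP) => [h x y Kxy|h x].
  by move/forallP/(_ y): (h x); rewrite Kxy => /eqP.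
by apply/forallP => y; apply/implyP => /h ->.
Qed.

Lemma agree_refl K o : agree K o o.
Proof. exact/agreeP. Qed.

Lemma agree_sym K o o' : agree K o o' = agree K o' o.
Proof. by apply/agreeP/agreeP => h x y /h. Qed.

Lemma agree_trans K o1 o2 o3 : agree K o1 o2 -> agree K o2 o3 -> agree K o1 o3.
Proof. by move=> /agreeP h /agreeP h'; apply/agreeP => x y k; rewrite h ?h'. Qed.

Lemma agree_sub K L o o' : subrel K L -> agree L o o' -> agree K o o'.
Proof. by move=> KL /agreeP h; apply/agreeP => x y /KL /h. Qed.

Lemma agree_eql K o1 o2 o3 : agree K o1 o2 -> agree K o1 o3 = agree K o2 o3.
Proof.
move=> h; apply/idP/idP; last exact: agree_trans.
by apply: agree_trans; rewrite agree_sym.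
Qed.

(** The finite form of measurability with respect to the states of the pairs in [K]: constancy on
    the atoms of [agree K]. *)
Definition meas T K (f : conf -> T) := forall o o', agree K o o' -> f o = f o'.

Lemma meas_sub T K L (f : conf -> T) : subrel K L -> meas K f -> meas L f.
Proof. by move=> KL h o o' /(agree_sub KL) /h. Qed.

Definition sq A : rel V := fun x y => (x \in A) && (y \in A).

Lemma sqS A B : A \subset B -> subrel (sq A) (sq B).
Proof. by move=> /subsetP AB x y /andP[/AB xB /AB yB]; apply/andP. Qed.

Lemma meas_op A x y : x \in A -> y \in A -> meas (sq A) (fun o => op o x y).
Proof. by move=> xA yA o o' /agreeP; apply; rewrite /sq xA. Qed.

Definition conn o A : rel V := connect [rel x y | sq A x y && op o x y].

Lemma meas_conn A x y : meas (sq A) (fun o => conn o A x y).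
Proof.
move=> o o' /agreeP h; apply: eq_connect => u v /=.
by case: (boolP (sq A u v)) => //= /h ->.
Qed.

Lemma connC o A x y : conn o A x y = conn o A y x.
Proof.
apply: sym_connect_sym => u v /=.
by rewrite opC /sq andbC [X in _ && X]andbC andbC.
Qed.

Lemma conn_trans o A : transitive (conn o A).
Proof. exact: connect_trans. Qed.

Lemma conn_sub o A B x y : A \subset B -> conn o A x y -> conn o B x y.
Proof.
move=> AB; apply: connect_sub => u v /= /andP[uv ouv].
by apply: connect1; rewrite /= (sqS AB uv).
Qed.

Lemma conn1 o A x y : x \in A -> y \in A -> op o x y -> conn o A x y.
Proof. by move=> xA yA oxy; apply: connect1; rewrite /= /sq xA yA. Qed.

End Configurations.

Section Expectation.
Variables (R : realFieldType) (V : finType) (mu : conf V -> R).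
Hypotheses (mu_ge0 : forall o, 0 <= mu o) (mu1 : \sum_o mu o = 1).
Notation conf := (conf V).
Implicit Types (o : conf) (K L : rel V) (A B : {set V}) (f g : conf -> R).

Definition Ex f := \sum_o mu o * f o.

Lemma Ex_le f g : (forall o, f o <= g o) -> Ex f <= Ex g.
Proof. by move=> h; apply: ler_sum => o _; rewrite ler_wpM2l. Qed.

Lemma Ex_ge0 f : (forall o, 0 <= f o) -> 0 <= Ex f.
Proof. by move=> h; apply: sumr_ge0 => o _; rewrite mulr_ge0. Qed.

Lemma Ex_leae f g : (forall o, 0 < mu o -> f o <= g o) -> Ex f <= Ex g.
Proof.
move=> h; apply: ler_sum => o _.
have [->|m0] := eqVneq (mu o) 0; first by rewrite !mul0r.
by rewrite ler_wpM2l // h // lt0r m0 mu_ge0.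
Qed.

Lemma eq_Ex f g : f =1 g -> Ex f = Ex g.
Proof. by move=> h; apply: eq_bigr => o _; rewrite h. Qed.

Lemma ExD f g : Ex (fun o => f o + g o) = Ex f + Ex g.
Proof. by rewrite /Ex -big_split; apply: eq_bigr => o _; rewrite mulrDr. Qed.

Lemma ExN f : Ex (fun o => - f o) = - Ex f.
Proof. by rewrite /Ex -sumrN; apply: eq_bigr => o _; rewrite mulrN. Qed.

Lemma ExB f g : Ex (fun o => f o - g o) = Ex f - Ex g.
Proof. by rewrite ExD ExN. Qed.

Lemma ExZ c f : Ex (fun o => c * f o) = c * Ex f.
Proof. by rewrite /Ex big_distrr; apply: eq_bigr => o _ /=; rewrite mulrCA. Qed.

Lemma ExZr c f : Ex (fun o => f o * c) = Ex f * c.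
Proof. by rewrite mulrC -ExZ; apply: eq_Ex => o; rewrite mulrC. Qed.

Lemma Ex_cst c : Ex (fun=> c) = c.
Proof. by rewrite /Ex -big_distrl /= mu1 mul1r. Qed.

Lemma Ex_sum (I : Type) (r : seq I) (P : pred I) (F : I -> conf -> R) :
  Ex (fun o => \sum_(i <- r | P i) F i o) = \sum_(i <- r | P i) Ex (F i).
Proof.
rewrite /Ex exchange_big /=; apply: eq_bigr => o _.
by rewrite big_distrr.
Qed.

(** Cauchy-Schwarz without square roots: integrate the pointwise bound of [|f|] by
    [t / 2 + f ^ 2 / (2 t)]. *)
Lemma Ex_norm_le f t : 0 < t -> Ex (fun o => f o ^+ 2) <= t ^+ 2 ->
  Ex (fun o => `|f o|) <= t.
Proof.
move=> t0 h.
apply: (@le_trans _ _ (Ex (fun o => t / 2 + (2 * t)^-1 * f o ^+ 2))).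
  apply: Ex_le => o; rewrite -subr_ge0.
  have -> : t / 2 + (2 * t)^-1 * f o ^+ 2 - `|f o| = (2 * t)^-1 * (t - `|f o|) ^+ 2.
    by rewrite -(real_normK (num_real (f o))); field; rewrite gt_eqF.
  by rewrite mulr_ge0 ?sqr_ge0 // invr_ge0 mulr_ge0 ?ltW.
rewrite ExD Ex_cst ExZ.
apply: (@le_trans _ _ (t / 2 + (2 * t)^-1 * t ^+ 2)).
  by rewrite lerD2l ler_wpM2l // invr_ge0 mulr_ge0 ?ltW.
by rewrite le_eqVlt; apply/orP; left; apply/eqP; field; rewrite gt_eqF.
Qed.

Lemma Ex_norm f : `|Ex f| <= Ex (fun o => `|f o|).
Proof.
apply: le_trans (ler_norm_sum _ _ _) _; apply: ler_sum => o _.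
by rewrite normrM ger0_norm.
Qed.

(** The average of [f] over the atom of [o]. On an atom of mass zero the value is 0 by division by
    zero, so that most identities below hold at every configuration and not only almost surely. *)
Definition ce K f o :=
  (\sum_(o' | agree K o o') mu o' * f o') / \sum_(o' | agree K o o') mu o'.

Lemma ceE K f o :
  ce K f o = Ex (fun o' => (agree K o o')%:R * f o') / Ex (fun o' => (agree K o o')%:R).
Proof.
rewrite /ce; congr (_ / _); rewrite /Ex [LHS]big_mkcond /=; apply: eq_bigr => o' _.
  by case: agree; rewrite ?mul1r ?mul0r ?mulr0.
by case: agree; rewrite ?mulr1 ?mulr0.
Qed.

Lemma meas_ce K f : meas K (ce K f).
Proof.
move=> o o' h; rewrite /ce.
by congr (_ / _); apply: eq_bigl => o2; apply: agree_eql.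
Qed.

Lemma mass_gt0 K o : 0 < mu o -> 0 < \sum_(o' | agree K o o') mu o'.
Proof.
move=> m0; rewrite (bigD1 o) ?agree_refl //= ltr_wpDr //.
by apply: sumr_ge0 => *.
Qed.

Lemma Ex_ce K f g : meas K g -> Ex (fun o => ce K f o * g o) = Ex (fun o => f o * g o).
Proof.
move=> mg.
pose m o := \sum_(o' | agree K o o') mu o'.
have mE o o' : agree K o o' -> m o = m o'.
  by move=> h; apply: eq_bigl => o2; apply: agree_eql.
have -> : Ex (fun o => ce K f o * g o) =
  \sum_o \sum_(o' | agree K o o') mu o * mu o' * f o' * g o' / m o'.
  apply: eq_bigr => o _.
  rewrite /ce -/(m o).
  have -> : forall S : R, mu o * (S / m o * g o) = S * (mu o * g o / m o).
    by move=> S; ring.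
  rewrite big_distrl /=.
  by apply: eq_bigr => o' h; rewrite (mE _ _ h) (mg _ _ h); ring.
rewrite (exchange_big_dep predT) //=; apply: eq_bigr => o' _.
have [m0|m0] := eqVneq (mu o') 0.
  by rewrite m0 mul0r big1 // => o _; rewrite mulr0 !mul0r.
have mo' : m o' != 0 by rewrite gt_eqF // mass_gt0 // lt0r m0 mu_ge0.
under eq_bigr do rewrite -!mulrA.
rewrite -big_distrl /=.
under eq_bigl do rewrite agree_sym.
by rewrite -/(m o'); field.
Qed.

Lemma ceD K f g o : ce K (fun o => f o + g o) o = ce K f o + ce K g o.
Proof.
rewrite /ce -mulrDl -big_split; congr (_ / _).
by apply: eq_bigr => o' _; rewrite mulrDr.
Qed.

Lemma ceZ K c f o : ce K (fun o => c * f o) o = c * ce K f o.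
Proof.
rewrite /ce mulrA big_distrr; congr (_ / _).
by apply: eq_bigr => o' _ /=; rewrite mulrCA.
Qed.

Lemma ceN K f o : ce K (fun o => - f o) o = - ce K f o.
Proof.
rewrite -mulN1r -ceZ /ce; congr (_ / _).
by apply: eq_bigr => o' _ /=; rewrite mulN1r.
Qed.

Lemma ceB K f g o : ce K (fun o => f o - g o) o = ce K f o - ce K g o.
Proof. by rewrite ceD ceN. Qed.

Lemma ce_le K f g o : (forall o, f o <= g o) -> ce K f o <= ce K g o.
Proof.
move=> h; rewrite ler_wpM2r ?invr_ge0 ?sumr_ge0 //.
apply: ler_sum => o' _; exact: ler_wpM2l.
Qed.

Lemma eq_ce K f g o : f =1 g -> ce K f o = ce K g o.
Proof. by move=> h; rewrite /ce; congr (_ / _); apply: eq_bigr => o' _; rewrite h. Qed.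

Lemma ce_ge0 K f o : (forall o, 0 <= f o) -> 0 <= ce K f o.
Proof.
move=> h; rewrite mulr_ge0 ?invr_ge0 ?sumr_ge0 // => o' _; exact: mulr_ge0.
Qed.

Lemma ce_le1 K f o : (forall o, f o <= 1) -> ce K f o <= 1.
Proof.
move=> h; have [m0|m0] := eqVneq (\sum_(o' | agree K o o') mu o') 0.
  by rewrite /ce m0 invr0 mulr0.
rewrite ler_pdivrMr; last by rewrite lt0r m0 sumr_ge0.
rewrite mul1r; apply: ler_sum => o' _.
by rewrite -[leRHS]mulr1 ler_wpM2l.
Qed.

Lemma ce_norm K f o : `|ce K f o| <= ce K (fun o => `|f o|) o.
Proof.
rewrite ler_norml lerNl -ceN; apply/andP; split; apply: ce_le => o'.
  by rewrite -normrN ler_norm.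
exact: ler_norm.
Qed.

Lemma Ex_ce1 K f : Ex (ce K f) = Ex f.
Proof.
have := @Ex_ce K f (fun=> 1) (fun _ _ _ => erefl).
under eq_Ex do rewrite mulr1; move=> ->.
by apply: eq_Ex => o; rewrite mulr1.
Qed.

Lemma meas_indic K o : meas K (fun o' => (agree K o o')%:R : R).
Proof.
by move=> o1 o2 h; rewrite !(agree_sym _ o) (agree_eql _ h).
Qed.

(** The indicator of a [K]-atom times [g] is [L]-measurable, so [Ex_ce] identifies the two
    numerators; the denominators are the same. *)
Lemma ce_tower K L f g o : subrel K L -> meas L g ->
  ce K (fun o => g o * ce L f o) o = ce K (fun o => g o * f o) o.
Proof.
move=> KL mg; rewrite !ceE; congr (_ / _).
pose i o' : R := (agree K o o')%:R * g o'.
have mi : meas L i.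
  move=> o1 o2 a; rewrite /i (mg _ _ a).
  by rewrite (meas_indic o (agree_sub KL a)).
have /= := Ex_ce f mi.
rewrite (eq_Ex (g := fun o' => (agree K o o')%:R * (g o' * ce L f o'))) => [->|o'].
  by apply: eq_Ex => o'; rewrite /i; ring.
by rewrite /i; ring.
Qed.

Lemma ce_out K f g o : meas K g -> ce K (fun o => g o * f o) o = g o * ce K f o.
Proof.
move=> mg; rewrite /ce mulrA big_distrr; congr (_ / _).
by apply: eq_bigr => o' h /=; rewrite (mg _ _ h); ring.
Qed.

(** [ce K f] is the orthogonal projection of [ce L f], so the cross term is the mean square of
    [ce K f]. *)
Lemma Ex_ce_pyth K L f : subrel K L ->
  Ex (fun o => (ce L f o - ce K f o) ^+ 2) =
  Ex (fun o => ce L f o ^+ 2) - Ex (fun o => ce K f o ^+ 2).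
Proof.
move=> KL.
have mK : meas L (ce K f) by apply: meas_sub KL _; exact: meas_ce.
have e1 := Ex_ce f mK; have e2 := Ex_ce f (@meas_ce K f).
have -> : Ex (fun o => (ce L f o - ce K f o) ^+ 2) =
  Ex (fun o => ce L f o ^+ 2) - 2 * Ex (fun o => ce L f o * ce K f o)
   + Ex (fun o => ce K f o ^+ 2).
  by rewrite -ExZ -ExB -ExD; apply: eq_Ex => o; ring.
have e3 : Ex (fun o => ce K f o * ce K f o) = Ex (fun o => ce K f o ^+ 2).
  by apply: eq_Ex => o; rewrite expr2.
by rewrite e1 -e2 e3; ring.
Qed.

Lemma Ex_ce_sq K L f : subrel K L ->
  Ex (fun o => ce K f o ^+ 2) <= Ex (fun o => ce L f o ^+ 2).
Proof.
move=> KL; rewrite -subr_ge0 -Ex_ce_pyth //.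
by apply: Ex_ge0 => o; exact: sqr_ge0.
Qed.

End Expectation.

(** * Prediction energy *)

Lemma big_eq_value (R : pzRingType) (T : finType) (S : eqType) (f : T -> S) (F : S -> R) x :
  \sum_(y <- undup (codom f)) F y * (f x == y)%:R = F (f x).
Proof.
rewrite (bigD1_seq (f x)) ?undup_uniq ?mem_undup ?codom_f //= eqxx mulr1.
by rewrite big1 ?addr0 // => y; rewrite eq_sym => /negPf ->; rewrite mulr0.
Qed.

Lemma ler_sqr_nneg (R : realDomainType) (x y : R) : 0 <= x -> x <= y -> x ^+ 2 <= y ^+ 2.
Proof. by move=> x0 xy; rewrite lerXn2r // nnegrE (le_trans x0). Qed.

Definition relU V (K L : rel V) : rel V := fun x y => K x y || L x y.

Section Independence.
Variables (R : realFieldType) (V : finType) (mu : conf V -> R).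
Hypotheses (mu_ge0 : forall o, 0 <= mu o) (mu1 : \sum_o mu o = 1).
Notation conf := (conf V).
Notation Ex := (Ex mu).
Notation ce := (ce mu).
Implicit Types (o : conf) (K L : rel V) (A B : {set V}) (f g : conf -> R).

Definition indep_on_disjoint := forall A B (a b : pred conf),
  [disjoint A & B] -> meas (sq A) a -> meas (sq B) b ->
  Ex (fun o => (a o && b o)%:R) = Ex (fun o => (a o)%:R) * Ex (fun o => (b o)%:R).

Hypothesis mu_indep : indep_on_disjoint.

Lemma Ex_indep A B f g : [disjoint A & B] -> meas (sq A) f -> meas (sq B) g ->
  Ex (fun o => f o * g o) = Ex f * Ex g.
Proof.
move=> dAB mf mg.
have fE o := big_eq_value f id o; have gE o := big_eq_value g id o.
rewrite -(eq_Ex mu fE) -(eq_Ex mu gE) !Ex_sum big_distrlr /=.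
under eq_Ex do rewrite -fE -gE big_distrlr /=.
rewrite Ex_sum; apply: eq_bigr => y _; rewrite Ex_sum; apply: eq_bigr => z _.
rewrite !ExZ.
transitivity (y * z * Ex (fun o => ((f o == y) && (g o == z))%:R)).
  by rewrite -ExZ; apply: eq_Ex => o; rewrite -mulnb natrM; ring.
rewrite (mu_indep dAB); first by ring.
- by move=> o o' h; rewrite (mf _ _ h).
- by move=> o o' h; rewrite (mg _ _ h).
Qed.

Lemma ce_indep A B f o : [disjoint A & B] -> meas (sq B) f -> 0 < mu o ->
  ce (sq A) f o = Ex f.
Proof.
move=> dAB mf m0; rewrite ceE (Ex_indep dAB) //; last exact: meas_indic.
rewrite mulrAC divff ?mul1r // gt_eqF //.
have := mass_gt0 mu_ge0 (sq A) m0.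
rewrite /Ex big_mkcond /=; congr (_ < _); apply: eq_bigr => o' _.
by case: agree; rewrite ?mulr1 ?mulr0.
Qed.

Lemma agreeU K L o o' : agree (relU K L) o o' = agree K o o' && agree L o o'.
Proof.
apply/idP/andP => [h|[/agreeP h1 /agreeP h2]].
  split; apply: agree_sub h => x y k; rewrite /relU k ?orbT //.
by apply/agreeP => x y /orP[/h1|/h2].
Qed.

(** The indicator of the joint atom is a product of one indicator on each side, so numerator and
    denominator both factor. Null atoms are no exception: both sides are then 0. *)
Lemma ce_prod A B A' B' f g o : [disjoint B & B'] -> A \subset B -> A' \subset B' ->
  meas (sq B) f -> meas (sq B') g ->
  ce (relU (sq A) (sq A')) (fun o => f o * g o) o = ce (sq A) f o * ce (sq A') g o.
Proof.
move=> dB AB AB' mf mg; rewrite !ceE.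
have mA : meas (sq B) (fun o' => (agree (sq A) o o')%:R : R).
  by apply: meas_sub (sqS AB) _; exact: meas_indic.
have mA' : meas (sq B') (fun o' => (agree (sq A') o o')%:R : R).
  by apply: meas_sub (sqS AB') _; exact: meas_indic.
under eq_Ex do rewrite agreeU -mulnb natrM mulrACA.
under [X in _ / X]eq_Ex do rewrite agreeU -mulnb natrM.
have mAf : meas (sq B) (fun o' => (agree (sq A) o o')%:R * f o').
  by move=> o1 o2 h; rewrite (mf _ _ h) (mA _ _ h).
have mAg : meas (sq B') (fun o' => (agree (sq A') o o')%:R * g o').
  by move=> o1 o2 h; rewrite (mg _ _ h) (mA' _ _ h).
by rewrite (Ex_indep dB mAf mAg) (Ex_indep dB mA mA') invfM mulrACA.
Qed.

Definition hit A w t o : R := (conn o A w t)%:R.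

Lemma hit_ge0 A w t o : 0 <= hit A w t o. Proof. exact: ler0n. Qed.
Lemma hit_le1 A w t o : hit A w t o <= 1. Proof. by rewrite /hit; case: conn. Qed.

Lemma meas_hit A B w t : A \subset B -> meas (sq B) (hit A w t).
Proof.
move=> AB o o' h; congr (_%:R); congr nat_of_bool.
exact: (@meas_conn V A w t _ _ (agree_sub (sqS AB) h)).
Qed.

Lemma hit_sub A B w t o : A \subset B -> hit A w t o <= hit B w t o.
Proof.
move=> AB; rewrite /hit ler_nat; case h: (conn o A w t) => //.
by rewrite (conn_sub AB h).
Qed.

(** The edges at the target [t] are left out of the conditioning, which makes the prediction
    independent of any edge from [t] to a vertex outside [A]. *)
Definition prd A w t := ce (sq (A :\ t)) (hit A w t).

Lemma prd_ge0 A w t o : 0 <= prd A w t o.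
Proof. exact: ce_ge0 (hit_ge0 _ _ _). Qed.

Lemma prd_le1 A w t o : prd A w t o <= 1.
Proof. exact: ce_le1 (hit_le1 _ _ _). Qed.

(* The energy of the prediction [prd] of the event that [w] is joined to [t] inside [A]: it is bounded by 1
   and nondecreasing in [A], so it is almost constant along some step of every long chain of sets. *)
Definition Psi A w t := Ex (fun o => prd A w t o ^+ 2).

Lemma Psi_ge0 A w t : 0 <= Psi A w t.
Proof. by apply: Ex_ge0 => // o; exact: sqr_ge0. Qed.

Lemma Psi_le1 A w t : Psi A w t <= 1.
Proof.
rewrite -[leRHS](Ex_cst mu1 1); apply: Ex_le => // o.
by rewrite expr_le1 ?prd_ge0 ?prd_le1.
Qed.

Lemma subD1 A B (t : V) : A \subset B -> A :\ t \subset B :\ t.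
Proof. exact: setSD. Qed.

(** Enlarging [A] refines the conditioning and enlarges the event; each of the two raises the
    energy. *)
Lemma Psi_mono A B w t : A \subset B -> Psi A w t <= Psi B w t.
Proof.
move=> AB; apply: le_trans (Ex_ce_sq mu_ge0 (hit A w t) (sqS (subD1 t AB))) _.
apply: Ex_le => // o; apply: ler_sqr_nneg; first by apply: ce_ge0 => // o'; apply: hit_ge0.
by apply: ce_le => // o'; apply: hit_sub.
Qed.

Section Stable.
Variables (A B : {set V}) (w t : V) (tau : R).
Hypotheses (tau0 : 0 < tau) (AB : A \subset B) (st : Psi B w t - Psi A w t <= tau ^+ 2).

Let KB := sq (B :\ t).
Let KA := sq (A :\ t).
Let KAB : subrel KA KB := sqS (subD1 t AB).

(** Given the edges of [B :\ t], the prediction for [B] is the one for the event inside [A] plus a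
    gain [d]. Both summands are nonnegative, so [d ^ 2] is at most a difference of squares, whose
    mean is at most the energy gap. *)
Lemma stable_gain : Ex (fun o => hit B w t o - hit A w t o) <= tau.
Proof.
rewrite -(Ex_ce1 mu_ge0 KB).
pose d o := ce KB (fun o => hit B w t o - hit A w t o) o.
have dE o : d o = ce KB (hit B w t) o - ce KB (hit A w t) o by exact: ceB.
have d0 o : 0 <= d o by apply: ce_ge0 => // o'; rewrite subr_ge0 hit_sub.
have a0 o : 0 <= ce KB (hit A w t) o by apply: ce_ge0 => // o'; exact: hit_ge0.
apply: le_trans (le_trans (ler_norm _) (Ex_norm mu_ge0 _)) _.
apply: Ex_norm_le => //; apply: le_trans st.
apply: (@le_trans _ _ (Psi B w t - Ex (fun o => ce KB (hit A w t) o ^+ 2))); last first.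
  by rewrite lerB // Ex_ce_sq.
rewrite -ExB; apply: Ex_le => // o; rewrite -/(d o).
have -> : prd B w t o = d o + ce KB (hit A w t) o by rewrite dE subrK.
have := mulr_ge0 (d0 o) (a0 o); rewrite !expr2; nra.
Qed.

(** Conditioning on further edges of [B] away from [t] moves the prediction by a martingale
    increment, whose mean square is an energy difference and hence at most [tau ^ 2]. *)
Lemma stable_prd L : subrel KA L -> subrel L KB ->
  Ex (fun o => `|ce L (hit A w t) o - prd A w t o|) <= tau.
Proof.
move=> AL LB; apply: Ex_norm_le => //; rewrite Ex_ce_pyth //.
apply: le_trans st; rewrite lerB //.
apply: le_trans (Ex_ce_sq mu_ge0 (hit A w t) LB) _.
apply: Ex_le => // o; apply: ler_sqr_nneg; first by apply: ce_ge0 => // o'; apply: hit_ge0.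
by apply: ce_le => // o'; apply: hit_sub.
Qed.

Lemma stable_approx L f : subrel KA L -> subrel L KB -> meas L f ->
  (forall o, `|f o| <= 1) ->
  `|Ex (fun o => f o * hit A w t o) - Ex (fun o => f o * prd A w t o)| <= tau.
Proof.
move=> AL LB mf f1.
have -> : Ex (fun o => f o * hit A w t o) = Ex (fun o => f o * ce L (hit A w t) o).
  rewrite (eq_Ex mu (g := fun o => hit A w t o * f o)); last by move=> o; rewrite mulrC.
  by rewrite -(Ex_ce mu_ge0 _ mf); apply: eq_Ex => o; rewrite mulrC.
rewrite -ExB; apply: le_trans (Ex_norm mu_ge0 _) _.
apply: le_trans (stable_prd AL LB); apply: Ex_le => // o.
by rewrite -mulrBr normrM ler_piMl.
Qed.

End Stable.

End Independence.

(** * Comparison of the predictions in two parallel slices *)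

Section TwoSlices.
Variables (R : realFieldType) (V : finType) (mu : conf V -> R).
Hypotheses (mu_ge0 : forall o, 0 <= mu o) (mu1 : \sum_o mu o = 1).
Hypothesis mu_indep : indep_on_disjoint mu.
Notation Ex := (Ex mu).
Notation ce := (ce mu).
Implicit Types (o : conf V) (f g : conf V -> R).

(** The edge [ws vs] is independent of [g], whence the factor [p]. The error 8 consists of the two
    gains from [A] and [A'] to [C], one replacement for each of the terms linear in a prediction,
    and two replacements, counted twice, for the product. *)
Lemma two_slices (A A' C : {set V}) (w v ws vs : V) (tau p : R) g :
  0 < tau -> 0 <= p -> [disjoint A & A'] -> A \subset C -> A' \subset C ->
  w \in A -> ws \in A -> v \in A' -> vs \in A' ->
  Psi mu C w ws - Psi mu A w ws <= tau ^+ 2 ->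
  Psi mu C v vs - Psi mu A' v vs <= tau ^+ 2 ->
  p <= Ex (fun o => (op o ws vs)%:R) ->
  meas (sq (C :\ ws :\ vs)) g -> (forall o, 0 <= g o <= (op o w v)%:R) ->
  p * Ex g <= Ex (fun o => g o * (prd mu A w ws o * prd mu A' v vs o +
                (1 - prd mu A w ws o) * (1 - prd mu A' v vs o))) + 8%:R * tau.
Proof.
move=> t0 p0 dA AC A'C wA wsA vA vsA stw stv pe mg g01.
have notin x : x \in A -> x \in A' = false by move=> xA; apply: disjointFr xA.
have notin' x : x \in A' -> x \in A = false by move=> xA; apply: disjointFl xA.
set q := prd mu A w ws; set q' := prd mu A' v vs.
pose h := hit R A w ws; pose h' := hit R A' v vs.
pose H := hit R C w ws; pose H' := hit R C v vs.
have g0 o : 0 <= g o by case/andP: (g01 o).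
have g1 o : g o <= 1 by case/andP: (g01 o) => _ /le_trans; apply; case: op.
have q0 o : 0 <= q o by apply: prd_ge0.
have q1 o : q o <= 1 by apply: prd_le1.
have h0 o : 0 <= h' o by apply: hit_ge0.
have h1 o : h' o <= 1 by apply: hit_le1.
have step1 : p * Ex g <= Ex (fun o => g o * (op o ws vs)%:R).
  rewrite (Ex_indep mu_indep (A := C :\ ws :\ vs) (B := [set ws; vs])) //.
  - by rewrite mulrC ler_wpM2l // Ex_ge0.
  - by rewrite disjoint_sym disjoints_subset; apply/subsetP => x; rewrite !inE => /orP[]/eqP ->;
      rewrite eqxx ?andbF.
  - by move=> o o' k; congr (_%:R); congr nat_of_bool; apply: (meas_op _ _ k); rewrite !inE eqxx ?orbT.
(* If both cross edges are open, the two events coincide inside [C]. Hence [h] and [h'] can differ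
   only where one of them differs from its counterpart [H] or [H']. *)
have step2 o : g o * (op o ws vs)%:R <=
    g o * (h' o * h o + (1 - h o) * (1 - h' o)) + (H o - h o) + (H' o - h' o).
  have gn0 := g0 o.
  have hH := hit_sub R w ws o AC; have hH' := hit_sub R v vs o A'C.
  rewrite -/(h o) -/(H o) -/(h' o) -/(H' o) in hH hH'.
  have := g01 o => /andP[_]; case wv: (op o w v); last first.
    move=> gz; have -> : g o = 0 by apply/eqP; rewrite eq_le gn0 gz.
    by rewrite !mul0r add0r addr_ge0 ?subr_ge0.
  move=> _; have gl := g1 o.
  case ee: (op o ws vs); last first.
    rewrite mulr0; apply: addr_ge0; last by rewrite subr_ge0.
    apply: addr_ge0; last by rewrite subr_ge0.
    apply: mulr_ge0 => //; apply: addr_ge0; apply: mulr_ge0; rewrite ?subr_ge0 //.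
    exact: hit_le1.
  have wv' : conn o C w v := conn1 (subsetP AC _ wA) (subsetP A'C _ vA) wv.
  have sv' : conn o C ws vs by apply: conn1 (subsetP AC _ wsA) (subsetP A'C _ vsA) _.
  have cw : conn o A w ws -> conn o C v vs.
    by move=> k; rewrite connC in wv'; apply: conn_trans (conn_trans wv' (conn_sub AC k)) sv'.
  have cv : conn o A' v vs -> conn o C w ws.
    by move=> k; rewrite connC in sv'; apply: conn_trans (conn_trans wv' (conn_sub A'C k)) sv'.
  rewrite /h /h' /H /H' /hit in hH hH' *.
  case: (conn o A w ws) hH cw => hH cw; case: (conn o A' v vs) hH' cv => hH' cv;
    rewrite /= ?mulr1n ?mulr0n in hH hH' *.
  - by move: hH hH'; lra.
  - by move: hH hH'; rewrite (cw isT) /= mulr1n; lra.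
  - by move: hH hH'; rewrite (cv isT) /= mulr1n; lra.
  - by move: hH hH'; lra.
have step3 : Ex (fun o => g o * (op o ws vs)%:R) <=
    Ex (fun o => g o * (h' o * h o + (1 - h o) * (1 - h' o))) + tau + tau.
  apply: le_trans (Ex_le mu_ge0 step2) _.
  rewrite (ExD mu _ (fun o => H' o - h' o)) (ExD mu _ (fun o => H o - h o)).
  apply: lerD; last by apply (stable_gain mu_ge0 mu1 t0 A'C stv).
  by apply: lerD => //; apply (stable_gain mu_ge0 mu1 t0 AC stw).
have subL : subrel (sq (A :\ ws)) (sq (C :\ ws)) by apply/sqS/setSD.
have subL' : subrel (sq (A' :\ vs)) (sq (C :\ vs)) by apply/sqS/setSD.
have mgL : meas (sq (C :\ ws)) g by apply: meas_sub (sqS (subD1set _ _)) mg.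
have mgL' : meas (sq (C :\ vs)) g by apply: meas_sub (sqS _) mg; apply/setSD/subD1set.
have mh' : meas (sq (C :\ ws)) h'.
  apply: meas_hit; apply/subsetP => x xA'; rewrite !inE (subsetP A'C) // andbT.
  by apply: contraTneq xA' => ->; rewrite notin.
have mq : meas (sq (C :\ vs)) q.
  apply: meas_sub (@meas_ce _ _ _ _ _); apply/sqS/subsetP => x; rewrite !inE => /andP[_ xA].
  rewrite (subsetP AC) // andbT; apply: contraTneq xA => ->; by rewrite notin'.
have subLL (P : rel V) : subrel P P by [].
have a1 := stable_approx mu_ge0 mu1 t0 AC stw subL (subLL _) mgL.
have a2 := stable_approx mu_ge0 mu1 t0 A'C stv subL' (subLL _) mgL'.
(* The product is treated in two stages: [h] becomes [q] with [h'] in the weight, which is allowed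
   since [ws] is not in [A']; then [h'] becomes [q'] with [q] in the weight, since [vs] is not in
   [A]. *)
have a3 := stable_approx mu_ge0 mu1 t0 AC stw subL (subLL _) (f := fun o => g o * h' o).
have a4 := stable_approx mu_ge0 mu1 t0 A'C stv subL' (subLL _) (f := fun o => g o * q o).
have ng o : `|g o| <= 1 by rewrite ger0_norm.
have {}a1 := a1 ng; have {}a2 := a2 ng.
have {}a3 : `|Ex (fun o => g o * h' o * h o) - Ex (fun o => g o * h' o * q o)| <= tau.
  apply: a3 => [o o' k|o]; first by rewrite (mgL _ _ k) (mh' _ _ k).
  by rewrite ger0_norm ?mulr_ge0 // mulr_ile1.
have {}a4 : `|Ex (fun o => g o * q o * h' o) - Ex (fun o => g o * q o * q' o)| <= tau.
  apply: a4 => [o o' k|o]; first by rewrite (mgL' _ _ k) (mq _ _ k).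
  by rewrite ger0_norm; [apply: mulr_ile1 | apply: mulr_ge0].
rewrite -/h -/h' in a1 a2 a3 a4.
have e1 : Ex (fun o => g o * (h' o * h o + (1 - h o) * (1 - h' o))) =
  Ex g - Ex (fun o => g o * h o) - Ex (fun o => g o * h' o) + 2 * Ex (fun o => g o * h' o * h o).
  by rewrite -ExZ -!ExB -ExD; apply: eq_Ex => o; ring.
have e2 : Ex (fun o => g o * (q o * q' o + (1 - q o) * (1 - q' o))) =
  Ex g - Ex (fun o => g o * q o) - Ex (fun o => g o * q' o) + 2 * Ex (fun o => g o * q o * q' o).
  by rewrite -ExZ -!ExB -ExD; apply: eq_Ex => o; ring.
have e3 : Ex (fun o => g o * h' o * q o) = Ex (fun o => g o * q o * h' o).
  by apply: eq_Ex => o; ring.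
rewrite e1 in step3; rewrite e2; rewrite e3 in a3.
move: a1 a2 a3 a4; rewrite !ler_norml => /andP[? ?] /andP[? ?] /andP[? ?] /andP[? ?].
by move: step1 step3; lra.
Qed.

End TwoSlices.

(** * Signs of two independent predictions *)

Section SignArithmetic.
Variable R : realFieldType.

(** A fraction just below 0.5847; what matters most is that [1 - p0] stays under the threshold
    [21 / 50] of the tests, by [1 / 300]. *)
Definition p0 : R := 7%:R / 12%:R.

(** Here [m], [m'] are the probabilities that the predictions exceed 1/2, [n], [n'] the means of
    [1 - 2 q] and [1 - 2 q'] where they do not, and [G] the probability that the edge is open and
    both are low. If [m > 1 / 2], then [m m' + (1 - m)(1 - m') <= m] suffices. Otherwise both are
    below 1/2, and the two bounds of [G] contradict the last hypothesis. *)
Lemma majority_sign (m m' n n' G k : R) :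
  0 <= m <= 1 -> 0 <= m' <= 1 -> 0 <= n <= m - (2 * p0 - 1) ->
  0 <= n' <= m' - (2 * p0 - 1) -> 0 <= k <= 1 / 400%:R ->
  G <= (1 - m) * (1 - m') -> (2 * p0 - 1) * G <= n * n' + 2 * k ->
  p0 <= m * m' + G + 12%:R * k -> p0 - 12%:R * k <= m.
Proof.
rewrite /p0 => /andP[m0 m1] /andP[m0' m1'] /andP[n0 nm] /andP[n0' nm'] /andP[k0 k1] G1 G2 pG.
have [hm|hm] := ltP (1 / 2) m.
  have : 0 <= (1 - m') * (2 * m - 1) by apply: mulr_ge0; lra.
  lra.
exfalso.
have hm' : m' < 1 / 2.
  rewrite ltNge; apply/negP => hm'.
  have : 0 <= (1 / 2 - m) * (m' - 1 / 2) by apply: mulr_ge0; lra.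
  lra.
have nn : n * n' <= (m - (2 * (7%:R / 12%:R) - 1)) * (m' - (2 * (7%:R / 12%:R) - 1)).
  by apply: ler_pM => //; lra.
set s := m + m'; set D := m * m' in pG.
have Ds : 4%:R * D <= s ^+ 2.
  have := sqr_ge0 (m - m'); rewrite /s /D !expr2; lra.
have e1 : n * n' <= D - (2 * (7%:R / 12%:R) - 1) * s + (2 * (7%:R / 12%:R) - 1) ^+ 2.
  by apply: le_trans nn _; rewrite /D /s; lra.
have s1 : s <= 1 by rewrite /s; lra.
have s0 : 0 <= s by rewrite /s; lra.
have GD : G <= 1 - s + D by rewrite /s /D; lra.
clearbody s D.
(* For [s] below 4/5 the bound of [G] through [n n'] is already too small; from 4/5 on, the bound
   [1 - s + D] is. *)
have s4 : 4%:R / 5%:R <= s.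
  rewrite leNgt; apply/negP => h.
  have : s ^+ 2 <= 4%:R / 5%:R * s by rewrite expr2 ler_wpM2r // ltW.
  lra.
have : (1 - s) ^+ 2 <= (1 / 5%:R) ^+ 2.
  by rewrite lerXn2r // ?nnegrE; lra.
rewrite !expr2 in Ds *; lra.
Qed.

End SignArithmetic.

Section Sign.
Variables (R : realFieldType) (V : finType) (mu : conf V -> R).
Hypotheses (mu_ge0 : forall o, 0 <= mu o) (mu1 : \sum_o mu o = 1).
Hypothesis mu_indep : indep_on_disjoint mu.
Notation Ex := (Ex mu).
Notation p0 := (p0 R).
Implicit Types (o : conf V).

Definition half_lt (x : R) := 1 / 2 < x.

(** Note that [q q' + (1 - q)(1 - q') = (1 + (1 - 2 q)(1 - 2 q')) / 2]. Where the signs differ this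
    is at most 1/2, and [p0 - 1 / 2 = 1 / 12] gives the factor 12. Where both are low, independence
    bounds the mean of the product by [n n'], which feeds [majority_sign]. *)
Lemma sign_agreement (B B' : {set V}) (q q' : conf V -> R) (c : pred (conf V)) (k : R) :
  [disjoint B & B'] -> meas (sq B) q -> meas (sq B') q' ->
  (forall o, 0 <= q o <= 1) -> (forall o, 0 <= q' o <= 1) ->
  p0 <= Ex q -> p0 <= Ex q' -> p0 <= Ex (fun o => (c o)%:R) -> 0 <= k <= 1 / 400%:R ->
  (forall P : R -> R -> bool,
     p0 * Ex (fun o => (c o && P (q o) (q' o))%:R) <=
     Ex (fun o => (c o && P (q o) (q' o))%:R *
                  (q o * q' o + (1 - q o) * (1 - q' o))) + k) ->
  [/\ Ex (fun o => (c o && (half_lt (q o) != half_lt (q' o)))%:R) <= 12%:R * k,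
      p0 - 12%:R * k <= Ex (fun o => (half_lt (q o))%:R) &
      p0 - 12%:R * k <= Ex (fun o => (half_lt (q' o))%:R)].
Proof.
move=> dB mq mq' q01 q01' pq pq' pc k0 rel.
pose W o := half_lt (q o); pose W' o := half_lt (q' o).
have q0 o : 0 <= q o by case/andP: (q01 o).
have q1 o : q o <= 1 by case/andP: (q01 o).
have q0' o : 0 <= q' o by case/andP: (q01' o).
have q1' o : q' o <= 1 by case/andP: (q01' o).
have first : Ex (fun o => (c o && (W o != W' o))%:R) <= 12%:R * k.
  set g := Ex _.
  have h : p0 * g <= Ex (fun o => (c o && (W o != W' o))%:R *
      (q o * q' o + (1 - q o) * (1 - q' o))) + k := rel (fun x y => half_lt x != half_lt y).
  have : Ex (fun o => (c o && (W o != W' o))%:R * (q o * q' o + (1 - q o) * (1 - q' o)))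
      <= Ex (fun o => 1 / 2 * (c o && (W o != W' o))%:R).
    apply: Ex_le => // o; case: (c o) => //=; last by rewrite mul0r mulr0.
    case: (boolP (W o)) => w; case: (boolP (W' o)) => w' /=; rewrite ?mul0r ?mulr0 // ?mul1r ?mulr1.
      rewrite /W /W' /half_lt -leNgt in w w' *.
      have : 0 <= (2 * q o - 1) * (1 - 2 * q' o) by apply: mulr_ge0; lra.
      lra.
    rewrite /W /W' /half_lt -leNgt in w w' *.
    have : 0 <= (1 - 2 * q o) * (2 * q' o - 1) by apply: mulr_ge0; lra.
    lra.
  rewrite ExZ -/g => h2; move: h; rewrite /p0; move: h2 k0 => ? /andP[??]; lra.
set m := Ex (fun o => (W o)%:R); set m' := Ex (fun o => (W' o)%:R).
pose G := Ex (fun o => (c o && ~~ W o && ~~ W' o)%:R).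
pose n := - Ex (fun o => (~~ W o)%:R * (2 * q o - 1)).
pose n' := - Ex (fun o => (~~ W' o)%:R * (2 * q' o - 1)).
have mW : meas (sq B) (fun o => (W o)%:R : R) by move=> o o' a; rewrite /W (mq _ _ a).
have mW' : meas (sq B') (fun o => (W' o)%:R : R) by move=> o o' a; rewrite /W' (mq' _ _ a).
have mN : meas (sq B) (fun o => (~~ W o)%:R : R) by move=> o o' a; rewrite /W (mq _ _ a).
have mN' : meas (sq B') (fun o => (~~ W' o)%:R : R) by move=> o o' a; rewrite /W' (mq' _ _ a).
have ENE (w : pred (conf V)) : Ex (fun o => (~~ w o)%:R) = 1 - Ex (fun o => (w o)%:R).
  rewrite -[X in X - _](Ex_cst mu1) -ExB; apply: eq_Ex => o.
  by case: (w o); rewrite /= ?subrr ?subr0.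
have m01 (w : pred (conf V)) : 0 <= Ex (fun o => (w o)%:R) <= 1.
  rewrite Ex_ge0 //= -[leRHS](Ex_cst mu1); apply: Ex_le => // o; by case: (w o).
have GC : G <= (1 - m) * (1 - m').
  rewrite -!ENE -(Ex_indep mu_indep dB) //; apply: Ex_le => // o.
  by case: (c o); case: (W o); case: (W' o); rewrite /= ?mulr1 ?mulr0.
have pG : p0 <= m * m' + G + 12%:R * k.
  apply: le_trans pc _.
  apply: (@le_trans _ _ (Ex (fun o => (W o)%:R * (W' o)%:R) + G
     + Ex (fun o => (c o && (W o != W' o))%:R))); last first.
    by rewrite lerD // lerD // (Ex_indep mu_indep dB).
  rewrite -!ExD; apply: Ex_le => // o.
  by case: (c o); case: (W o); case: (W' o); rewrite /= ?mulr1 ?mulr0 ?addr0 ?add0r.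
(* The mean of [2 r - 1] is at least [2 p0 - 1], and the part where [r > 1 / 2] contributes at most
   the probability of that event. *)
have nE (w : pred (conf V)) r : (forall o, w o = half_lt (r o)) -> (forall o, 0 <= r o <= 1) ->
    p0 <= Ex r -> 0 <= - Ex (fun o => (~~ w o)%:R * (2 * r o - 1)) <=
      Ex (fun o => (w o)%:R) - (2 * p0 - 1).
  move=> wE r01 pr; rewrite -ExN; apply/andP; split.
    apply: Ex_ge0 => // o; rewrite wE /half_lt ltNge negbK oppr_ge0.
    by case: (leP (r o) (1 / 2)) => h; rewrite /= ?mul0r ?mul1r; lra.
  have : Ex (fun o => - ((~~ w o)%:R * (2 * r o - 1)) + (2 * r o - 1)) <= Ex (fun o => (w o)%:R).
    apply: Ex_le => // o; case/andP: (r01 o) => _ r1.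
    by case: (w o) => /=; rewrite ?mul0r ?mul1r; lra.
  rewrite ExD ExB ExZ (Ex_cst mu1); lra.
have nn := nE _ _ (fun o => erefl (W o)) q01 pq.
have nn' := nE _ _ (fun o => erefl (W' o)) q01' pq'.
have uG : (2 * p0 - 1) * G <= n * n' + 2 * k.
  have := rel (fun x y => ~~ half_lt x && ~~ half_lt y).
  under eq_Ex do rewrite andbA; rewrite -/G.
  under [X in _ <= X + _]eq_Ex do rewrite andbA.
  move=> h.
  have e : n * n' = Ex (fun o => (~~ W o)%:R * (2 * q o - 1) * ((~~ W' o)%:R * (2 * q' o - 1))).
    rewrite (Ex_indep mu_indep dB); first by rewrite mulrNN.
    - by move=> o o' a; rewrite (mN _ _ a) (mq _ _ a).
    - by move=> o o' a; rewrite (mN' _ _ a) (mq' _ _ a).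
  have : Ex (fun o => (c o && ~~ W o && ~~ W' o)%:R * (q o * q' o + (1 - q o) * (1 - q' o)) * 2)
     <= Ex (fun o => (c o && ~~ W o && ~~ W' o)%:R +
        (~~ W o)%:R * (2 * q o - 1) * ((~~ W' o)%:R * (2 * q' o - 1))).
    apply: Ex_le => // o; rewrite /W /W' /half_lt.
    case: ltP => w; rewrite /= ?andbF ?andbT ?(mul0r, mulr0, add0r) //=.
    case: ltP => w'; rewrite /= ?andbF ?andbT ?(mul0r, mulr0, add0r) //=.
    have : 0 <= (1 - 2 * q o) * (1 - 2 * q' o) by apply: mulr_ge0; lra.
    by case: (c o) => /=; rewrite ?mul0r ?mul1r; lra.
  rewrite ExZr ExD -e -/G; move: h; rewrite /W /W'; lra.
have am := majority_sign (m01 W) (m01 W') nn nn' k0 GC uG pG.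
split=> //; apply: (majority_sign (m01 W') (m01 W) nn' nn k0 (G := G)).
- by rewrite mulrC; exact: GC.
- by rewrite (mulrC (- _)); exact: uG.
- by rewrite (mulrC (Ex _)); exact: pG.
Qed.

End Sign.

(** * Two directions at once *)

Section PairArithmetic.
Variable R : realFieldType.
Implicit Types (a b y e s t P : R).

(** [m] is the least product of two numbers that are at least [49 / 100] and have sum [1 + t]. The
    slack is smallest near [t = 41 / 125], where it is below [1 / 1000]; this explains the first
    square in the proof. *)
Lemma pair_cubic t m : 0 <= t ->
  m = 49%:R / 100%:R * (1 + t) - (49%:R / 100%:R) ^+ 2 ->
  t * ((21%:R / 50%:R) ^+ 2 + (33%:R / 50%:R) ^+ 2 * m)
  < 2 * (33%:R / 50%:R) * m
    * (5%:R / 12%:R * (1 + t) * t + m * (1 / 4%:R - t / 2) - 1 / (20%:R * 100%:R)).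
Proof.
move=> t0 ->.
have : 0 <= (t - 41%:R / 125%:R) ^+ 2 * (111%:R / 1000%:R * t + 183%:R / 1000%:R).
  by apply: mulr_ge0; rewrite ?sqr_ge0 //; lra.
have : 0 <= t ^+ 3 by exact: exprn_ge0.
have : 0 <= (t - 1 / 4%:R) ^+ 2 by exact: sqr_ge0.
rewrite !expr2 !exprS !expr0; lra.
Qed.

(** The factor [3 / 4 - (a + b) / 2 = 1 / 4 - t / 2] changes sign at [t = 1 / 2]. Before, [a b] is
    bounded below by [m], and [y ^ 2] by its tangent at [33 / 50]. After, [a b <= (1 + t) ^ 2 / 4]
    yields explicit lower bounds of [y] on two intervals. *)
Lemma pair_overlap a b y e :
  49%:R / 100%:R <= a <= 1 -> 49%:R / 100%:R <= b <= 1 -> 0 <= y -> 0 <= e <= 1 / (20%:R * 100%:R) ->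
  0 <= a + b - 1 ->
  (5%:R / 12%:R) * (a + b) * (a + b - 1) + a * b * (3%:R / 4%:R - (a + b) / 2) - e
    <= (a + b - 1) * y ->
  (21%:R / 50%:R) ^+ 2 < a * b * y ^+ 2.
Proof.
move=> /andP[a0 a1] /andP[b0 b1] y0 /andP[e0 e1] s1 h.
rewrite ltNge; apply/negP => hy.
set t := a + b - 1 in s1 h.
pose m := 49%:R / 100%:R * (1 + t) - (49%:R / 100%:R) ^+ 2.
have mP : m <= a * b.
  have : 0 <= (a - 49%:R / 100%:R) * (b - 49%:R / 100%:R) by apply: mulr_ge0; lra.
  rewrite /m /t expr2; lra.
have Pm : 4%:R * (a * b) <= (1 + t) ^+ 2.
  have := sqr_ge0 (a - b); rewrite /t !expr2; lra.
have st : a + b = 1 + t by rewrite /t; lra.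
have t2 : t <= 1 by rewrite /t; lra.
rewrite st in h; set P := a * b in mP Pm h hy; clearbody t P; clear a0 a1 b0 b1 st.
have m0 : 0 < m by rewrite /m expr2; lra.
have y20 : 0 <= y ^+ 2 by exact: sqr_ge0.
have my : m * y ^+ 2 <= (21%:R / 50%:R) ^+ 2 by apply: le_trans hy; rewrite ler_wpM2r.
have [t12|t12] := lerP t (1 / 2).
  have cub := pair_cubic s1 (erefl m).
  have k1 : 2 * (33%:R / 50%:R) * m * y <= (21%:R / 50%:R) ^+ 2 + (33%:R / 50%:R) ^+ 2 * m.
    have : 0 <= m * (y - 33%:R / 50%:R) ^+ 2 by rewrite mulr_ge0 ?sqr_ge0 // ltW.
    by rewrite !expr2 in my *; lra.
  have k2 := ler_wpM2l s1 k1.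
  have k3 : 5%:R / 12%:R * (1 + t) * t + m * (1 / 4%:R - t / 2) - 1 / (20%:R * 100%:R) <= t * y.
    apply: le_trans h.
    have : 0 <= (P - m) * (1 / 4%:R - t / 2) by apply: mulr_ge0; lra.
    lra.
  have k4 : 0 <= 2 * (33%:R / 50%:R) * m by apply: mulr_ge0; [lra | exact: ltW].
  have k5 := ler_wpM2l k4 k3.
  lra.
have k1 : 5%:R / 12%:R * (1 + t) * t + (1 + t) ^+ 2 / 4%:R * (1 / 4%:R - t / 2) - 1 / (20%:R * 100%:R)
    <= t * y.
  apply: le_trans h.
  have : 0 <= ((1 + t) ^+ 2 / 4%:R - P) * (t / 2 - 1 / 4%:R) by apply: mulr_ge0; lra.
  lra.
have t0 : 0 < t by lra.
have [t13|t13] := lerP t (13%:R / 20%:R).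
  have : 3%:R / 5%:R <= y.
    rewrite -(ler_pM2l t0); apply: le_trans k1.
    have : 0 <= (t - 1 / 2) * (13%:R / 20%:R - t) by apply: mulr_ge0; lra.
    have : 0 <= (t - 1 / 2) * (13%:R / 20%:R - t) * t by rewrite !mulr_ge0 //; lra.
    have := sqr_ge0 (t - 23%:R / 40%:R).
    rewrite !expr2; lra.
  move=> hy'; have : (3%:R / 5%:R) ^+ 2 <= y ^+ 2 by apply: ler_sqr_nneg; lra.
  move=> hy2; have : 0 <= (m - 247%:R / 500%:R) * y ^+ 2.
    by apply: mulr_ge0 => //; rewrite /m expr2; lra.
  rewrite !expr2 in my hy2 *; lra.
have : 29%:R / 50%:R <= y.
  rewrite -(ler_pM2l t0); apply: le_trans k1.
  have : 0 <= (t - 13%:R / 20%:R) * (1 - t) by apply: mulr_ge0; lra.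
  have : 0 <= (t - 13%:R / 20%:R) * (1 - t) * t by rewrite !mulr_ge0 //; lra.
  have := sqr_ge0 (t - 9%:R / 10%:R).
  rewrite !expr2; lra.
move=> hy'; have : (29%:R / 50%:R) ^+ 2 <= y ^+ 2 by apply: ler_sqr_nneg; lra.
move=> hy2; have : 0 <= (m - 14%:R / 25%:R) * y ^+ 2.
  by apply: mulr_ge0 => //; rewrite /m expr2; lra.
rewrite !expr2 in my hy2 *; lra.
Qed.

End PairArithmetic.

Section PairBound.
Variable R : realFieldType.

(** Adding [b] times the first inequality to [1 - b] times the second one eliminates [x1]. *)
Lemma pair_step (a b x1 x2 e : R) : 0 <= b <= 1 ->
  x1 * (1 - b) + a * (p0 R - x2) <= a * (1 - b) + e ->
  x2 * (1 - a) + b * (p0 R - x1) <= b * (1 - a) + e ->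
  b * (a * p0 R - (1 - p0 R) * (1 - b)) - e <= x2 * (a + b - 1).
Proof.
move=> /andP[b0 b1] c1 c2; have c2' : 0 <= 1 - b by rewrite subr_ge0.
have := ler_wpM2l b0 c1; have := ler_wpM2l c2' c2; lra.
Qed.

(** [a], [b] stand for the conditional probabilities of reaching [s] and [t], [x1], [x2] for those
    of reaching [z] through [s] and through [t], and [y] for reaching it either way. For [a + b < 1]
    the eliminated inequality is violated; otherwise it bounds [x1] and [x2] from below, and thus
    [y]. *)
Lemma pair_bound (a b x1 x2 y e : R) :
  49%:R / 100%:R <= a <= 1 -> 49%:R / 100%:R <= b <= 1 -> 0 <= x1 -> 0 <= x2 -> 0 <= y ->
  0 <= e <= 1 / (60%:R * 100%:R) ->
  x1 * (1 - b) + a * (p0 R - x2) <= a * (1 - b) + e ->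
  x2 * (1 - a) + b * (p0 R - x1) <= b * (1 - a) + e ->
  x1 * (1 - b / 2) + x2 * (1 - a / 2) - e <= y ->
  (21%:R / 50%:R) ^+ 2 < a * b * y ^+ 2.
Proof.
move=> ha hb x10 x20 y0 he c1 c2 cy.
have a01 : 0 <= a <= 1 by case/andP: ha => ? ->; rewrite andbT; lra.
have b01 : 0 <= b <= 1 by case/andP: hb => ? ->; rewrite andbT; lra.
have s2 := pair_step b01 c1 c2; have s1 := pair_step a01 c2 c1.
rewrite (addrC b a) in s1; clear c1 c2.
have [s0|s0] := ltP (a + b - 1) 0.
  have : x2 * (a + b - 1) <= 0 by rewrite mulr_ge0_le0 // ltW.
  have : 49%:R / 100%:R * (49%:R / 100%:R * p0 R - (1 - p0 R) * (51%:R / 100%:R)) <=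
      b * (a * p0 R - (1 - p0 R) * (1 - b)).
    case/andP: ha => ha _; case/andP: hb => hb _.
    by apply: ler_pM; rewrite /p0; lra.
  case/andP: he; move: s2; rewrite /p0; lra.
case/andP: (he) => e0 e1.
apply: (pair_overlap ha hb y0 (e := 3%:R * e)) => //; first by rewrite mulr_ge0 //=; lra.
apply: le_trans (ler_wpM2l s0 cy).
case/andP: ha => ha0 ha1; case/andP: hb => hb0 hb1.
have k1 : 0 <= 1 - b / 2 by lra.
have k2 : 0 <= 1 - a / 2 by lra.
have := ler_wpM2l k1 s1; have := ler_wpM2l k2 s2.
have : 0 <= e * (2 - (a + b - 1)) by apply: mulr_ge0; lra.
have : 0 <= e * (a + b) by apply: mulr_ge0; lra.
rewrite /p0; lra.
Qed.

(** The left side is [a (1 - b) (e + f - 1)]. It is positive only if [a], [e], [f] hold and [b]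
    fails, that is, if the target is reached around the square but not inside its own subcube. *)
Lemma merge_indic (a e f b c : bool) : (a -> e -> f -> c) -> (b -> c) ->
  a%:R * e%:R + f%:R * a%:R - a%:R - a%:R * e%:R * b%:R - b%:R * f%:R * a%:R + a%:R * b%:R
  <= c%:R - b%:R :> R.
Proof.
move: a e f b c => [] [] [] [] [] h1 h2; (try by have := h1 isT isT isT); (try by have := h2 isT);
  by rewrite /= ?mulr1n ?mulr0n; lra.
Qed.

(** The intersection is replaced by the average of two larger events, each without one of the last
    edges. These two edges share a vertex, so nothing is known about their joint law. *)
Lemma union_indic (a e b f : bool) :
  a%:R * e%:R + b%:R * f%:R - 1 / 2 * (a%:R * e%:R * b%:R) - 1 / 2 * (b%:R * f%:R * a%:R)
  <= ((a && e) || (b && f))%:R :> R.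
Proof.
by move: a e b f => [] [] [] [];
  rewrite /= ?(mulr1n, mulr0n, mul1r, mul0r, mulr1, mulr0, subr0, addr0, add0r); lra.
Qed.

Lemma pair_merge (a b x1 x2 c u v1 v2 h p g es et e : R) : 0 <= a -> p <= c ->
  x1 + u - a - v1 - v2 + h <= g -> `|u - c * a| <= es -> `|v1 - x1 * b| <= et ->
  `|v2 - x2 * a| <= es -> `|h - a * b| <= et -> g + 2 * es + 2 * et <= e ->
  x1 * (1 - b) + a * (p - x2) <= a * (1 - b) + e.
Proof.
move=> a0 pc m /ler_normlP[h1 _] /ler_normlP[_ h2] /ler_normlP[_ h3] /ler_normlP[h4 _] ge.
have := ler_wpM2r a0 pc; lra.
Qed.

Lemma gain_le_l (g h s t : R) : 0 <= h -> g + 2 * t + 2 * s <= g + h + 2 * s + 2 * t.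
Proof. by move=> ?; lra. Qed.

Lemma gain_le_r (g h s t : R) : 0 <= g -> h + 2 * s + 2 * t <= g + h + 2 * s + 2 * t.
Proof. by move=> ?; lra. Qed.

Lemma union_bound (a b x1 x2 v1 v2 y gs gt es et : R) :
  x1 + x2 - 1 / 2 * v1 - 1 / 2 * v2 <= y -> `|v1 - x1 * b| <= et -> `|v2 - x2 * a| <= es ->
  0 <= gs -> 0 <= gt -> 0 <= es -> 0 <= et ->
  x1 * (1 - b / 2) + x2 * (1 - a / 2) - (gs + gt + 2 * es + 2 * et) <= y.
Proof. by move=> ? /ler_normlP[_ ?] /ler_normlP[_ ?] ? ? ? ?; lra. Qed.

Lemma err_total (gs gt es et tau : R) : gs <= tau -> gt <= tau -> es <= 2 * tau -> et <= 2 * tau ->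
  gs + gt + 2 * es + 2 * et <= 10%:R * tau.
Proof. by move=> *; lra. Qed.

Lemma err_nonneg (gs gt es et : R) : 0 <= gs -> 0 <= gt -> 0 <= es -> 0 <= et ->
  0 <= gs + gt + 2 * es + 2 * et.
Proof. by move=> *; lra. Qed.

Lemma indic_err (a q : R) : 1 / 2 < q -> a < 49%:R / 100%:R -> 1 <= 100%:R * `|a - q|.
Proof. by move=> h1 h2; have := ler_norm (q - a); rewrite distrC; lra. Qed.

Lemma pair_total (u v P tau : R) : u <= tau -> v <= tau -> P <= 600%:R * 100%:R * tau ->
  100%:R * u + 100%:R * v + P <= 602%:R * 100%:R * tau.
Proof. by move=> *; lra. Qed.

Lemma pair_indic (a q b q' : R) (c : bool) :
  ([&& 1 / 2 < q, 1 / 2 < q' & c])%:R <=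
  100%:R * `|a - q| + 100%:R * `|b - q'|
   + ((49%:R / 100%:R <= a) && (49%:R / 100%:R <= b) && c)%:R :> R.
Proof.
have := normr_ge0 (a - q); have := normr_ge0 (b - q'); have := @indic_err a q; have := @indic_err b q'.
move: (`|a - q|) (`|b - q'|) => u v.
case: (ltP (1 / 2) q) => //= _; last by move=> _ _ ? ?; case: (_ && _); rewrite /= ?mulr1n ?mulr0n; lra.
case: (ltP (1 / 2) q') => //= _; last by move=> _ _ ? ?; case: (_ && _); rewrite /= ?mulr1n ?mulr0n; lra.
case: (leP (49%:R / 100%:R) a) => _ /=; last first.
  by move=> _ /(_ isT isT) ? ? ?; case: c; rewrite /= ?mulr1n ?mulr0n; lra.
case: (leP (49%:R / 100%:R) b) => _ /=; last first.
  by move=> /(_ isT isT) ? _ ? ?; case: c; rewrite /= ?mulr1n ?mulr0n; lra.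
by move=> _ _ ? ?; case: c; rewrite /= ?mulr1n ?mulr0n; lra.
Qed.

Lemma err_scale (e tau : R) : e <= 10%:R * tau -> 60%:R * 100%:R * e <= 600%:R * 100%:R * tau.
Proof. by move=> *; lra. Qed.

Lemma err_large (e : R) : 1 / (60%:R * 100%:R) < e -> 1 <= 60%:R * 100%:R * e.
Proof. by move=> *; lra. Qed.

End PairBound.

Section Pair.
Variables (R : realFieldType) (V : finType) (mu : conf V -> R).
Hypotheses (mu_ge0 : forall o, 0 <= mu o) (mu1 : \sum_o mu o = 1).
Hypothesis mu_indep : indep_on_disjoint mu.
Notation Ex := (Ex mu).
Notation ce := (ce mu).
Notation p0 := (p0 R).
Implicit Types (o : conf V) (f g : conf V -> R).

(** By the tower property [f] may be replaced by [ce L f] next to [g]; what remains is the distance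
    from [ce L f] to [ce K f]. *)
Lemma ce_mul_approx (K L : rel V) f g o : subrel K L -> meas L g ->
  (forall o, 0 <= g o <= 1) ->
  `|ce K (fun o => g o * f o) o - ce K g o * ce K f o| <=
  ce K (fun o => `|ce L f o - ce K f o|) o.
Proof.
move=> KL mg g01; rewrite -(ce_tower mu_ge0 f o KL mg).
have -> : ce K g o * ce K f o = ce K (fun o => ce K f o * g o) o.
  by rewrite (@ce_out _ _ mu K g (ce K f) o (@meas_ce _ _ mu K f)) mulrC.
rewrite -ceB; apply: le_trans (ce_norm mu_ge0 _ _ _) _; apply: ce_le => // o'.
case/andP: (g01 o') => g0 g1.
by rewrite [X in _ - X]mulrC -mulrBr normrM ger0_norm // ler_piMl.
Qed.

Variables (As At B F : {set V}) (w s t z : V) (tau : R).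
Hypotheses (sAs : s \in As) (tAt : t \in At).
Hypotheses (sAt : s \notin At) (tAs : t \notin As) (AsB : As \subset B) (AtB : At \subset B).
Hypotheses (zB : z \in B) (zs : z != s) (zt : z != t) (st : s != t).
Hypotheses (AsF : As :\ s \subset F) (AtF : At :\ t \subset F) (FB : F \subset B).
Hypotheses (sF : s \notin F) (tF : t \notin F) (zF : z \notin F).
Hypotheses (tau0 : 0 < tau).
Hypotheses (stab_s : Psi mu B w s - Psi mu As w s <= tau ^+ 2)
           (stab_t : Psi mu B w t - Psi mu At w t <= tau ^+ 2).
Hypotheses (ps : p0 <= Ex (fun o => (op o s z)%:R)) (pt : p0 <= Ex (fun o => (op o t z)%:R)).

(** [z] is the fourth vertex of the square through [w], [s], [t]. As [s], [t], [z] are not in [F],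
    each of the edges [s z] and [t z] is independent of the edges in [F]. *)
Definition reach_pair As At w s t z o :=
  (conn o As w s && op o s z) || (conn o At w t && op o t z).

Let K := sq F.
Let hs := hit R As w s.
Let ht := hit R At w t.
Let es o : R := (op o s z)%:R.
Let et o : R := (op o t z)%:R.

Let prd_pair_s : Ex (fun o => `|ce K hs o - prd mu As w s o|) <= tau.
Proof.
apply: (stable_prd mu_ge0 mu1 tau0 AsB stab_s); first exact: sqS.
apply: sqS; apply/subsetP => x xF; rewrite !inE (subsetP FB) // andbT.
by apply: contraNneq sF => <-.
Qed.

Let prd_pair_t : Ex (fun o => `|ce K ht o - prd mu At w t o|) <= tau.
Proof.
apply: (stable_prd mu_ge0 mu1 tau0 AtB stab_t); first exact: sqS.
apply: sqS; apply/subsetP => x xF; rewrite !inE (subsetP FB) // andbT.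
by apply: contraNneq tF => <-.
Qed.

Let KBs : subrel K (sq (B :\ s)).
Proof.
apply: sqS; apply/subsetP => x xF; rewrite !inE (subsetP FB) // andbT.
by apply: contraNneq sF => <-.
Qed.

Let KBt : subrel K (sq (B :\ t)).
Proof.
apply: sqS; apply/subsetP => x xF; rewrite !inE (subsetP FB) // andbT.
by apply: contraNneq tF => <-.
Qed.

Let err_s o := ce K (fun o => `|ce (sq (B :\ s)) hs o - ce K hs o|) o.
Let err_t o := ce K (fun o => `|ce (sq (B :\ t)) ht o - ce K ht o|) o.
Let gain_s o := ce K (fun o => hit R B w s o - hs o) o.
Let gain_t o := ce K (fun o => hit R B w t o - ht o) o.
Let err o := gain_s o + gain_t o + 2 * err_s o + 2 * err_t o.

Let Ex_err_aux (A : {set V}) x : A \subset B -> A :\ x \subset F -> subrel K (sq (B :\ x)) ->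
  Psi mu B w x - Psi mu A w x <= tau ^+ 2 ->
  Ex (ce K (fun o => `|ce (sq (B :\ x)) (hit R A w x) o - ce K (hit R A w x) o|))
    <= 2 * tau.
Proof.
move=> AB AF KB stab; rewrite Ex_ce1 // mulr_natl mulr2n.
have h1 := stable_prd mu_ge0 mu1 tau0 AB stab (sqS AF) KB.
have h2 := stable_prd mu_ge0 mu1 tau0 AB stab (fun u v h => KB u v (sqS AF h)) (fun _ _ h => h).
apply: le_trans (lerD h2 h1); rewrite -ExD; apply: Ex_le => // o.
by rewrite [X in _ <= _ + X]distrC; exact: ler_distD.
Qed.

Let err_ge0 o : [/\ 0 <= gain_s o, 0 <= gain_t o, 0 <= err_s o & 0 <= err_t o].
Proof.
split; apply: ce_ge0 => // o'; rewrite ?subr_ge0; first exact: hit_sub.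
exact: hit_sub.
Qed.

Let Ex_err : Ex err <= 10%:R * tau.
Proof.
have h1 : Ex gain_s <= tau by rewrite Ex_ce1 //; apply (stable_gain mu_ge0 mu1 tau0 AsB stab_s).
have h2 : Ex gain_t <= tau by rewrite Ex_ce1 //; apply (stable_gain mu_ge0 mu1 tau0 AtB stab_t).
have h3 : Ex err_s <= 2 * tau := Ex_err_aux AsB AsF KBs stab_s.
have h4 : Ex err_t <= 2 * tau := Ex_err_aux AtB AtF KBt stab_t.
have -> : Ex err = Ex gain_s + Ex gain_t + 2 * Ex err_s + 2 * Ex err_t.
  by rewrite -!ExZ -!ExD.
exact: err_total.
Qed.

Let ind01 (b : bool) : 0 <= (b%:R : R) <= 1. Proof. by case: b; rewrite /= ?lexx ?ler01. Qed.

Let mes (C : {set V}) : s \in C -> z \in C -> meas (sq C) es.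
Proof. by move=> sC zC o o' k; rewrite /es (meas_op sC zC k). Qed.
Let met (C : {set V}) : t \in C -> z \in C -> meas (sq C) et.
Proof. by move=> sC zC o o' k; rewrite /et (meas_op sC zC k). Qed.

Let inBt x : x \in B -> x != t -> x \in B :\ t. Proof. by rewrite !inE => -> ->. Qed.
Let inBs x : x \in B -> x != s -> x \in B :\ s. Proof. by rewrite !inE => -> ->. Qed.

Let AsBt : As \subset B :\ t.
Proof. by apply/subsetP => x xA; apply: inBt (subsetP AsB _ xA) _; apply: contraNneq tAs => <-. Qed.
Let AtBs : At \subset B :\ s.
Proof. by apply/subsetP => x xA; apply: inBs (subsetP AtB _ xA) _; apply: contraNneq sAt => <-. Qed.

Let mhs : meas (sq (B :\ t)) hs := meas_hit R w s AsBt.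
Let mht : meas (sq (B :\ s)) ht := meas_hit R w t AtBs.

Let y := ce K (fun o => (reach_pair As At w s t z o)%:R).

(** Given the edges in [F], reaching [s] is almost independent of events that avoid [s], and
    reaching [t] of events that avoid [t]. A detour to [t] by [s] and [z] is a gain from enlarging
    [At] to [B], hence rare, and likewise for [s]. This yields the hypotheses of [pair_bound]. *)
Let pair_ae o : 0 < mu o -> err o <= 1 / (60%:R * 100%:R) ->
  49%:R / 100%:R <= ce K hs o -> 49%:R / 100%:R <= ce K ht o ->
  (21%:R / 50%:R) ^+ 2 < ce K hs o * ce K ht o * y o ^+ 2.
Proof.
move=> m0 eo ha hb; have [gs0 gt0 es0 et0] := err_ge0 o.
pose a := ce K hs o; pose b := ce K ht o.
pose x1 := ce K (fun o => hs o * es o) o; pose x2 := ce K (fun o => ht o * et o) o.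
have sB := subsetP AsB _ sAs; have tB := subsetP AtB _ tAt.
have hs01 o' : 0 <= hs o' <= 1 := ind01 _.
have ht01 o' : 0 <= ht o' <= 1 := ind01 _.
have es01 o' : 0 <= es o' <= 1 := ind01 _.
have et01 o' : 0 <= et o' <= 1 := ind01 _.
have prod01 (f g : conf V -> R) : (forall o, 0 <= f o <= 1) -> (forall o, 0 <= g o <= 1) ->
    forall o, 0 <= f o * g o <= 1.
  move=> hf hg o'; case/andP: (hf o') => ? ?; case/andP: (hg o') => ? ?.
  by rewrite mulr_ge0 // mulr_ile1.
have ce01 f : (forall o, 0 <= f o <= 1) -> 0 <= ce K f o <= 1.
  move=> hf; rewrite ce_ge0 ?ce_le1 // => o'; by case/andP: (hf o').
have cE x : x \in B -> x \notin F -> p0 <= Ex (fun o => (op o x z)%:R) ->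
    p0 <= ce K (fun o => (op o x z)%:R) o.
  move=> xB xF px; rewrite (ce_indep mu_ge0 mu_indep (B := [set x; z])) //.
    rewrite disjoint_sym disjoints_subset; apply/subsetP => u.
    by rewrite !inE => /orP[]/eqP ->.
  by move=> o1 o2 k; rewrite (meas_op _ _ k) // !inE eqxx ?orbT.
have i1 : `|ce K (fun o => hs o * es o * ht o) o - x1 * b| <= err_t o.
  apply: (ce_mul_approx ht o KBt _ (prod01 _ _ hs01 es01)) => o1 o2 k.
  rewrite (mhs k) (mes (inBt sB st) (inBt zB zt) k) //.
have i2 : `|ce K (fun o => hs o * ht o) o - a * b| <= err_t o by exact: ce_mul_approx.
have i3 : `|ce K (fun o => ht o * et o * hs o) o - x2 * a| <= err_s o.
  apply: (ce_mul_approx hs o KBs _ (prod01 _ _ ht01 et01)) => o1 o2 k.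
  by rewrite (mht k) (met (inBs tB _) (inBs zB zs) k) // eq_sym.
have i4 : `|ce K (fun o => et o * hs o) o - ce K et o * a| <= err_s o.
  by apply: (ce_mul_approx hs o KBs _ et01); apply: met; apply: inBs => //; rewrite eq_sym.
have i5 : `|ce K (fun o => es o * ht o) o - ce K es o * b| <= err_t o.
  by apply: (ce_mul_approx ht o KBt _ es01); apply: mes; apply: inBt.
have pes : p0 <= ce K es o by exact: cE.
have pet : p0 <= ce K et o by exact: cE.
have lin (f1 f2 f3 f4 f5 f6 g : conf V -> R) :
    (forall o, f1 o + f2 o - f3 o - f4 o - f5 o + f6 o <= g o) ->
    ce K f1 o + ce K f2 o - ce K f3 o - ce K f4 o - ce K f5 o + ce K f6 o <= ce K g o.
  by move=> h; rewrite -ceD -!ceB -ceD; exact: ce_le.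
have i2' : `|ce K (fun o => hs o * ht o) o - b * a| <= err_s o.
  rewrite (eq_ce mu _ (g := fun o => ht o * hs o)); first exact: (ce_mul_approx hs o KBs mht ht01).
  by move=> o'; rewrite mulrC.
have merge_t : x1 + ce K (fun o => et o * hs o) o - a
     - ce K (fun o => hs o * es o * ht o) o - ce K (fun o => ht o * et o * hs o) o
     + ce K (fun o => hs o * ht o) o <= gain_t o.
  apply: lin => o'; apply: merge_indic; last exact: conn_sub.
  move=> k1 k2 k3; apply: conn_trans (conn_trans (conn_sub AsB k1) (conn1 sB zB k2)) _.
  by rewrite connC; exact: conn1.
have merge_s : x2 + ce K (fun o => es o * ht o) o - b
     - ce K (fun o => ht o * et o * hs o) o - ce K (fun o => hs o * es o * ht o) o
     + ce K (fun o => hs o * ht o) o <= gain_s o.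
  apply: lin => o'; rewrite [X in _ + X <= _]mulrC; apply: merge_indic; last exact: conn_sub.
  move=> k1 k2 k3; apply: conn_trans (conn_trans (conn_sub AtB k1) (conn1 tB zB k2)) _.
  by rewrite connC; exact: conn1.
have yl : x1 + x2 - 1 / 2 * ce K (fun o => hs o * es o * ht o) o
    - 1 / 2 * ce K (fun o => ht o * et o * hs o) o <= y o.
  by rewrite -!ceZ -ceD -!ceB; apply: ce_le => // o'; exact: union_indic.
have [/andP[a0 a1] /andP[b0 b1]] := (ce01 _ hs01, ce01 _ ht01); rewrite -/a -/b in a0 a1 b0 b1.
have eE : err o = gain_s o + gain_t o + 2 * err_s o + 2 * err_t o by [].
apply: (@pair_bound R a b x1 x2 (y o) (err o)).
- by rewrite a1 andbT.
- by rewrite b1 andbT.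
- by case/andP: (ce01 _ (prod01 _ _ hs01 es01)).
- by case/andP: (ce01 _ (prod01 _ _ ht01 et01)).
- by apply: ce_ge0 => // o'; exact: ler0n.
- by rewrite eo andbT eE; exact: err_nonneg.
- apply: (pair_merge a0 pet merge_t i4 i1 i3 i2).
  by rewrite eE; exact: gain_le_r.
- rewrite -/b in i1 *; apply: (pair_merge (es := err_t o) (et := err_s o) b0 pes merge_s i5 i3 i1 i2').
  by rewrite eE; exact: gain_le_l.
- exact: union_bound yl i1 i3 gs0 gt0 es0 et0.
Qed.

Let pair_Ex :
  Ex (fun o => ((49%:R / 100%:R <= ce K hs o) && (49%:R / 100%:R <= ce K ht o) &&
     (ce K hs o * ce K ht o * y o ^+ 2 <= (21%:R / 50%:R) ^+ 2))%:R) <= 600%:R * 100%:R * tau.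
Proof.
apply: (@le_trans _ _ (Ex (fun o => 60%:R * 100%:R * err o))); last first.
  by rewrite ExZ; exact: err_scale Ex_err.
apply: Ex_leae => // o m0; case: (leP (err o) (1 / (60%:R * 100%:R))) => eo; last first.
  apply: (@le_trans _ _ 1); first by case: (_ && _).
  exact: err_large.
have -> : (49%:R / 100%:R <= ce K hs o) && (49%:R / 100%:R <= ce K ht o) &&
     (ce K hs o * ce K ht o * y o ^+ 2 <= (21%:R / 50%:R) ^+ 2) = false.
  apply/negP => /andP[/andP[ha hb]]; rewrite leNgt (pair_ae m0 eo ha hb) //.
by have [? ? ? ?] := err_ge0 o; apply: mulr_ge0; [rewrite mulr_ge0 ?ler0n|exact: err_nonneg].
Qed.
(** Each passage from a prediction above [1 / 2] to a value at least [49 / 100] costs [100 tau] by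
    Markov's inequality; the remaining [600 * 100] comes from [err > 1 / 6000] and
    [Ex err <= 10 tau]. *)
Lemma pair_half :
  Ex (fun o => ([&& 1 / 2 < prd mu As w s o, 1 / 2 < prd mu At w t o &
     ce K hs o * ce K ht o * y o ^+ 2 <= (21%:R / 50%:R) ^+ 2])%:R) <= 602%:R * 100%:R * tau.
Proof.
apply: le_trans (pair_total prd_pair_s prd_pair_t pair_Ex).
rewrite -!ExZ -!ExD; apply: Ex_le => // o.
exact: pair_indic.
Qed.
End Pair.

(** * Sequential tests *)

Section Tests.
Variables (R : realFieldType) (V : finType) (mu : conf V -> R).
Hypotheses (mu_ge0 : forall o, 0 <= mu o) (mu1 : \sum_o mu o = 1).
Hypothesis mu_indep : indep_on_disjoint mu.
Notation Ex := (Ex mu).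
Notation ce := (ce mu).
Notation p0 := (p0 R).
Implicit Types (o : conf V).

Lemma Ex_sq_orth k (d : nat -> conf V -> R) :
  (forall i o, (i < k)%N -> `|d i o| <= 1) ->
  (forall i j, (j < i < k)%N -> Ex (fun o => d j o * d i o) = 0) ->
  Ex (fun o => (\sum_(i < k) d i o) ^+ 2) <= k%:R.
Proof.
elim: k => [|k IHk] d1 orth.
  by under eq_Ex do rewrite big_ord0 expr0n; rewrite Ex_cst.
have -> : Ex (fun o => (\sum_(i < k.+1) d i o) ^+ 2) =
    Ex (fun o => (\sum_(i < k) d i o) ^+ 2) + 2 * \sum_(i < k) Ex (fun o => d i o * d k o)
     + Ex (fun o => d k o ^+ 2).
  rewrite -Ex_sum -ExZ -!ExD; apply: eq_Ex => o.
  rewrite big_ord_recr /= -big_distrl /=; ring.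
rewrite big1 => [|i _]; last by apply: orth; rewrite ltn_ord /=.
rewrite mulr0 addr0 -natr1; apply: lerD.
  by apply: IHk => [i o ik|i j /andP[ji ik]]; [apply: d1|apply: orth]; rewrite ?ji ltnS ltnW.
rewrite -[leRHS](Ex_cst mu1); apply: Ex_le => // o.
by rewrite -(real_normK (num_real _)) expr_le1 // d1.
Qed.

Lemma Ex_orth k (lam : R) (d : nat -> conf V -> R) (n : pred (conf V)) :
  0 < lam -> k%:R <= lam ^+ 2 -> (forall i o, (i < k)%N -> `|d i o| <= 1) ->
  (forall i j, (j < i < k)%N -> Ex (fun o => d j o * d i o) = 0) ->
  Ex (fun o => (n o)%:R * \sum_(i < k) d i o) <= lam.
Proof.
move=> l0 kl d1 orth.
apply: le_trans (Ex_norm_le mu_ge0 mu1 l0 (le_trans (Ex_sq_orth d1 orth) kl)).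
apply: Ex_le => // o; case: (n o); rewrite ?mul1r ?mul0r ?normr_ge0 //.
exact: ler_norm.
Qed.

(** Without a connection, two reached targets force the edge between them to be closed, so the
    indicators of [a && b] and of [e] add up to at most 1. *)
Lemma test_indic (a b e : bool) (y q p : R) : (a -> b -> e -> False) -> p <= q ->
  y - (1 - p) <= y - (a && b)%:R + (q - e%:R).
Proof.
move: a b e => [] [] [] h pq; try (by have := h isT isT isT);
  by move: pq; clear; rewrite /= ?mulr1n ?mulr0n => ?; lra.
Qed.

Variables (k : nat) (lam : R) (F B F' B' : nat -> {set V}) (x x' : nat -> V).
Variables (Z Z' : nat -> pred (conf V)) (n : pred (conf V)).
Hypotheses (lam0 : 0 < lam) (klam : k%:R <= lam ^+ 2).
Hypothesis FB : forall i, (i < k)%N -> F i \subset B i.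
Hypothesis FB' : forall i, (i < k)%N -> F' i \subset B' i.
Hypothesis BF : forall i j, (j < i < k)%N -> B j \subset F i.
Hypothesis BF' : forall i j, (j < i < k)%N -> B' j \subset F' i.
Hypothesis dis : forall i, (i < k)%N -> [disjoint B i & B' i].
Hypothesis xB : forall i, (i < k)%N -> (x i \in B i) && (x i \notin F i).
Hypothesis xB' : forall i, (i < k)%N -> (x' i \in B' i) && (x' i \notin F' i).
Hypothesis mZ : forall i, (i < k)%N -> meas (sq (B i)) (Z i).
Hypothesis mZ' : forall i, (i < k)%N -> meas (sq (B' i)) (Z' i).
Hypothesis pe : forall i, (i < k)%N -> p0 <= Ex (fun o => (op o (x i) (x' i))%:R).
Hypothesis nZ : forall i o, (i < k)%N -> n o -> Z i o -> Z' i o -> op o (x i) (x' i) -> False.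

Let z i := ce (sq (F i)) (fun o => (Z i o)%:R).
Let z' i := ce (sq (F' i)) (fun o => (Z' i o)%:R).

(* Since 21/50 > [1 - p0], a positive test gains at least a constant: the probability that both targets are
   reached, minus the probability that the edge between them is closed. *)
Definition test (z z' : conf V -> R) o : R :=
  (21%:R / 50%:R < z o * z' o)%R%:R * (z o * z' o - (1 - p0)).

Let K i := relU (sq (F i)) (sq (F' i)).
Let tau i o : bool := 21%:R / 50%:R < z i o * z' i o.
Let d1 i o := (tau i o)%:R * (z i o * z' i o - (Z i o && Z' i o)%:R).
Let d2 i o := (tau i o)%:R * (Ex (fun o => (op o (x i) (x' i))%:R) - (op o (x i) (x' i))%:R).

Let z01 i o : 0 <= z i o <= 1.
Proof. by rewrite ce_ge0 ?ce_le1 // => o'; case: (Z i o'). Qed.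
Let z01' i o : 0 <= z' i o <= 1.
Proof. by rewrite ce_ge0 ?ce_le1 // => o'; case: (Z' i o'). Qed.

Let mz i : meas (K i) (z i).
Proof. by apply: meas_sub (@meas_ce _ _ _ _ _) => u v h; rewrite /K /relU h. Qed.
Let mz' i : meas (K i) (z' i).
Proof. by apply: meas_sub (@meas_ce _ _ _ _ _) => u v h; rewrite /K /relU h orbT. Qed.
Let mtau i : meas (K i) (tau i).
Proof. by move=> o o' h; rewrite /tau (mz h) (mz' h). Qed.

Let KK i j : (j < i < k)%N -> subrel (K j) (K i).
Proof.
move=> ji u v; have jk : (j < k)%N by case/andP: ji => ji; apply: ltn_trans.
rewrite /K /relU => /orP[h|h]; apply/orP; [left|right]; apply: sqS h.
  exact: subset_trans (FB jk) (BF ji).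
exact: subset_trans (FB' jk) (BF' ji).
Qed.

Let unit_diff (t b : bool) (y : R) : 0 <= y <= 1 -> `|t%:R * (y - b%:R)| <= 1.
Proof.
case/andP=> y0 y1; case: t => /=; rewrite ?mul0r ?normr0 ?ler01 // mul1r ler_norml.
by case: b => /=; lra.
Qed.

Let mZj i j : (j < i < k)%N -> meas (K i) (Z j).
Proof.
move=> ji; have jk : (j < k)%N by case/andP: ji => ji; apply: ltn_trans.
apply: meas_sub (mZ jk) => u v /(sqS (BF ji)) h.
by rewrite /K /relU h.
Qed.
Let mZj' i j : (j < i < k)%N -> meas (K i) (Z' j).
Proof.
move=> ji; have jk : (j < k)%N by case/andP: ji => ji; apply: ltn_trans.
apply: meas_sub (mZ' jk) => u v /(sqS (BF' ji)) h.
by rewrite /K /relU h orbT.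
Qed.

(** Given [K i] the two sides are conditionally independent, so [z i * z' i] is the conditional
    probability of reaching both targets, while all earlier tests are measurable. *)
Let orth1 i j : (j < i < k)%N -> Ex (fun o => d1 j o * d1 i o) = 0.
Proof.
move=> ji; have ik : (i < k)%N by case/andP: ji.
pose g o := d1 j o * (tau i o)%:R.
have mg : meas (K i) g.
  move=> o o' h; have hj := agree_sub (KK ji) h.
  by rewrite /g /d1 (mtau hj) (mz hj) (mz' hj) (mZj ji h) (mZj' ji h) (mtau h).
have prE o : ce (K i) (fun o => (Z i o)%:R * (Z' i o)%:R) o = z i o * z' i o.
  apply: (ce_prod mu_indep o (dis ik) (FB ik) (FB' ik)) => o1 o2 h.
    by rewrite (mZ ik h).
  by rewrite (mZ' ik h).
have := Ex_ce mu_ge0 (fun o => (Z i o)%:R * (Z' i o)%:R) mg.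
under eq_Ex do rewrite prE.
move=> e; transitivity (Ex (fun o => z i o * z' i o * g o - (Z i o)%:R * (Z' i o)%:R * g o)).
  by apply: eq_Ex => o; rewrite /d1 -/(d1 j o) -mulnb natrM /g; ring.
by rewrite ExB e subrr.
Qed.

(** An earlier edge from [x j] to [x' j] runs between the two sides and is not covered by [K i]. It
    lies inside [F i :|: F' i], however, and this set avoids [x i] and [x' i]; so independence takes
    the place of conditioning. *)
Let orth2 i j : (j < i < k)%N -> Ex (fun o => d2 j o * d2 i o) = 0.
Proof.
move=> ji; have /andP[jlti ik] := ji; have jk := ltn_trans jlti ik.
pose A := F i :|: F' i; pose g o := d2 j o * (tau i o)%:R.
have KA : subrel (K i) (sq A).
  by move=> u v /orP[] h; apply: sqS h; rewrite ?subsetUl ?subsetUr.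
have mg : meas (sq A) g.
  move=> o o' h; have hi := agree_sub KA h; have hj := agree_sub (KK ji) hi.
  rewrite /g /d2 (mtau hj) (mtau hi) (meas_op _ _ h) //.
    by have /andP[xj _] := xB jk; rewrite inE (subsetP (BF ji)).
  by have /andP[xj _] := xB' jk; rewrite inE (subsetP (BF' ji)) ?orbT.
have dA : [disjoint A & [set x i; x' i]].
  rewrite disjoint_sym disjoints_subset; apply/subsetP => y.
  have /andP[xi xiF] := xB ik; have /andP[xi' xiF'] := xB' ik.
  rewrite !inE => /orP[]/eqP ->; rewrite negb_or ?xiF ?xiF' ?andbT /=.
    by apply: contraFN (disjointFr (dis ik) xi) => /(subsetP (FB' ik)).
  by apply: contraFN (disjointFl (dis ik) xi') => /(subsetP (FB ik)).
transitivity (Ex (fun o => g o * (Ex (fun o => (op o (x i) (x' i))%:R) - (op o (x i) (x' i))%:R))).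
  by apply: eq_Ex => o; rewrite /g /d2 -/(d2 j o); ring.
rewrite (Ex_indep mu_indep dA mg) ?ExB ?Ex_cst ?subrr ?mulr0 //.
by move=> o o' h; rewrite (meas_op _ _ h) // !inE eqxx ?orbT.
Qed.

(** On [n] every test is at most the sum of two orthogonal increments. So the tests together
    contribute only the order of the square root of [k], whereas a positive proportion of successful
    ones would contribute the order of [k]. *)
Lemma sequential_tests : Ex (fun o => (n o)%:R * \sum_(i < k) test (z i) (z' i) o) <= 2 * lam.
Proof.
have h1 : Ex (fun o => (n o)%:R * \sum_(i < k) d1 i o) <= lam.
  apply: Ex_orth orth1 => // i o _; apply: unit_diff.
  case/andP: (z01 i o) => a0 a1; case/andP: (z01' i o) => b0 b1.
  by rewrite mulr_ge0 //= mulr_ile1.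
have h2 : Ex (fun o => (n o)%:R * \sum_(i < k) d2 i o) <= lam.
  apply: Ex_orth orth2 => // i o _; apply: unit_diff.
  rewrite Ex_ge0 //= -[leRHS](Ex_cst mu1); apply: Ex_le => // o'; by case: op.
rewrite mulr_natl mulr2n; apply: le_trans (lerD h1 h2).
rewrite -ExD; apply: Ex_le => // o; rewrite -mulrDr -big_split /=.
case no: (n o); rewrite ?mul0r // !mul1r; apply: ler_sum => -[i ik] _.
rewrite /test /d1 /d2 -/(tau i o) -mulrDr ler_wpM2l ?ler0n //=.
by apply: test_indic (pe ik) => ? ? ?; apply: (nZ ik no).
Qed.

Lemma test_ge0 (y y' : conf V -> R) o : 0 <= test y y' o.
Proof.
rewrite /test; case: ltP => h /=; rewrite ?mul0r // mul1r /p0.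
by move: h; move: (y o * y' o); move=> ? ?; lra.
Qed.

Lemma test_ge (y y' : conf V -> R) o : 21%:R / 50%:R < y o * y' o -> 1 / 300%:R <= test y y' o.
Proof.
move=> h; rewrite /test h /= !mul1r /p0.
by move: h; move: (y o * y' o); move=> ? ?; lra.
Qed.

End Tests.

(** * Subcubes *)

Section Cosets.
Variable J : finType.
Implicit Types (U w T : {set J}) (t : J).

(* The subcube through [w] with directions [U]. *)
Definition Q U w := [set T : {set J} | T :\: U == w :\: U].

Lemma mem_Q U w T : (T \in Q U w) = (T :\: U == w :\: U).
Proof. by rewrite inE. Qed.

Lemma Q_refl U w : w \in Q U w. Proof. by rewrite inE. Qed.

Lemma Q_out U w T t : T \in Q U w -> t \notin U -> (t \in T) = (t \in w).
Proof. by rewrite inE => /eqP/setP/(_ t); rewrite !inE => + tU; rewrite tU. Qed.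

Lemma Q_sub U U' w : U \subset U' -> Q U w \subset Q U' w.
Proof.
move=> UU'; apply/subsetP => T; rewrite !inE => /eqP h; apply/eqP.
have D A : A :\: U' = (A :\: U) :\: U' by rewrite setDDl (setUidPr UU').
by rewrite (D T) h -D.
Qed.

Lemma Q_add U w T t : t \in U -> T \in Q U w -> t |: T \in Q U w.
Proof.
move=> tU; rewrite !inE => /eqP h; apply/eqP; rewrite -h setDUl.
by rewrite (_ : [set t] :\: U = set0) ?set0U //; apply/eqP; rewrite setD_eq0 sub1set.
Qed.

Lemma Q_disjoint U U' w w' r : r \notin U -> r \notin U' -> (r \in w) != (r \in w') ->
  [disjoint Q U w & Q U' w'].
Proof.
move=> rU rU' rw; rewrite disjoints_subset; apply/subsetP => T hT.
rewrite inE; apply: contra rw => hT'.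
by rewrite -(Q_out hT rU) (Q_out hT' rU').
Qed.

End Cosets.

Lemma double_cases a b : [/\ a.*2 = b.*2 -> a = b, a.*2 = b.*2.+1 -> a = b,
  a.*2.+1 = b.*2 -> a = b & a.*2.+1 = b.*2.+1 -> a = b].
Proof. by split; lia. Qed.

Section OneSide.
Variables (R : realFieldType) (J : finType) (mu : conf {set J} -> R).
Hypotheses (mu_ge0 : forall o, 0 <= mu o) (mu1 : \sum_o mu o = 1).
Hypothesis mu_indep : indep_on_disjoint mu.
Notation Ex := (Ex mu).
Notation ce := (ce mu).
Notation p0 := (p0 R).
Implicit Types (o : conf {set J}).

Definition cube_open := forall (w : {set J}) r, r \notin w -> p0 <= Ex (fun o => (op o w (r |: w))%:R).

Definition stable tau (U D w : {set J}) := forall t, t \in D ->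
  Psi mu (Q (U :|: D) w) w (t |: w) - Psi mu (Q (t |: U) w) w (t |: w) <= tau ^+ 2.

Definition nbad (U D w : {set J}) o :=
  #|[set t in D | prd mu (Q (t |: U) w) w (t |: w) o <= 1 / 2]|.

(** With at most a twentieth of the directions bad at either end of an edge, at least four fifths of
    the disjoint pairs of directions are clean at both ends. *)
Definition good U D w o := (nbad U D w o * 20 <= #|D|)%N.

Hypothesis mu_open : cube_open.
Variables (tau : R) (U D w : {set J}) (e : nat -> J) (k : nat).
Hypotheses (tau0 : 0 < tau) (st : stable tau U D w).
Hypotheses (dDU : [disjoint D & U]) (dDw : [disjoint D & w]).
Hypothesis eD : forall i, (i < k.*2)%N -> e i \in D.
Hypothesis einj : forall i j, (i < k.*2)%N -> (j < k.*2)%N -> e i = e j -> i = j.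

(** The blocks increase, each using two new directions of [D]. The targets [sv i], [tv i], [zv i]
    involve new directions, so they lie outside the earlier blocks, which are therefore contained in
    [cut i]. *)
Definition blk i := Q (U :|: [set e j | j : 'I_i.+1.*2]) w.
Definition sv i := e i.*2 |: w.
Definition tv i := e i.*2.+1 |: w.
Definition zv i := e i.*2 |: tv i.
Definition cut i := blk i :\ sv i :\ tv i :\ zv i.
Definition As i := Q (e i.*2 |: U) w.
Definition At i := Q (e i.*2.+1 |: U) w.

Definition a_ i := ce (sq (cut i)) (fun o => (conn o (As i) w (sv i))%:R).
Definition b_ i := ce (sq (cut i)) (fun o => (conn o (At i) w (tv i))%:R).
Definition y_ i := ce (sq (cut i)) (fun o => (reach_pair (As i) (At i) w (sv i) (tv i) (zv i) o)%:R).

Let i2k i : (i < k)%N -> (i.*2 < k.*2)%N /\ (i.*2.+1 < k.*2)%N.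
Proof. by move=> ik; rewrite ltn_double ik; split=> //; rewrite -doubleS leq_double. Qed.

Let eU i : (i < k.*2)%N -> e i \notin U.
Proof. by move=> /eD h; rewrite (disjointFr dDU). Qed.
Let ew i : (i < k.*2)%N -> e i \notin w.
Proof. by move=> /eD h; rewrite (disjointFr dDw). Qed.

Let Qe i j v : (j < i.+1.*2)%N -> v \in blk i -> e j |: v \in blk i.
Proof.
by move=> ji; apply: Q_add; rewrite inE; apply/orP; right; apply/imsetP; exists (Ordinal ji).
Qed.

Let st_neq i : (i < k)%N -> e i.*2.+1 != e i.*2.
Proof.
case/i2k => h1 h2; apply/eqP => /(einj h2 h1) /eqP.
by rewrite eqn_leq ltnn.
Qed.

Lemma blk_sv i : sv i \in blk i. Proof. by apply: Qe (Q_refl _ _); rewrite doubleS. Qed.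
Lemma blk_tv i : tv i \in blk i. Proof. by apply: Qe (Q_refl _ _); rewrite doubleS. Qed.
Lemma blk_zv i : zv i \in blk i. Proof. by apply: Qe (blk_tv i); rewrite doubleS. Qed.

Lemma cut_blk i : cut i \subset blk i.
Proof. by apply/subsetP => x; rewrite !inE => /and4P[]. Qed.

Lemma sv_cut i : sv i \notin cut i. Proof. by rewrite !inE eqxx !andbF. Qed.
Lemma tv_cut i : tv i \notin cut i. Proof. by rewrite !inE eqxx !andbF. Qed.
Lemma zv_cut i : zv i \notin cut i. Proof. by rewrite !inE eqxx. Qed.

Lemma blk_cut i j : (j < i < k)%N -> blk j \subset cut i.
Proof.
case/andP=> ji ik; have [h1 h2] := i2k ik.
have sub : blk j \subset blk i.
  apply: Q_sub; apply: setUS; apply/subsetP => x /imsetP[m _ ->].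
  have mi : (m < i.+1.*2)%N by apply: leq_trans (ltn_ord m) _; rewrite leq_double ltnW.
  by apply/imsetP; exists (Ordinal mi).
have out m : (i.*2 <= m)%N -> (m < k.*2)%N -> forall x, x \in blk j -> e m \notin x.
  move=> im mk x xb; rewrite (Q_out xb) ?ew // inE negb_or eU //=.
  apply/imsetP => -[l _ /einj]; move=> /(_ mk).
  have lm : (l < m)%N by apply: leq_trans im; apply: leq_trans (ltn_ord l) _; rewrite leq_double.
  by move=> /(_ (ltn_trans lm mk)) h; rewrite h ltnn in lm.
apply/subsetP => x xb; have hs := out _ (leqnn _) h1 x xb; have ht := out _ (leqnSn _) h2 x xb.
rewrite !inE -mem_Q -/(blk i) (subsetP sub) // andbT.
by apply/and3P; split; [apply: contraNneq hs => ->|apply: contraNneq ht => ->|apply: contraNneq hs => ->];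
  rewrite !inE eqxx.
Qed.

Lemma As_blk i : As i \subset blk i.
Proof.
apply: Q_sub; rewrite setUC; apply: setUS; rewrite sub1set.
have h : (i.*2 < i.+1.*2)%N by rewrite doubleS.
by apply/imsetP; exists (Ordinal h).
Qed.

Lemma At_blk i : At i \subset blk i.
Proof.
apply: Q_sub; rewrite setUC; apply: setUS; rewrite sub1set.
have h : (i.*2.+1 < i.+1.*2)%N by rewrite doubleS.
by apply/imsetP; exists (Ordinal h).
Qed.

Let notAs i : (i < k)%N -> tv i \notin As i /\ zv i \notin As i.
Proof.
move=> ik; have [h1 h2] := i2k ik; have n := st_neq ik.
have o (x : {set J}) : e i.*2.+1 \in x -> x \notin As i.
  by move=> ex; apply: contraL ex => xA; rewrite (Q_out xA) ?ew // !inE negb_or n eU.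
by split; apply: o; rewrite !inE eqxx ?orbT.
Qed.

Let notAt i : (i < k)%N -> sv i \notin At i /\ zv i \notin At i.
Proof.
move=> ik; have [h1 h2] := i2k ik; have n := st_neq ik.
have o (x : {set J}) : e i.*2 \in x -> x \notin At i.
  by move=> ex; apply: contraL ex => xA; rewrite (Q_out xA) ?ew // !inE negb_or eq_sym n eU.
by split; apply: o; rewrite !inE eqxx ?orbT.
Qed.

Lemma pair_side i : (i < k)%N ->
  Ex (fun o => ([&& 1 / 2 < prd mu (As i) w (sv i) o, 1 / 2 < prd mu (At i) w (tv i) o &
     a_ i o * b_ i o * y_ i o ^+ 2 <= (21%:R / 50%:R) ^+ 2])%:R) <= 602%:R * 100%:R * tau.
Proof.
move=> ik; have [h1 h2] := i2k ik; have [tA zA] := notAs ik; have [sA zA'] := notAt ik.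
have n := st_neq ik.
have blkD : blk i \subset Q (U :|: D) w.
  apply: Q_sub; apply: setUS; apply/subsetP => x /imsetP[m _ ->]; apply: eD.
  by apply: leq_trans (ltn_ord m) _; rewrite leq_double.
have tvN : e i.*2 \notin tv i by rewrite !inE negb_or eq_sym n ew.
have svN : e i.*2.+1 \notin sv i by rewrite !inE negb_or n ew.
have cutI u : u \in blk i -> u != sv i -> u != tv i -> u != zv i -> u \in cut i.
  by move=> ub us ut uz; rewrite !in_setD1 uz ut us.
apply: (@pair_half _ _ mu mu_ge0 mu1 mu_indep (As i) (At i) (blk i) (cut i) w (sv i) (tv i) (zv i)
  tau) => //.
- by apply: Q_add (Q_refl _ _); rewrite !inE eqxx.
- by apply: Q_add (Q_refl _ _); rewrite !inE eqxx.
- exact: As_blk.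
- exact: At_blk.
- exact: blk_zv.
- by apply: contraNneq zA => ->; apply: Q_add (Q_refl _ _); rewrite !inE eqxx.
- by apply: contraNneq zA' => ->; apply: Q_add (Q_refl _ _); rewrite !inE eqxx.
- by apply: contraNneq sA => ->; apply: Q_add (Q_refl _ _); rewrite !inE eqxx.
- apply/subsetP => u; rewrite in_setD1 => /andP[us uA]; apply: cutI => //.
  + exact: (subsetP (As_blk i)).
  + by apply: contraNneq tA => <-.
  + by apply: contraNneq zA => <-.
- apply/subsetP => u; rewrite in_setD1 => /andP[us uA]; apply: cutI => //.
  + exact: (subsetP (At_blk i)).
  + by apply: contraNneq sA => <-.
  + by apply: contraNneq zA' => <-.
- exact: cut_blk.
- exact: sv_cut.
- exact: tv_cut.
- exact: zv_cut.
- apply: le_trans (st (eD h1)); rewrite lerD2r; exact: Psi_mono.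
- apply: le_trans (st (eD h2)); rewrite lerD2r; exact: Psi_mono.
- by rewrite /zv /tv setUCA; apply: mu_open.
- exact: mu_open.
Qed.

Definition halves i o := (1 / 2 < prd mu (As i) w (sv i) o) && (1 / 2 < prd mu (At i) w (tv i) o).

(** Each failing pair is charged to one of its own two directions, and the pairs are disjoint. *)
Lemma halves_count o : (#|[set i : 'I_k | ~~ halves i o]| <= nbad U D w o)%N.
Proof.
pose g (i : 'I_k) := if prd mu (As i) w (sv i) o <= 1 / 2 then e i.*2 else e i.*2.+1.
rewrite -(card_imset (f := g)); last first.
  move=> i j; rewrite /g; have [h1 h2] := i2k (ltn_ord i); have [h3 h4] := i2k (ltn_ord j).
  have [d1 d2 d3 d4] := double_cases i j.
  case: ifP => _; case: ifP => _ /einj hij; apply: val_inj;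
    by [apply: d1; apply: hij|apply: d2; apply: hij|apply: d3; apply: hij|apply: d4; apply: hij].
apply: subset_leq_card; apply/subsetP => x /imsetP[i]; rewrite inE => ih ->.
have [h1 h2] := i2k (ltn_ord i).
rewrite inE /g; case: leP => [hs|hs]; first by rewrite eD.
by rewrite eD //= leNgt; move: ih; rewrite /halves hs.
Qed.

End OneSide.

(** * Joining two adjacent good vertices *)

Section Join.
Variables (R : realFieldType) (J : finType) (mu : conf {set J} -> R).
Hypotheses (mu_ge0 : forall o, 0 <= mu o) (mu1 : \sum_o mu o = 1).
Hypothesis mu_indep : indep_on_disjoint mu.
Hypothesis mu_open : cube_open mu.
Notation Ex := (Ex mu).
Notation ce := (ce mu).
Notation p0 := (p0 R).
Implicit Types (o : conf {set J}).

Lemma clean_count K n n' a a' m : (n * 20 <= K.*2)%N -> (n' * 20 <= K.*2)%N ->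
  (a <= n)%N -> (a' <= n')%N -> (K <= m + a + a')%N -> (4 * K <= 5 * m)%N.
Proof. lia. Qed.

Lemma clean_total K (P P' : pred 'I_K) :
  (K <= \sum_i (P i && P' i) + #|[set i | ~~ P i]| + #|[set i | ~~ P' i]|)%N.
Proof.
rewrite -!sum1dep_card !(big_mkcond (fun i => ~~ _ i)) /= -!big_split /= -{1}(card_ord K) -sum1_card.
by apply: leq_sum => i _; case: (P i); case: (P' i).
Qed.

Lemma natr_count K (P : pred 'I_K) : (4 * K <= 5 * \sum_i P i)%N ->
  4%:R * K%:R * 1 <= 5%:R * \sum_i (P i)%:R :> R.
Proof. by rewrite mulr1 -natr_sum -!natrM ler_nat. Qed.

Lemma join_arith (l t P ta tb ty c c' : R) : 0 < l ->
  4%:R * (l * l) * P <= 5%:R * (300%:R * ta + 300%:R * tb + 300%:R * ty + c + c') ->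
  ta <= 2 * l -> tb <= 2 * l -> ty <= 2 * l -> 0 < t ->
  c <= (l * l) * (602%:R * 100%:R * t) -> c' <= (l * l) * (602%:R * 100%:R * t) ->
  l * P <= 100%:R ^+ 2 + 100%:R ^+ 3 * (l * t).
Proof.
move=> l0 h ha hb hy t0 hc hc'; rewrite -(ler_pM2l l0).
have : 0 < l * l * t by rewrite !mulr_gt0.
rewrite !exprS !expr0; lra.
Qed.

(** The product [(a a') (b b') (y y') ^ 2] exceeds [th ^ 4], so one of its factors exceeds [th].
    Only a weighted geometric mean of the three probabilities at each end has to be large. *)
Lemma triple_product (th a b y a' b' y' : R) : 0 <= th ->
  0 <= a -> 0 <= b -> 0 <= y -> 0 <= a' -> 0 <= b' -> 0 <= y' ->
  th ^+ 2 < a * b * y ^+ 2 -> th ^+ 2 < a' * b' * y' ^+ 2 ->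
  [|| th < a * a', th < b * b' | th < y * y'].
Proof.
move=> th0 a0 b0 y0 a0' b0' y0' h h'; rewrite -[_ || _]negbK !negb_or -!leNgt.
apply/negP => /and3P[ha hb hy].
have : th ^+ 2 * th ^+ 2 < (a * b * y ^+ 2) * (a' * b' * y' ^+ 2).
  by apply: ltr_pM; rewrite ?sqr_ge0.
have -> : (a * b * y ^+ 2) * (a' * b' * y' ^+ 2) = (a * a') * (b * b') * ((y * y') ^+ 2) by ring.
rewrite ltNge (expr2 th) => /negP; apply; apply: ler_pM; rewrite ?mulr_ge0 ?sqr_ge0 //.
  by apply: ler_pM; rewrite ?mulr_ge0.
by rewrite -expr2; apply: ler_sqr_nneg; rewrite ?mulr_ge0.
Qed.

Lemma join_indic (ta tb ty f f' : R) (n h h' c c' : bool) :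
  0 <= ta -> 0 <= tb -> 0 <= ty -> (h -> ~~ c -> h' -> ~~ c' -> 1 / 300%:R <= ta + tb + ty) ->
  (n && h && h')%:R <= 300%:R * (n%:R * ta) + 300%:R * (n%:R * tb) + 300%:R * (n%:R * ty)
   + (h && c)%:R + (h' && c')%:R :> R.
Proof.
case: n => /=; last by case: h; case: c; case: h'; case: c' => /= *; lra.
case: h => /=; last by case: h'; case: c' => /= *; lra.
case: h' => /=; last by case: c => /= *; lra.
case: c => /=; first by case: c' => /= *; lra.
case: c' => /=; first by move=> *; lra.
by move=> ? ? ? /(_ isT isT isT isT) ?; lra.
Qed.

Variables (U U' D w : {set J}) (r : J) (tau : R) (l : nat).
Hypotheses (tau0 : 0 < tau) (l0 : (0 < l)%N) (Dl : #|D| = (l * l).*2).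
Hypotheses (rw : r \notin w) (rU : r \notin U) (rU' : r \notin U') (rD : r \notin D).
Hypotheses (dDU : [disjoint D & U]) (dDU' : [disjoint D & U']) (dDw : [disjoint D & w]).
Hypotheses (st : stable mu tau U D w) (st' : stable mu tau U' D (r |: w)).

(** There are [l * l] pairs, so the tests can be run with [lam = l]. At each clean pair either the
    pair bound fails at one end, with probability of order [tau], or one of the three tests gains
    [1 / 300]. As the tests gain at most [6 l] in total, being good but not joined has probability
    of order [1 / l + tau]. *)
Lemma join_good :
  l%:R * Ex (fun o => ([&& good mu U D w o, good mu U' D (r |: w) o & ~~ conn o setT w (r |: w)])%:R)
  <= 100%:R ^+ 2 + 100%:R ^+ 3 * (l%:R * tau).
Proof.
pose k := (l * l)%N; pose w' := r |: w.
have D0 : (0 < #|D|)%N by rewrite Dl double_gt0 muln_gt0 l0.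
have [d0 d0D] := card_gt0P D0.
pose e i := nth d0 (enum D) i.
have sz : size (enum D) = k.*2 by rewrite -cardE.
have eD i : (i < k.*2)%N -> e i \in D.
  by move=> ik; rewrite -mem_enum mem_nth ?sz.
have einj i j : (i < k.*2)%N -> (j < k.*2)%N -> e i = e j -> i = j.
  by move=> ik jk /eqP; rewrite nth_uniq ?sz ?enum_uniq // => /eqP.
have dDw' : [disjoint D & w'].
  rewrite disjoints_subset; apply/subsetP => x xD; rewrite !inE negb_or (disjointFr dDw xD) andbT.
  by apply: contraNneq rD => <-.
have re i : (i < k.*2)%N -> r != e i by move=> /eD h; apply: contraNneq rD => ->.
pose nn o := ~~ conn o setT w w'.
have tests (x x' : nat -> {set J}) (Z Z' : nat -> pred (conf {set J})) :
    (forall i, (i < k)%N -> (x i \in blk U w e i) && (x i \notin cut U w e i)) ->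
    (forall i, (i < k)%N -> (x' i \in blk U' w' e i) && (x' i \notin cut U' w' e i)) ->
    (forall i, (i < k)%N -> r \notin x i) ->
    (forall i, (i < k)%N -> meas (sq (blk U w e i)) (Z i)) ->
    (forall i, (i < k)%N -> meas (sq (blk U' w' e i)) (Z' i)) ->
    (forall i o, Z i o -> conn o setT w (x i)) ->
    (forall i o, Z' i o -> conn o setT w' (x' i)) -> (forall i, x' i = r |: x i) ->
    Ex (fun o => (nn o)%:R * \sum_(i < k) test (ce (sq (cut U w e i)) (fun o => (Z i o)%:R))
       (ce (sq (cut U' w' e i)) (fun o => (Z' i o)%:R)) o) <= 2 * l%:R.
  move=> hx hx' hr mZ mZ' cZ cZ' xE.
  apply: (@sequential_tests _ _ mu mu_ge0 mu1 mu_indep k l%:R (cut U w e) (blk U w e)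
     (cut U' w' e) (blk U' w' e) x x') => //.
  - by rewrite ltr0n.
  - by rewrite /k natrM expr2.
  - by move=> *; exact: cut_blk.
  - by move=> *; exact: cut_blk.
  - by move=> i j h; apply: (blk_cut dDU dDw eD einj h).
  - by move=> i j h; apply: (blk_cut dDU' dDw' eD einj h).
  - move=> i ik; apply: (Q_disjoint (r := r)).
    + rewrite inE negb_or rU /=; apply/imsetP => -[m _ h].
      have := re m (leq_trans (ltn_ord m) _); rewrite -h eqxx leq_double => /(_ ik).
      by [].
    + rewrite inE negb_or rU' /=; apply/imsetP => -[m _ h].
      have := re m (leq_trans (ltn_ord m) _); rewrite -h eqxx leq_double => /(_ ik).
      by [].
    + by rewrite !inE eqxx (negPf rw).
  - by move=> i ik; rewrite xE; apply: mu_open; exact: hr.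
  - move=> i o ik /negP no /cZ c /cZ' c' oe; apply: no.
    apply: conn_trans c _; rewrite connC; apply: conn_trans c' _.
    by rewrite connC conn1.
have mconn (A B : {set {set J}}) x y : A \subset B -> meas (sq B) (fun o => conn o A x y).
  by move=> AB; apply: meas_sub (sqS AB) _; exact: meas_conn.
have mreach (A A' B : {set {set J}}) x y z t : A \subset B -> A' \subset B -> y \in B -> z \in B ->
    t \in B -> meas (sq B) (fun o => reach_pair A A' x y z t o).
  move=> AB AB' yB zB tB o o' h; rewrite /reach_pair (mconn _ _ _ _ AB _ _ h) (mconn _ _ _ _ AB' _ _ h).
  by rewrite (meas_op yB tB h) (meas_op zB tB h).
have creach (A A' : {set {set J}}) x y z t o : reach_pair A A' x y z t o -> conn o setT x t.
  by case/orP=> /andP[c oe]; apply: conn_trans (conn_sub (subsetT _) c) _; rewrite conn1.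
have addC x : x |: w' = r |: (x |: w) by rewrite setUCA.
have rS i : (i < k)%N -> r != e i.*2 /\ r != e i.*2.+1.
  by move=> ik; split; apply: re; rewrite ?ltn_double // -doubleS leq_double.
have rsv i : (i < k)%N -> r \notin sv w e i by move=> /rS[h _]; rewrite !inE negb_or h.
have rtv i : (i < k)%N -> r \notin tv w e i by move=> /rS[_ h]; rewrite !inE negb_or h.
have rzv i : (i < k)%N -> r \notin zv w e i by move=> /rS[h h']; rewrite !inE !negb_or h h'.
have zE i : zv w' e i = r |: zv w e i by rewrite /zv /tv addC setUCA.
have ts := tests (sv w e) (sv w' e)
  (fun i o => conn o (As U w e i) w (sv w e i)) (fun i o => conn o (As U' w' e i) w' (sv w' e i))
  (fun i _ => introT andP (conj (blk_sv U w e i) (sv_cut U w e i)))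
  (fun i _ => introT andP (conj (blk_sv U' w' e i) (sv_cut U' w' e i)))
  rsv (fun i _ => mconn _ _ _ _ (As_blk _ _ _ _)) (fun i _ => mconn _ _ _ _ (As_blk _ _ _ _))
  (fun i o => conn_sub (subsetT _)) (fun i o => conn_sub (subsetT _)) (fun i => addC _).
have tt := tests (tv w e) (tv w' e)
  (fun i o => conn o (At U w e i) w (tv w e i)) (fun i o => conn o (At U' w' e i) w' (tv w' e i))
  (fun i _ => introT andP (conj (blk_tv U w e i) (tv_cut U w e i)))
  (fun i _ => introT andP (conj (blk_tv U' w' e i) (tv_cut U' w' e i)))
  rtv (fun i _ => mconn _ _ _ _ (At_blk _ _ _ _)) (fun i _ => mconn _ _ _ _ (At_blk _ _ _ _))
  (fun i o => conn_sub (subsetT _)) (fun i o => conn_sub (subsetT _)) (fun i => addC _).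
have mz (U1 w1 : {set J}) i :
    meas (sq (blk U1 w1 e i)) (reach_pair (As U1 w1 e i) (At U1 w1 e i) w1 (sv w1 e i) (tv w1 e i) (zv w1 e i)).
  by apply: mreach; rewrite ?As_blk ?At_blk ?blk_sv ?blk_tv ?blk_zv.
have tz := tests (zv w e) (zv w' e)
  (fun i => reach_pair (As U w e i) (At U w e i) w (sv w e i) (tv w e i) (zv w e i))
  (fun i => reach_pair (As U' w' e i) (At U' w' e i) w' (sv w' e i) (tv w' e i) (zv w' e i))
  (fun i _ => introT andP (conj (blk_zv U w e i) (zv_cut U w e i)))
  (fun i _ => introT andP (conj (blk_zv U' w' e i) (zv_cut U' w' e i)))
  rzv (fun i _ => mz U w i) (fun i _ => mz U' w' i)
  (fun i o => @creach _ _ _ _ _ _ o) (fun i o => @creach _ _ _ _ _ _ o) zE.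
clear tests mconn mreach creach.
pose h i := halves mu U w e i; pose h' i := halves mu U' w' e i.
pose c i o := a_ mu U w e i o * b_ mu U w e i o * y_ mu U w e i o ^+ 2 <= (21%:R / 50%:R) ^+ 2.
pose c' i o := a_ mu U' w' e i o * b_ mu U' w' e i o * y_ mu U' w' e i o ^+ 2 <= (21%:R / 50%:R) ^+ 2.
have ps i : (i < k)%N -> Ex (fun o => (h i o && c i o)%:R) <= 602%:R * 100%:R * tau.
  move=> ik; have := pair_side mu_ge0 mu1 mu_indep mu_open tau0 st dDU dDw eD einj ik.
  by apply: le_trans; apply: Ex_le => // o; rewrite /h /halves /c andbA.
have ps' i : (i < k)%N -> Ex (fun o => (h' i o && c' i o)%:R) <= 602%:R * 100%:R * tau.
  move=> ik; have := pair_side mu_ge0 mu1 mu_indep mu_open tau0 st' dDU' dDw' eD einj ik.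
  by apply: le_trans; apply: Ex_le => // o; rewrite /h' /halves /c' andbA.
pose ta i o := test (a_ mu U w e i) (a_ mu U' w' e i) o.
pose tb i o := test (b_ mu U w e i) (b_ mu U' w' e i) o.
pose ty i o := test (y_ mu U w e i) (y_ mu U' w' e i) o.
have cl o : good mu U D w o -> good mu U' D w' o ->
    (4 * k <= 5 * \sum_(i < k) (h i o && h' i o))%N.
  rewrite /good Dl => g g'.
  exact: clean_count g g' (halves_count mu U w eD einj o) (halves_count mu U' w' eD einj o)
    (clean_total _ _).
have pt o : 4%:R * k%:R * ([&& good mu U D w o, good mu U' D w' o & nn o])%:R <=
    5%:R * (300%:R * ((nn o)%:R * \sum_(i < k) ta i o) + 300%:R * ((nn o)%:R * \sum_(i < k) tb i o)
      + 300%:R * ((nn o)%:R * \sum_(i < k) ty i o) + \sum_(i < k) (h i o && c i o)%:R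
      + \sum_(i < k) (h' i o && c' i o)%:R) :> R.
  apply: (@le_trans _ _ (5%:R * \sum_(i < k) (nn o && h i o && h' i o)%:R)); last first.
    rewrite ler_pM2l ?ltr0n // !big_distrr /= -!big_split /=; apply: ler_sum => i _.
    apply: join_indic; rewrite ?test_ge0 // => hi ci hi' ci'.
    have ce0 (X : {set {set J}}) f : 0 <= ce (sq X) (fun o => (f o)%:R) o.
      by apply: ce_ge0 => // o'; exact: ler0n.
    rewrite /c -ltNge in ci; rewrite /c' -ltNge in ci'.
    have /or3P[] := @triple_product (21%:R / 50%:R) (a_ mu U w e i o) (b_ mu U w e i o)
       (y_ mu U w e i o) (a_ mu U' w' e i o) (b_ mu U' w' e i o) (y_ mu U' w' e i o)
       (divr_ge0 (ler0n _ _) (ler0n _ _)) (ce0 _ _) (ce0 _ _) (ce0 _ _) (ce0 _ _) (ce0 _ _) (ce0 _ _)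
       ci ci'.
    - move=> /test_ge tg; apply: le_trans tg _; rewrite -addrA lerDl; apply: addr_ge0; apply: test_ge0.
    - move=> /test_ge tg; apply: le_trans tg _; rewrite addrAC lerDr; apply: addr_ge0; apply: test_ge0.
    - move=> /test_ge tg; apply: le_trans tg _; rewrite lerDr; apply: addr_ge0; apply: test_ge0.
  case g: (good _ _ _ _ _); rewrite /= ?mulr0; last by rewrite mulr_ge0 ?sumr_ge0.
  case g': (good _ _ _ _ _); rewrite /= ?mulr0; last by rewrite mulr_ge0 ?sumr_ge0.
  case: (nn o); rewrite /= ?mulr0; last by rewrite mulr_ge0 ?sumr_ge0.
  exact: (@natr_count k (fun i => h i o && h' i o) (cl o g g')).
have l0R : 0 < l%:R :> R by rewrite ltr0n.
have kl : k%:R = l%:R * l%:R :> R by rewrite /k natrM.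
have cst (C : nat -> conf {set J} -> bool) : (forall i, (i < k)%N ->
    Ex (fun o => (C i o)%:R) <= 602%:R * 100%:R * tau) ->
    Ex (fun o => \sum_(i < k) (C i o)%:R) <= l%:R * l%:R * (602%:R * 100%:R * tau).
  move=> hC; rewrite Ex_sum -kl mulr_natl -[k in leRHS]card_ord -sumr_const.
  by apply: ler_sum => i _; exact: hC.
have ptE := Ex_le mu_ge0 pt.
rewrite (ExZ mu (4%:R * k%:R) (fun o => _)) (ExZ mu 5%:R (fun o => _)) kl in ptE.
rewrite 4!(ExD mu (fun o => _) (fun o => _)) 3!(ExZ mu 300%:R (fun o => _)) in ptE.
exact: join_arith l0R ptE ts tt tz tau0 (cst _ ps) (cst _ ps').
Qed.

End Join.

(** * Good vertices *)

Section ModeArithmetic.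
Variable R : realFieldType.

(** [tau1] keeps the sign error [12 * 8 * tau1] negligible. [eps1] is such that, by Markov's
    inequality, all but a fraction [2 / 10 ^ 5] of [D] has slice gain at most [tau1 ^ 2] at both
    vertices. *)
Definition tau1 : R := 1 / (100%:R * 100%:R) / (100%:R * 10%:R).
Definition eps1 : R := tau1 ^+ 2 / (100%:R * 100%:R * 10%:R).

Lemma tau1_gt0 : 0 < tau1.
Proof. by rewrite /tau1 !divr_gt0 ?mulr_gt0 ?ltr0n.
Qed.

Lemma tau1_le (q : R) : 0 <= q -> q * tau1 <= q / (100%:R * 100%:R * 100%:R * 10%:R).
Proof. by move=> q0; rewrite ler_wpM2l // /tau1; lra. Qed.

Lemma eps1_gt0 : 0 < eps1.
Proof.
by apply: divr_gt0; [rewrite exprn_gt0 ?tau1_gt0|rewrite !mulr_gt0 ?ltr0n].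
Qed.

Lemma tau1_small : 0 <= 8%:R * tau1 <= 1 / 400%:R.
Proof. by rewrite mulr_ge0 ?ler0n 1?ltW ?tau1_gt0 //= /tau1; lra. Qed.

Lemma mode_beta (b q g g' : R) : b * tau1 ^+ 2 <= g + g' -> g <= eps1 * q -> g' <= eps1 * q ->
  b <= q / (100%:R * 100%:R * 5%:R).
Proof.
move=> h hg hg'; have t2 : 0 < tau1 ^+ 2 by rewrite exprn_gt0 // tau1_gt0.
rewrite -(ler_pM2r t2); apply: le_trans h (le_trans (lerD hg hg') _).
by rewrite /eps1; move: (tau1 ^+ 2) => t; lra.
Qed.

Lemma mode_prob (q b d P : R) : 0 < q -> b <= q / (100%:R * 100%:R * 5%:R) ->
  d <= q * (12%:R * (8%:R * tau1)) + b -> q * p0 R <= q * P + 200%:R * d ->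
  34%:R / 60%:R <= P.
Proof.
move=> q0 hb hd h; rewrite -(ler_pM2l q0); move: h; rewrite /p0.
have : q * tau1 <= q / (100%:R * 100%:R * 100%:R * 10%:R).
  by apply: tau1_le; exact: ltW.
by move: hb hd => *; lra.
Qed.

Lemma mode_zeros (q b n P : R) : 0 < q -> 0 <= n -> b <= q / (100%:R * 100%:R * 5%:R) ->
  34%:R / 60%:R <= P <= 1 ->
  P * (n - q / 200%:R - b) <= n * (1 - p0 R + 12%:R * (8%:R * tau1)) ->
  n + q / 200%:R <= q / 20%:R.
Proof.
move=> q0 n0 hb /andP[P0 P1] h.
have t : n * tau1 <= n / (100%:R * 100%:R * 100%:R * 10%:R).
  exact: tau1_le.
rewrite leNgt; apply/negP => nq.
have m0 : 0 <= n - q / 200%:R - b by move: hb nq => *; lra.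
have := ler_wpM2r m0 P0; move: h hb t nq; rewrite /p0; by move=> *; lra.
Qed.

End ModeArithmetic.

(** By independence the left side is the average, over the values of [g], of the right side; some
    value is at least average. *)
Lemma decouple (R : realFieldType) (V : finType) (nu : conf V -> R) (S T : finType) (A B : {set V})
    (f : conf V -> S) (g : conf V -> T) (P : S -> T -> bool) :
  (forall o, 0 <= nu o) -> \sum_o nu o = 1 -> indep_on_disjoint nu ->
  [disjoint A & B] -> meas (sq A) f -> meas (sq B) g ->
  exists o', Ex nu (fun o => (P (f o) (g o))%:R) <= Ex nu (fun o => (P (f o) (g o'))%:R).
Proof.
move=> nu0 nu1 nui dAB mf mg; pose phi y := Ex nu (fun o => (P (f o) y)%:R).
have h : Ex nu (fun o => (P (f o) (g o))%:R) = Ex nu (fun o => phi (g o)).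
  have -> : Ex nu (fun o => phi (g o)) = Ex nu (fun o => \sum_y (g o == y)%:R * phi y).
    apply: eq_Ex => o; rewrite (bigD1 (g o)) //= eqxx mul1r big1 ?addr0 // => y.
    by rewrite eq_sym => /negPf ->; rewrite mul0r.
  have -> : Ex nu (fun o => (P (f o) (g o))%:R) =
      Ex nu (fun o => \sum_y (P (f o) y)%:R * (g o == y)%:R).
    apply: eq_Ex => o; rewrite (bigD1 (g o)) //= eqxx mulr1 big1 ?addr0 // => y.
    by rewrite eq_sym => /negPf ->; rewrite mulr0.
  rewrite !Ex_sum; apply: eq_bigr => y _; rewrite ExZr (Ex_indep nui dAB) 1?mulrC //.
    by move=> o o' a; rewrite (mf _ _ a).
  by move=> o o' a; rewrite (mg _ _ a).
rewrite h; set c := Ex nu _.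
case: (pickP (fun o' : conf V => c <= phi (g o'))) => [o' ho'|hn]; first by exists o'.
exfalso; have : Ex nu (fun o => phi (g o) - c) < 0.
  rewrite /Ex; have [o0 o0P] : exists o0, 0 < nu o0.
    case: (pickP (fun o => 0 < nu o)) => [o0 h0|hz]; first by exists o0.
    by move: nu1; rewrite big1 => [/esym/eqP|o _]; rewrite ?oner_eq0 //;
      apply/eqP; rewrite eq_le nu0 andbT leNgt hz.
  rewrite (bigD1 o0) //= -[ltRHS]addr0; apply: ltr_leD.
    by rewrite pmulr_rlt0 // subr_lt0 ltNge hn.
  by apply: sumr_le0 => o _; rewrite mulr_ge0_le0 // subr_le0 ltW // ltNge hn.
by rewrite ExB (Ex_cst nu1) subrr ltxx.
Qed.

Section Mode.
Variables (R : realFieldType) (J : finType) (mu : conf {set J} -> R).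
Hypotheses (mu_ge0 : forall o, 0 <= mu o) (mu1 : \sum_o mu o = 1).
Hypothesis mu_indep : indep_on_disjoint mu.
Notation Ex := (Ex mu).
Notation ce := (ce mu).
Notation p0 := (p0 R).
Implicit Types (o : conf {set J}).

Hypothesis mu_open : cube_open mu.
Variables (U D w v : {set J}) (r : J).
Hypotheses (rU : r \notin U) (rD : r \notin D).
Hypotheses (wv : w :\ r = v :\ r) (rwv : (r \in w) != (r \in v)).
Hypotheses (dDU : [disjoint D & U]) (dDw : [disjoint D & w]) (D0 : (0 < #|D|)%N).

Definition slice_gain (U w : {set J}) (r s : J) :=
  Psi mu (Q (r |: (s |: U)) w) w (s |: w) - Psi mu (Q (s |: U) w) w (s |: w).

Hypotheses (gw : \sum_(s in D) slice_gain U w r s <= eps1 R * #|D|%:R)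
           (gv : \sum_(s in D) slice_gain U v r s <= eps1 R * #|D|%:R).

Let dDv : [disjoint D & v].
Proof.
rewrite disjoints_subset; apply/subsetP => x xD; rewrite inE.
have xr : x != r by apply: contraNneq rD => <-.
by have := disjointFr dDw xD; move/setP/(_ x): wv; rewrite !inE xr /= => -> ->.
Qed.

Lemma cube_edge_open (x y : {set J}) : x :\ r = y :\ r -> (r \in x) != (r \in y) ->
  p0 <= Ex (fun o => (op o x y)%:R).
Proof.
move=> xy; case: (boolP (r \in x)) => rx; case: (boolP (r \in y)) => ry //= _.
  have -> : x = r |: y.
    by rewrite -(setD1K rx) xy; congr (_ |: _); apply/setDidPl; rewrite disjoint_sym disjoints1.
  by rewrite (eq_Ex mu (g := fun o => (op o y (r |: y))%:R)) => [|o]; rewrite ?mu_open // opC.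
have -> : y = r |: x.
  by rewrite -(setD1K ry) -xy; congr (_ |: _); apply/setDidPl; rewrite disjoint_sym disjoints1.
exact: mu_open.
Qed.

Let q s o := prd mu (Q (s |: U) w) w (s |: w) o.
Let q' s o := prd mu (Q (s |: U) v) v (s |: v) o.
Let c o := op o w v.

(** [C] contains the parallel slices [A] through [w] and [A'] through [v], which differ in the
    coordinate [r]. Small slice gains are the stability required by [two_slices], with error
    [8 tau1]. *)
Lemma half_agreement s : s \in D ->
  slice_gain U w r s <= tau1 R ^+ 2 -> slice_gain U v r s <= tau1 R ^+ 2 ->
  Ex (fun o => (c o && (half_lt (q s o) != half_lt (q' s o)))%:R) <= 12%:R * (8%:R * tau1 R) /\
  p0 - 12%:R * (8%:R * tau1 R) <= Ex (fun o => (half_lt (q s o))%:R).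
Proof.
move=> sD gws gvs.
have sU : s \notin U by rewrite (disjointFr dDU).
have sw : s \notin w by rewrite (disjointFr dDw).
have sv : s \notin v by rewrite (disjointFr dDv).
have rs : r != s by apply: contraNneq rD => ->.
have rsU : r \notin s |: U by rewrite !inE negb_or rs.
have CE : Q (r |: (s |: U)) v = Q (r |: (s |: U)) w.
  by apply/setP => T; rewrite !mem_Q -!(setDDl v) -!(setDDl w) wv.
pose A := Q (s |: U) w; pose A' := Q (s |: U) v; pose C := Q (r |: (s |: U)) w.
have AC : A \subset C by apply: Q_sub; exact: subsetUr.
have AC' : A' \subset C by rewrite /C -CE; apply: Q_sub; exact: subsetUr.
have dA : [disjoint A & A'] by apply: Q_disjoint rwv.
have sA : s |: w \in A by apply: Q_add (Q_refl _ _); rewrite !inE eqxx.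
have sA' : s |: v \in A' by apply: Q_add (Q_refl _ _); rewrite !inE eqxx.
have wA : w \in A := Q_refl _ _; have vA : v \in A' := Q_refl _ _.
have nA x : x \in A -> x \in A' -> False by move=> xA; rewrite (disjointFr dA xA).
have wsw : w != s |: w by apply: contraNneq sw => ->; rewrite !inE eqxx.
have vsv : v != s |: v by apply: contraNneq sv => ->; rewrite !inE eqxx.
have o1 : p0 <= Ex (fun o => (op o (s |: w) (s |: v))%:R).
  apply: cube_edge_open; first by rewrite !setDUl wv.
  by rewrite !inE (negPf rs).
have qge (x : {set J}) : s \notin x -> p0 <= Ex (fun o => prd mu (Q (s |: U) x) x (s |: x) o).
  move=> sx; rewrite Ex_ce1 //; apply: le_trans (mu_open sx) _; apply: Ex_le => // o.
  rewrite /hit ler_nat; case oe: (op o _ _) => //; rewrite conn1 ?Q_refl //.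
  by apply: Q_add (Q_refl _ _); rewrite !inE eqxx.
have mq (X Y : {set {set J}}) x t : X :\ t \subset Y -> meas (sq Y) (prd mu X x t).
  by move=> XY; apply: meas_sub (sqS XY) _; exact: meas_ce.
have k0 : 0 <= 8%:R * tau1 R <= 1 / 400%:R.
  exact: tau1_small.
have cP : p0 <= Ex (fun o => (c o)%:R) by exact: cube_edge_open.
have [|||] := sign_agreement mu_ge0 mu1 mu_indep dA (mq A A w (s |: w) (subD1set _ _))
   (mq A' A' v (s |: v) (subD1set _ _)) _ _ (qge _ sw) (qge _ sv) cP k0.
- by move=> o; rewrite prd_ge0 ?prd_le1.
- by move=> o; rewrite prd_ge0 ?prd_le1.
- move=> P.
  apply: (two_slices mu_ge0 mu1 mu_indep (tau1_gt0 R) _ dA AC AC' wA sA vA sA' gws _ o1).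
  + by rewrite /p0 divr_ge0 ?ler0n.
  + by rewrite /C -CE.
  + move=> o o' h; rewrite /c (meas_op _ _ h).
    * rewrite (mq A _ w _ _ _ _ h) ?(mq A' _ v _ _ _ _ h) //.
        apply/subsetP => x; rewrite !inE -!mem_Q => /andP[xs xA].
        rewrite xs (subsetP AC') //= andbT; apply: contraTneq sA => <-.
        by apply/negP => /nA; apply.
      apply/subsetP => x; rewrite !inE -!mem_Q => /andP[xs xA].
      rewrite xs (subsetP AC) //= andbT; apply: contraTneq sA' => <-.
      by apply/negP => /(nA _ xA).
    * rewrite !in_setD1 (subsetP AC _ wA) wsw !andbT.
      by apply/negP => /eqP e; apply: (nA w wA); rewrite e.
    * rewrite !in_setD1 (subsetP AC' _ vA) vsv !andbT /=.
      by apply/negP => /eqP e; apply: (nA v _ vA); rewrite e.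
  + by move=> o; rewrite ler0n ler_nat /c; case: (op o w v); rewrite ?leq_b1.
by move=> h1 h2 _; split; [exact: h1|exact: h2].
Qed.

End Mode.

Definition symdiff (T : finType) (X Y : {set T}) := (X :\: Y) :|: (Y :\: X).

Lemma in_symdiff (T : finType) (X Y : {set T}) s : (s \in symdiff X Y) = (s \in X) (+) (s \in Y).
Proof. by rewrite in_setU !in_setD; case: (s \in X); case: (s \in Y). Qed.

Lemma in_setDDD (T : finType) (X Y Z B : {set T}) s :
  (s \in X :\: Y :\: Z :\: B) = [&& s \in X :\: Y, s \notin Z & s \notin B].
Proof. by rewrite !in_setD; case: (s \in X); case: (s \in Y); case: (s \in Z); case: (s \in B). Qed.

Lemma card_symdiff_bound (T : finType) (X Y Z B : {set T}) :
  (#|X :\: Y| <= #|X :\: Y :\: Z :\: B| + #|symdiff Z Y| + #|B|)%N.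
Proof.
apply: leq_trans (leq_trans (leq_card_setU _ _) _); last by apply: leq_add; first exact: leq_card_setU.
apply: subset_leq_card; apply/subsetP => s; rewrite !in_setU !in_setD.
by case: (s \in B); case: (s \in Y); case: (s \in X); case: (s \in Z).
Qed.

Lemma card_setD_symdiff (T : finType) (X Y Z : {set T}) :
  (#|X :\: Z| <= #|X :\: Y| + #|symdiff Z Y|)%N.
Proof.
apply: leq_trans (leq_card_setU _ _); apply: subset_leq_card; apply/subsetP => s.
by rewrite in_setU in_symdiff !in_setD; case: (s \in Y); case: (s \in X); case: (s \in Z).
Qed.

Section ModeGood.
Variables (R : realFieldType) (J : finType) (mu : conf {set J} -> R).
Hypotheses (mu_ge0 : forall o, 0 <= mu o) (mu1 : \sum_o mu o = 1).
Hypothesis mu_indep : indep_on_disjoint mu.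
Hypothesis mu_open : cube_open mu.
Notation Ex := (Ex mu).
Notation p0 := (p0 R).
Implicit Types (o : conf {set J}).

Lemma Ex_card (I : finType) (P : conf {set J} -> {set I}) :
  Ex (fun o => #|P o|%:R) = \sum_i Ex (fun o => (i \in P o)%:R).
Proof.
rewrite -Ex_sum; apply: eq_Ex => o.
by rewrite -sum1_card natr_sum big_mkcond; apply: eq_bigr => i _; case: (i \in P o).
Qed.

Lemma sum_mem (I : finType) (A : {set I}) : \sum_i (i \in A)%:R = #|A|%:R :> R.
Proof. by rewrite -sum1_card natr_sum [RHS]big_mkcond; apply: eq_bigr => i _; case: (i \in A). Qed.

Lemma card_markov (I : finType) (A : {set I}) (g : I -> R) (t : R) : (forall i, i \in A -> 0 <= g i) ->
  #|[set i in A | t < g i]|%:R * t <= \sum_(i in A) g i.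
Proof.
move=> g0; rewrite -sum_mem big_distrl /= [leRHS]big_mkcond; apply: ler_sum => i _; rewrite inE.
case: (boolP (i \in A)) => iA /=; rewrite ?mul0r //; case: ltP => h; rewrite /= ?mul0r ?mul1r ?g0 //.
exact: ltW.
Qed.

Lemma card_bound (n z d b q : nat) : (n <= z + d + b)%N -> (d * 200 <= q)%N ->
  n%:R - q%:R / 200%:R - b%:R <= z%:R :> R.
Proof.
move=> h1 h2; have : n%:R <= z%:R + d%:R + b%:R :> R by rewrite -!natrD ler_nat.
have : d%:R * 200%:R <= q%:R :> R by rewrite -natrM ler_nat.
by move=> *; lra.
Qed.

Lemma good_bound (n d q m : nat) : n%:R + q%:R / 200%:R <= q%:R / 20%:R :> R ->
  (d * 200 <= q)%N -> (m <= n + d)%N -> (m * 20 <= q)%N.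
Proof.
move=> h1 h2 h3; rewrite -(ler_nat R) natrM.
have : d%:R * 200%:R <= q%:R :> R by rewrite -natrM ler_nat.
have : m%:R <= n%:R + d%:R :> R by rewrite -natrD ler_nat.
by move=> *; lra.
Qed.

Lemma not_exceeding (A : {set J}) (g g' : J -> R) t s : s \in A ->
  s \notin [set s in A | t < g s] :|: [set s in A | t < g' s] -> g s <= t /\ g' s <= t.
Proof. by move=> sA; rewrite !inE sA /= negb_or -!leNgt => /andP. Qed.

(** [V] and [V'], the sets of directions with positive sign at the two vertices, are independent and
    close to each other with probability more than 1/2. So [V] is close to a fixed set, and the
    marginals show that this set is nearly all of [D]. *)
Lemma mode_abstract (D bad : {set J}) (A B : {set {set J}}) (c : pred (conf {set J}))
    (h h' : J -> pred (conf {set J})) :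
  (0 < #|D|)%N -> #|bad|%:R <= #|D|%:R / (100%:R * 100%:R * 5%:R) :> R ->
  [disjoint A & B] -> (forall s, s \in D -> meas (sq A) (h s)) ->
  (forall s, s \in D -> meas (sq B) (h' s)) -> p0 <= Ex (fun o => (c o)%:R) ->
  (forall s, s \in D -> s \notin bad ->
     Ex (fun o => (c o && (h s o != h' s o))%:R) <= 12%:R * (8%:R * tau1 R) /\
     p0 - 12%:R * (8%:R * tau1 R) <= Ex (fun o => (h s o)%:R)) ->
  34%:R / 60%:R <= Ex (fun o => (#|[set s in D | ~~ h s o]| * 20 <= #|D|)%N%:R).
Proof.
move=> D0 bad_small dQ mh mh' pc agr.
have q0 : 0 < #|D|%:R :> R by rewrite ltr0n.
have kap0 : 0 <= 12%:R * (8%:R * tau1 R) by rewrite mulr_ge0 ?ler0n //; case/andP: (tau1_small R).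
pose V o := [set s in D | h s o]; pose V' o := [set s in D | h' s o].
have memV o s : (s \in V o) = (s \in D) && h s o by rewrite in_set.
have memV' o s : (s \in V' o) = (s \in D) && h' s o by rewrite in_set.
have mV : meas (sq A) V.
  by move=> o o' k; apply/setP => s; rewrite !memV; case: (boolP (s \in D)) => //= sD; apply: mh.
have mV' : meas (sq B) V'.
  by move=> o o' k; apply/setP => s; rewrite !memV'; case: (boolP (s \in D)) => //= sD; apply: mh'.
pose d o := #|symdiff (V o) (V' o)|.
have dE : Ex (fun o => (c o)%:R * (d o)%:R) <= #|D|%:R * (12%:R * (8%:R * tau1 R)) + #|bad|%:R.
  have -> : Ex (fun o => (c o)%:R * (d o)%:R) =
     \sum_s Ex (fun o => (c o && (s \in symdiff (V o) (V' o)))%:R).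
    rewrite -Ex_sum; apply: eq_Ex => o; rewrite /d -sum_mem big_distrr.
    by apply: eq_bigr => s _; case: (c o) => /=; rewrite ?mul1r ?mul0r.
  rewrite -!sum_mem big_distrl -big_split /=; apply: ler_sum => s _.
  case: (boolP (s \in D)) => sD; last first.
    rewrite (eq_Ex mu (g := fun=> 0)) ?Ex_cst ?mul0r ?add0r ?ler0n // => o.
    by rewrite in_symdiff memV memV' (negPf sD) andbF.
  case: (boolP (s \in bad)) => sb.
    apply: (@le_trans _ _ 1); last by rewrite mul1r lerDr.
    by rewrite -[leRHS](Ex_cst mu1); apply: Ex_le => // o; case: (_ && _).
  rewrite mul1r addr0; have [le1 _] := agr s sD sb; apply: le_trans le1; apply: Ex_le => // o.
  rewrite in_symdiff memV memV' sD ler_nat.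
  by move: (c o) (h s o) (h' s o) => [] [] [].
(* Markov's inequality: the edge is open with probability at least [p0], and while it is open the
   sets seldom differ in more than [#|D| / 200] places. *)
have p1 : 34%:R / 60%:R <= Ex (fun o => (d o * 200 <= #|D|)%N%:R).
  apply: (mode_prob q0 bad_small dE).
  apply: (@le_trans _ _ (#|D|%:R * Ex (fun o => (c o)%:R))); first by rewrite (ler_pM2l q0); exact: pc.
  rewrite -!ExZ -ExD; apply: Ex_le => // o.
  case: (c o); last by rewrite mul0r !mulr0 addr0 mulr_ge0 ?ler0n.
  rewrite mul1r mulr1; case: leqP => l; rewrite /= ?mulr1 ?mulr0 ?add0r.
    by rewrite lerDl mulr_ge0 ?ler0n.
  by rewrite -natrM ler_nat mulnC ltnW.
have [o' ho'] := decouple (fun X Y : {set J} => (#|symdiff X Y| * 200 <= #|D|)%N) mu_ge0 mu1 mu_indep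
  dQ mV mV'.
set sg := V' o' in ho'; have p2 := le_trans p1 ho'.
set E := fun o => (#|symdiff (V o) sg| * 200 <= #|D|)%N in p2.
pose n := #|D :\: sg|; pose z o := (D :\: sg :\: V o) :\: bad.
have zE : Ex (fun o => #|z o|%:R) <= n%:R * (1 - p0 + 12%:R * (8%:R * tau1 R)).
  rewrite Ex_card -sum_mem big_distrl /=; apply: ler_sum => s _.
  case: (boolP (s \in D :\: sg)) => sD; last first.
    rewrite (eq_Ex mu (g := fun=> 0)) => [|o]; first by rewrite Ex_cst // mul0r.
    by rewrite /z in_setDDD (negPf sD).
  case: (boolP (s \in bad)) => sb.
    rewrite (eq_Ex mu (g := fun=> 0)) => [|o]; last by rewrite /z in_setDDD sb !andbF.
    by rewrite Ex_cst // mul1r addr_ge0 // /p0; lra.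
  move: (sD); rewrite in_setD => /andP[_ sD'].
  have [_ ge1] := agr s sD' sb; rewrite mul1r.
  have hE : Ex (fun o => (s \in z o)%:R) <= Ex (fun o => 1 - (h s o)%:R).
    apply: Ex_le => // o; rewrite /z in_setDDD memV (negPf sb) sD sD' /=.
    by case: (h s o); rewrite /= ?subr0 ?subrr.
  by apply: le_trans hE _; rewrite ExB Ex_cst // -addrA lerD2l lerNl opprD opprK.
have ptz o : (E o)%:R * (n%:R - #|D|%:R / 200%:R - #|bad|%:R) <= #|z o|%:R :> R.
  rewrite /E; case: leqP => l; rewrite /= ?mul0r ?mul1r //.
  exact: card_bound (card_symdiff_bound _ _ _ _) l.
(* If [sg] missed many directions, so would [V] with probability at least [34 / 60]; but a direction
   outside [bad] is missed with probability hardly more than [1 - p0 = 5 / 12]. *)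
have hz : n%:R + #|D|%:R / 200%:R <= #|D|%:R / 20%:R :> R.
  apply: (mode_zeros (P := Ex (fun o => (E o)%:R)) q0 (ler0n _ _) bad_small); last first.
    by apply: le_trans zE; rewrite -ExZr; apply: Ex_le ptz.
  rewrite p2 -[leRHS](Ex_cst mu1); apply: Ex_le => // o; by case: (E o).
apply: le_trans p2 _; apply: Ex_le => // o; rewrite ler_nat /E.
have [dl|//] := leqP (#|symdiff (V o) sg| * 200)%N #|D|.
suff -> : (#|[set s in D | ~~ h s o]| * 20 <= #|D|)%N by [].
apply: (good_bound hz dl).
apply: leq_trans (card_setD_symdiff D sg (V o)); apply: subset_leq_card; apply/subsetP => s.
by rewrite in_set in_setD memV => /andP[-> nh]; rewrite andbT.
Qed.

Variables (U D w v : {set J}) (r : J).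
Hypotheses (rU : r \notin U) (rD : r \notin D).
Hypotheses (wv : w :\ r = v :\ r) (rwv : (r \in w) != (r \in v)).
Hypotheses (dDU : [disjoint D & U]) (dDw : [disjoint D & w]) (D0 : (0 < #|D|)%N).
Hypotheses (gw : \sum_(s in D) slice_gain mu U w r s <= eps1 R * #|D|%:R)
           (gv : \sum_(s in D) slice_gain mu U v r s <= eps1 R * #|D|%:R).

Let H (x : {set J}) s o := half_lt (prd mu (Q (s |: U) x) x (s |: x) o).

Let bad := [set s in D | tau1 R ^+ 2 < slice_gain mu U w r s] :|:
           [set s in D | tau1 R ^+ 2 < slice_gain mu U v r s].

Let slice_gain_ge0 x s : 0 <= slice_gain mu U x r s.
Proof. by rewrite subr_ge0; apply: Psi_mono => //; apply: Q_sub; exact: subsetUr. Qed.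

Let bad_small : #|bad|%:R <= #|D|%:R / (100%:R * 100%:R * 5%:R) :> R.
Proof.
apply: mode_beta gw gv.
have h1 := @card_markov _ D (slice_gain mu U w r) (tau1 R ^+ 2) (fun s _ => slice_gain_ge0 w s).
have h2 := @card_markov _ D (slice_gain mu U v r) (tau1 R ^+ 2) (fun s _ => slice_gain_ge0 v s).
apply: le_trans (lerD h1 h2).
by rewrite -mulrDl -natrD ler_wpM2r ?exprn_ge0 ?(ltW (tau1_gt0 R)) // ler_nat leq_card_setU.
Qed.

Let agr s : s \in D -> s \notin bad ->
  Ex (fun o => (op o w v && (H w s o != H v s o))%:R) <= 12%:R * (8%:R * tau1 R) /\
  p0 - 12%:R * (8%:R * tau1 R) <= Ex (fun o => (H w s o)%:R).
Proof.
move=> sD sb.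
have [h1 h2] := not_exceeding sD sb.
by have [a b] := half_agreement mu_ge0 mu1 mu_indep mu_open rU rD wv rwv dDU dDw sD h1 h2; split.
Qed.

Let mH x s : s \in D -> meas (sq (Q (U :|: D) x)) (H x s).
Proof.
move=> sD o o' k; congr (half_lt _); apply: (@meas_ce _ _ mu) (agree_sub _ k).
apply: sqS; apply: subset_trans (subD1set _ _) _; apply: Q_sub.
by rewrite subUset sub1set inE sD orbT subsetUl.
Qed.

Lemma mode_good : 34%:R / 60%:R <= Ex (fun o => (good mu U D w o)%:R).
Proof.
have dQ : [disjoint Q (U :|: D) w & Q (U :|: D) v].
  by apply: Q_disjoint rwv; rewrite inE negb_or rU.
have pc := cube_edge_open mu_open wv rwv.
have := @mode_abstract D bad _ _ (fun o => op o w v) (H w) (H v) D0 bad_small dQ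
  (fun s sD => @mH w s sD) (fun s sD => @mH v s sD) pc agr.
move=> h; apply: le_trans h _.
apply: Ex_le => // o; rewrite ler_nat /good; have -> // : nbad mu U D w o = #|[set s in D | ~~ H w s o]|.
by apply: eq_card => s; rewrite !in_set /H /half_lt -leNgt.
Qed.

End ModeGood.

(** * Regular directions *)

Section Selection.
Variables (R : realFieldType) (J : finType).
Implicit Types (S D P T : {set J}) (t : J).

Lemma exists_subset_card q P : (q <= #|P|)%N -> exists2 D : {set J}, D \subset P & #|D| = q.
Proof.
case/card_geqP => s [us ss sP]; exists [set x : J | x \in s]; last by rewrite cardsE (card_uniqP us).
by apply/subsetP => x; rewrite inE => /sP.
Qed.

(** After each choice the whole set [D] is removed from the supply, so the elements chosen later
    avoid it. *)
Lemma select_many q m P (phi : {set J} -> J -> Prop) : (q * m <= #|P|)%N ->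
  (forall D, D \subset P -> #|D| = q -> exists2 t, t \in D & phi D t) ->
  exists T : {set J}, [/\ T \subset P, #|T| = m & forall t, t \in T ->
     exists D : {set J}, [/\ D \subset P, [disjoint D :\ t & T] & phi D t]].
Proof.
elim: m P => [|m IHm] P mP h.
  by exists set0; rewrite sub0set cards0; split=> // t; rewrite inE.
have [D DP Dq] : exists2 D : {set J}, D \subset P & #|D| = q.
  by apply: exists_subset_card; apply: leq_trans mP; rewrite mulnS leq_addr.
have [t tD pt] := h D DP Dq.
have [||T [TP Tm hT]] := IHm (P :\: D).
- by rewrite cardsD (setIidPr DP) Dq leq_subRL ?(leq_trans _ mP) // mulnS ?leq_addr.
- by move=> D' D'P; apply: h; apply: subset_trans D'P (subsetDl _ _).
have tT : t \notin T by apply: contraL tD => /(subsetP TP); rewrite inE => /andP[].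
exists (t |: T); split.
- rewrite subUset sub1set (subsetP DP) //=; apply: subset_trans TP (subsetDl _ _).
- by rewrite cardsU1 tT Tm.
move=> u; rewrite !inE => /orP[/eqP ->|uT].
  exists D; split=> //; rewrite disjoint_sym disjoints_subset; apply/subsetP => x.
  rewrite !inE => /orP[/eqP ->|/(subsetP TP)]; first by rewrite eqxx.
  by rewrite inE negb_and => /andP[-> _]; rewrite orbT.
have [D' [D'P dD' pD']] := hT u uT; exists D'; split=> //.
  exact: subset_trans D'P (subsetDl _ _).
rewrite disjoint_sym disjoints_subset; apply/subsetP => x.
rewrite !inE => /orP[/eqP ->|xT]; last by move: (disjointFl dD' xT); rewrite !inE => ->.
rewrite negb_and; apply/orP; right; apply: contraL tD => /(subsetP D'P).
by rewrite inE => /andP[].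
Qed.

(** An energy increment argument. If no [q]-set is stable over [S0], disjoint [q]-sets provide
    [q ^ k] elements that gain [eps] each; they become the new supply and all the rest is added to
    [S0]. The value cannot exceed [Lam], so this stops before the rounds are used up. *)
Lemma greedy (f : {set J} -> J -> R) (Lam eps : R) q k P S0 :
  (forall S S' t, S \subset S' -> f S t <= f S' t) -> (forall S t, f S t <= Lam) ->
  (q ^ k <= #|P|)%N -> [disjoint S0 & P] ->
  (forall t, t \in P -> Lam < f S0 t + k%:R * eps) ->
  exists S D : {set J}, [/\ S \subset S0 :|: P, D \subset P, [disjoint S & D], #|D| = q &
     forall t, t \in D -> f (S :|: (D :\ t)) t <= f S t + eps].
Proof.
move=> fmono fle; elim: k P S0 => [|k IHk] P S0 kP dS hP.
  have [t tP] := card_gt0P kP.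
  by have := hP t tP; rewrite mul0r addr0 ltNge fle.
case: (pickP (fun D : {set J} => [&& D \subset P, #|D| == q &
    [forall t in D, f (S0 :|: (D :\ t)) t <= f S0 t + eps]])) => [D|none].
  case/and3P => DP /eqP Dq /forall_inP hD; exists S0, D; split=> //; first exact: subsetUl.
  by apply: disjointWr dS.
have [|D DP Dq|T [TP Tm hT]] := @select_many q (q ^ k) P
    (fun D t => f S0 t + eps < f (S0 :|: (D :\ t)) t).
- by rewrite -expnS.
- move: (none D); rewrite DP Dq eqxx /= => /negbT; rewrite negb_forall_in => /exists_inP[t tD].
  by rewrite -ltNge; exists t.
have [||t tT|S [D [SP DP dSD Dq hD]]] := IHk T (S0 :|: (P :\: T)).
- by rewrite Tm.
- rewrite disjoint_sym disjoints_subset; apply/subsetP => x xT; rewrite !inE xT /= orbF.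
  by rewrite (disjointFl dS) // (subsetP TP).
- have [D [DP dD pD]] := hT t tT; have tP := subsetP TP t tT.
  have : f (S0 :|: (D :\ t)) t <= f (S0 :|: (P :\: T)) t.
    apply: fmono; apply: setUS; apply/subsetP => x xD; rewrite inE (disjointFr dD xD) /=.
    by move: xD; rewrite !inE => /andP[_]; apply: (subsetP DP).
  have := hP t tP; rewrite -natr1; move: pD; move: (f _ t) (f _ t) (f _ t) => u v w; lra.
exists S, D; split=> //; last exact: subset_trans DP TP.
apply: subset_trans SP _; rewrite -setUA; apply: setUS.
by rewrite subUset subsetDl TP.
Qed.

(* The energy gains of adding [r] to [chain G r] telescope over [r \in G], so only boundedly many are large. *)
Definition chain (G : {set J}) (r : J) := [set x in take (index r (enum G)) (enum G)].

Lemma chain_sub (G : {set J}) r : chain G r \subset G.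
Proof. by apply/subsetP => x; rewrite inE => /mem_take; rewrite mem_enum. Qed.

Lemma chain_notin (G : {set J}) r : r \in G -> r \notin chain G r.
Proof.
move=> rG; rewrite inE; apply/negP => h.
have : uniq (rcons (take (index r (enum G)) (enum G)) r).
  rewrite -[X in rcons _ X](nth_index r (_ : r \in enum G)) ?mem_enum //.
  by rewrite -take_nth ?index_mem ?mem_enum // take_uniq ?enum_uniq.
by rewrite rcons_uniq h.
Qed.

Lemma chain_telescope (F : {set J} -> R) (G : {set J}) :
  \sum_(r in G) (F (r |: chain G r) - F (chain G r)) = F G - F set0.
Proof.
have [G0|[x0 x0G]] := set_0Vmem G; first by rewrite G0 big_set0 subrr.
rewrite -big_enum /= (big_nth x0) big_mkord.
pose B i := F [set x in take i (enum G)].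
rewrite (eq_bigr (fun i : 'I_(size (enum G)) => B i.+1 - B i)) => [|i _].
  rewrite -(big_mkord predT (fun i => B i.+1 - B i)) telescope_sumr // /B take_size take0.
  by congr (F _ - F _); apply/setP => x; rewrite !inE ?mem_enum.
rewrite /B /chain index_uniq ?enum_uniq //; congr (F _ - _).
by apply/setP => x; rewrite (take_nth x0) // !inE mem_rcons inE.
Qed.

(** A failing set is some [Y] of size [K - 1] with one of at most [b] elements added. So there are
    at most [b] times the binomial coefficient ['C(#|G|, K.-1)] of them, fewer than all sets of size
    [K] once [G] is large. *)
Lemma free_set (B : {set J} -> {set J}) b K (G : {set J}) : (0 < K)%N ->
  (forall Y, #|B Y| <= b)%N -> (K * b + K <= #|G|)%N ->
  exists X : {set J}, [/\ X \subset G, #|X| = K & forall r, r \in X -> r \notin B (X :\ r)].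
Proof.
move=> K0 Bb NG.
pose dr k := [set X : {set J} | X \subset G & #|X| == k].
pose bad := [set X in dr K | [exists r in X, r \in B (X :\ r)]].
have sub : bad \subset \bigcup_(Y in dr K.-1) [set r |: Y | r in B Y].
  apply/subsetP => X; rewrite !inE => /andP[/andP[XG /eqP XK] /exists_inP[r rX rB]].
  apply/bigcupP; exists (X :\ r).
    by rewrite inE (subset_trans (subD1set _ _) XG) /= -XK (cardsD1 r X) rX.
  by apply/imsetP; exists r => //; rewrite setD1K.
have cbad : (#|bad| <= 'C(#|G|, K.-1) * b)%N.
  apply: leq_trans (subset_leq_card sub) _; apply: leq_trans (_ : \sum_(Y in dr K.-1) #|[set r |: Y | r in B Y]| <= _)%N.
    elim/big_ind2: _ => [|m X n Y hX hY|//]; first by rewrite cards0.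
    by apply: leq_trans (leq_card_setU _ _) _; apply: leq_add.
  rewrite -cards_draws -sum_nat_const; apply: leq_sum => Y _.
  exact: leq_trans (leq_imset_card _ _) (Bb _).
have : (#|bad| < #|dr K|)%N.
  apply: leq_ltn_trans cbad _; rewrite cards_draws.
  have := mul_bin_left #|G| K.-1; rewrite prednK // => h.
  have c0 : (0 < 'C(#|G|, K.-1))%N.
    by rewrite bin_gt0 (leq_trans (leq_pred _)) // (leq_trans _ NG) // leq_addl.
  rewrite -(ltn_pmul2l K0) h mulnCA mulnC ltn_pmul2r //.
  by move: NG K0; move: (K * b)%N #|G| => kb N; clear; lia.
move=> lt; case: (pickP (mem (dr K :\: bad))) => [X|none].
  rewrite !inE => /andP[nb /andP[XG XK]]; exists X; split=> //; first exact/eqP.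
  move=> r rX; apply: contra nb => h; rewrite XG XK /=; apply/exists_inP; by exists r.
exfalso; move: lt; rewrite ltnNge => /negP; apply; apply: subset_leq_card.
by rewrite -setD_eq0; apply/eqP/setP => x; rewrite [RHS]inE; exact: none.
Qed.

End Selection.

(** * Regular directions and stable sets for the energy *)

Section Regularity.
Variables (R : realFieldType) (J : finType) (mu : conf {set J} -> R).
Hypotheses (mu_ge0 : forall o, 0 <= mu o) (mu1 : \sum_o mu o = 1).
Hypothesis mu_indep : indep_on_disjoint mu.
Hypothesis mu_open : cube_open mu.
Notation Ex := (Ex mu).
Implicit Types (o : conf {set J}) (G S D w U : {set J}) (r s t : J).

Definition badset S D G w :=
  [set r in G | eps1 R * #|D|%:R < \sum_(s in D) slice_gain mu (chain G r :|: S) w r s].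

(** The total gain along the chain telescopes to at most [#|D|], so Markov's inequality gives a
    bound that does not depend on the size of [G]. *)
Lemma card_badset S D G w : (0 < #|D|)%N -> #|badset S D G w|%:R * eps1 R <= 1.
Proof.
move=> D0; have q0 : 0 < #|D|%:R :> R by rewrite ltr0n.
rewrite -(ler_pM2r q0) mul1r -mulrA.
pose f (A : {set J}) := \sum_(s in D) Psi mu (Q (s |: (A :|: S)) w) w (s |: w).
pose g r := \sum_(s in D) slice_gain mu (chain G r :|: S) w r s.
have gE r : g r = f (r |: chain G r) - f (chain G r).
  rewrite /g /f -sumrB; apply: eq_bigr => s _; rewrite /slice_gain.
  by rewrite (_ : s |: (r |: chain G r :|: S) = r |: (s |: (chain G r :|: S))) // -setUA setUCA.
have g0 r : 0 <= g r.
  by apply: sumr_ge0 => s _; rewrite subr_ge0; apply: Psi_mono => //; apply: Q_sub; exact: subsetUr.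
have h := @card_markov R J G g (eps1 R * #|D|%:R) (fun r _ => g0 r).
apply: le_trans h _; rewrite (eq_bigr _ (fun r _ => gE r)) chain_telescope.
apply: (@le_trans _ _ (f G)).
  by rewrite lerBlDr lerDl; apply: sumr_ge0 => s _; apply: Psi_ge0.
rewrite /f -sum1_card natr_sum; apply: ler_sum => s _; exact: Psi_le1.
Qed.

Lemma in_badset S D G w r : r \in G -> r \notin badset S D G w ->
  \sum_(s in D) slice_gain mu (chain G r :|: S) w r s <= eps1 R * #|D|%:R.
Proof. by move=> rG; rewrite in_set rG leNgt. Qed.

(** Regularity is required at both [w] and [w :\ r], the two slices that [mode_good] compares. *)
Definition usable_at S D G w r :=
  [&& r \in G, r \in w, r \notin badset S D G w & r \notin badset S D G (w :\ r)].

Definition usable S D G w := [exists r, usable_at S D G w r].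

Definition loc S D G w := if [pick r | usable_at S D G w r] is Some r then chain G r :|: S else S.

Lemma loc_sub S D G w : exists2 A : {set J}, A \subset G & loc S D G w = A :|: S.
Proof.
rewrite /loc; case: pickP => [r _|_]; first by exists (chain G r) => //; apply: chain_sub.
by exists set0; rewrite ?sub0set ?set0U.
Qed.

Lemma usable_good S D G w : (0 < #|D|)%N -> [disjoint S & D] -> [disjoint G & D] ->
  [disjoint G & S] -> [disjoint D & w] -> usable S D G w ->
  34%:R / 60%:R <= Ex (fun o => (good mu (loc S D G w) D w o)%:R).
Proof.
move=> D0 dSD dGD dGS dDw /existsP[r0 hr0]; rewrite /loc; case: pickP => [r|/(_ r0)]; last by rewrite hr0.
case/and4P => rG rw /(in_badset rG) h /(in_badset rG) h'.
have dD : [disjoint D & chain G r :|: S].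
  rewrite disjoint_sym disjoints_subset subUset; apply/andP; split; rewrite -disjoints_subset //.
  exact: disjointWl (chain_sub _ _) dGD.
apply: (@mode_good R J mu mu_ge0 mu1 mu_indep mu_open (chain G r :|: S) D w (w :\ r) r) => //.
- by rewrite inE negb_or chain_notin // (disjointFr dGS rG).
- by rewrite (disjointFr dGD rG).
- by apply/setP => x; rewrite !inE andbA andbb.
- by rewrite !inE eqxx rw.
Qed.

(** More than [b] directions of [G] occur in [w] and at most [b] of them are bad at [w]; freeness
    excludes badness at [w :\ r] for all of them. *)
Lemma free_usable S D G w b : (0 < #|D|)%N -> (#|badset S D G w| <= b)%N -> (b < #|G :&: w|)%N ->
  (forall r, r \in G :&: w -> r \notin badset S D G (w :\ r)) -> usable S D G w.
Proof.
move=> D0 hb hG free.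
have [r] : exists r, r \in (G :&: w) :\: badset S D G w.
  apply/set0Pn; rewrite -card_gt0 cardsD subn_gt0; apply: leq_ltn_trans hG.
  by apply: leq_trans hb; apply: subset_leq_card; exact: subsetIr.
rewrite in_setD => /andP[nb rGw]; apply/existsP; exists r; apply/and4P.
have /andP[rG rw] : (r \in G) && (r \in w) by rewrite -in_setI.
by split; [exact: rG|exact: rw|exact: nb|exact: free].
Qed.

Lemma term_le_sum (I : finType) (P : pred I) (g : I -> R) i :
  (forall j, 0 <= g j) -> P i -> g i <= \sum_(j | P j) g j.
Proof. by move=> g0 Pi; rewrite (bigD1 i) //= lerDl; apply: sumr_ge0. Qed.

(** Summing the energies over all [w] and [A] outside the pool makes one choice of [S] and [D]
    stable for all of them at once: every term of the sum has a nonnegative increment, so each is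
    bounded by the total. *)
Lemma pool_choice tau q k (Pl : {set J}) : 0 < tau -> (q ^ k <= #|Pl|)%N ->
  4%:R ^+ #|~: Pl| < k%:R * tau ^+ 2 ->
  exists S D : {set J}, [/\ S \subset Pl, D \subset Pl, [disjoint S & D], #|D| = q &
    forall w A : {set J}, w \subset ~: Pl -> A \subset ~: Pl -> stable mu tau (A :|: S) D w].
Proof.
move=> t0 qk hk.
pose f (S : {set J}) t := \sum_(w in powerset (~: Pl)) \sum_(A in powerset (~: Pl))
  Psi mu (Q (t |: (A :|: S)) w) w (t |: w).
have fmono S S' t : S \subset S' -> f S t <= f S' t.
  move=> SS; apply: ler_sum => w _; apply: ler_sum => A _; apply: Psi_mono => //; apply: Q_sub.
  by apply: setUS; apply: setUS.
have fle S t : f S t <= 4%:R ^+ #|~: Pl|.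
  apply: le_trans (_ : \sum_(w in powerset (~: Pl)) \sum_(A in powerset (~: Pl)) (1 : R) <= _).
    by apply: ler_sum => w _; apply: ler_sum => A _; exact: Psi_le1.
  by rewrite !sumr_const card_powerset -mulrnA -natrX ler_nat -expnMn.
have f0 S t : 0 <= f S t.
  by apply: sumr_ge0 => w _; apply: sumr_ge0 => A _; exact: Psi_ge0.
have [||S [D [SP DP dSD Dq hD]]] := @greedy R J f (4%:R ^+ #|~: Pl|) (tau ^+ 2) q k Pl set0 fmono fle qk.
- by rewrite disjoints_subset sub0set.
- by move=> t _; apply: lt_le_trans hk _; rewrite lerDr.
rewrite set0U in SP; exists S, D; split=> // w A wP AP t tD.
have {hD} := hD t tD; set F := fun S' w A => Psi mu (Q (t |: (A :|: S')) w) w (t |: w).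
have F0 w' A' : 0 <= F (S :|: D :\ t) w' A' - F S w' A'.
  rewrite subr_ge0; apply: Psi_mono => //; apply: Q_sub.
  by apply: setUS; apply: setUS; exact: subsetUl.
rewrite -lerBlDl /f -sumrB => h.
have -> : Psi mu (Q (A :|: S :|: D) w) w (t |: w) = F (S :|: D :\ t) w A.
  rewrite /F (_ : t |: (A :|: (S :|: D :\ t)) = A :|: S :|: D) //.
  by apply/setP => x; rewrite !inE; case: eqP => [->|_] /=; rewrite ?tD ?orbT ?orbA.
apply: le_trans h.
pose g w' := \sum_(A' in powerset (~: Pl)) (F (S :|: D :\ t) w' A' - F S w' A').
apply: (@le_trans _ _ (g w)).
  by apply: (term_le_sum (fun A' => F0 w A')); rewrite powersetE.
apply: (@le_trans _ _ (\sum_(w' in powerset (~: Pl)) g w')).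
  apply: (@term_le_sum _ _ g); last by rewrite powersetE.
  by move=> w'; apply: sumr_ge0 => A' _; exact: F0.
by apply: ler_sum => w' _; rewrite /g sumrB.
Qed.

Lemma Ex_none (s : seq J) (W : J -> {set {set J}}) (E : J -> pred (conf {set J})) c :
  c <= 1 -> uniq s -> (forall i, i \in s -> meas (sq (W i)) (E i)) ->
  (forall i j, i \in s -> j \in s -> i != j -> [disjoint W i & W j]) ->
  (forall i, i \in s -> c <= Ex (fun o => (E i o)%:R)) ->
  Ex (fun o => (all (fun i => ~~ E i o) s)%:R) <= (1 - c) ^+ size s.
Proof.
move=> c1; elim: s => [|i s IHs] /=; first by rewrite Ex_cst.
case/andP => iS us mE dW hc.
have tl j : j \in s -> j \in i :: s by rewrite inE orbC => ->.
have IH := IHs us (fun j js => mE j (tl j js)) (fun j l js ls => dW j l (tl j js) (tl l ls))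
  (fun j js => hc j (tl j js)).
have dis : [disjoint W i & \bigcup_(j in s) W j].
  rewrite disjoint_sym disjoints_subset; apply/bigcupsP => j js; rewrite -disjoints_subset.
  by apply: dW; rewrite ?inE ?eqxx ?js ?orbT //; apply: contraNneq iS => <-.
have ms : meas (sq (\bigcup_(j in s) W j)) (fun o => (all (fun i => ~~ E i o) s)%:R : R).
  move=> o o' h; congr (nat_of_bool _)%:R; apply: eq_in_all => j js; congr (~~ _).
  apply: (mE j (tl j js)); apply: agree_sub h; apply: sqS.
  exact: bigcup_sup.
have mi : meas (sq (W i)) (fun o => (~~ E i o)%:R : R).
  by move=> o o' h; rewrite (mE i (mem_head _ _) _ _ h).
rewrite (eq_Ex mu (g := fun o => (~~ E i o)%:R * (all (fun i => ~~ E i o) s)%:R)); last first.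
  by move=> o; rewrite -natrM mulnb.
rewrite (Ex_indep mu_indep dis mi ms) exprS.
apply: ler_pM => //; try by apply: Ex_ge0 => // o; exact: ler0n.
have -> : Ex (fun o => (~~ E i o)%:R) = 1 - Ex (fun o => (E i o)%:R).
  by rewrite -[X in X - _](Ex_cst mu1) -ExB; apply: eq_Ex => o; case: (E i o); rewrite /= ?subrr ?subr0.
by rewrite lerD2l lerN2 hc ?mem_head.
Qed.

End Regularity.

(** * Rows of good vertices *)

Section UnionBound.
Variables (R : realFieldType) (V : finType) (mu : conf V -> R).
Hypotheses (mu_ge0 : forall o, 0 <= mu o) (mu1 : \sum_o mu o = 1).
Notation Ex := (Ex mu).

Lemma union_bound2 (E F : pred (conf V)) :
  Ex (fun o => (~~ (E o && F o))%:R) <= Ex (fun o => (~~ E o)%:R) + Ex (fun o => (~~ F o)%:R).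
Proof.
rewrite -ExD; apply: Ex_le => // o.
by case: (E o); case: (F o); rewrite /= ?addr0 ?add0r // lerDl.
Qed.

Lemma both_prob (E F : pred (conf V)) a b : a <= Ex (fun o => (E o)%:R) ->
  b <= Ex (fun o => (F o)%:R) -> a + b - 1 <= Ex (fun o => (E o && F o)%:R).
Proof.
move=> hE hF; apply: le_trans (lerB (lerD hE hF) (lexx 1)) _.
rewrite lerBlDr -ExD -[X in _ <= _ + X](Ex_cst mu1) -ExD; apply: Ex_le => // o.
by case: (E o); case: (F o); rewrite /= ?addr0 ?add0r.
Qed.

Lemma union_bound_all (I : finType) (A : pred I) (E : I -> pred (conf V)) (b : R) :
  (forall i, A i -> Ex (fun o => (~~ E i o)%:R) <= b) ->
  Ex (fun o => (~~ [forall (i | A i), E i o])%:R) <= #|A|%:R * b.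
Proof.
move=> h; apply: (@le_trans _ _ (\sum_(i | A i) Ex (fun o => (~~ E i o)%:R))); last first.
  by rewrite mulr_natl -sumr_const; apply: ler_sum => i Ai; apply: h.
rewrite -Ex_sum; apply: Ex_le => // o; case: forall_inP => [_|/forall_inP] /=.
  by apply: sumr_ge0 => i _; exact: ler0n.
rewrite negb_forall_in => /exists_inP[i Ai nE].
apply: le_trans (term_le_sum (g := fun i => (~~ E i o)%:R) _ Ai); first by rewrite nE.
by move=> j; exact: ler0n.
Qed.

End UnionBound.

Lemma and3_natr (R : realFieldType) (a b c : bool) : [&& a, b & c]%:R = a%:R * (b%:R * c%:R) :> R.
Proof. by case: a; case: b; case: c; rewrite /= ?mulr1 ?mulr0 ?mul0r. Qed.

Section Structure.
Variables (R : realFieldType) (J : finType) (mu : conf {set J} -> R).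
Hypotheses (mu_ge0 : forall o, 0 <= mu o) (mu1 : \sum_o mu o = 1).
Hypothesis mu_indep : indep_on_disjoint mu.
Hypothesis mu_open : cube_open mu.
Notation Ex := (Ex mu).
Implicit Types (o : conf {set J}) (L w T : {set J}) (r m : J) (c d : bool).

Variables (tau eta : R) (l : nat) (S D Ms Pl : {set J}) (G : bool -> {set J}).
Hypotheses (tau0 : 0 < tau) (l0 : (0 < l)%N) (Dl : #|D| = (l * l).*2).
Hypotheses (SP : S \subset Pl) (DP : D \subset Pl) (dSD : [disjoint S & D]).
Hypotheses (MP : [disjoint Ms & Pl]) (GP : forall c, [disjoint G c & Pl]).
Hypotheses (MG : forall c, [disjoint Ms & G c]).
Hypothesis st : forall w A : {set J}, w \subset ~: Pl -> A \subset ~: Pl -> stable mu tau (A :|: S) D w.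

Definition gd c w o := good mu (loc mu S D (G c) w) D w o.
Let Uc c := G c :|: S :|: D.

Let D0 : (0 < #|D|)%N. Proof. by rewrite Dl double_gt0 muln_gt0 l0. Qed.

Let dDC w : w \subset ~: Pl -> [disjoint D & w].
Proof.
move=> wP; rewrite disjoint_sym disjoints_subset; apply: subset_trans wP _.
by rewrite setCS.
Qed.

Lemma meas_gd c w : meas (sq (Q (Uc c) w)) (gd c w).
Proof.
have [A AG lE] := loc_sub mu S D (G c) w.
move=> o o' h; rewrite /gd /good lE; congr (_ * 20 <= _)%N.
apply: eq_card => t; rewrite !in_set; case: (boolP (t \in D)) => //= tD; congr (_ <= _).
apply: (@meas_ce _ _ mu) (agree_sub _ h); apply: sqS; apply: subset_trans (subD1set _ _) _.
apply: Q_sub; rewrite subUset sub1set /Uc inE tD orbT /=.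
by apply: subset_trans (subsetUl _ _); apply: setSU.
Qed.

Lemma gd_prob c w : w \subset ~: Pl -> usable mu S D (G c) w -> 34%:R / 60%:R <= Ex (fun o => (gd c w o)%:R).
Proof.
move=> wP us; apply: usable_good => //.
- exact: disjointWr DP (GP c).
- exact: disjointWr SP (GP c).
- exact: dDC.
Qed.

Let notU c m : m \in Ms -> m \notin Uc c.
Proof.
move=> mM; rewrite !inE !negb_or (disjointFr (MG c) mM) /=; have mP := disjointFr MP mM.
by apply/andP; split; apply: contraFN mP; [exact: (subsetP SP)|exact: (subsetP DP)].
Qed.

(** Goodness in group [c] may use any direction of [G c], whereas [join_good] needs a step [r] that
    is used at neither end. Hence [r] has to avoid both groups involved. *)
Definition joined o := [forall (p : (bool * bool) * ({set J} * J) |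
    (p.2.1 \in powerset (~: Pl)) && (p.2.2 \in ~: Pl)),
  [&& p.2.2 \notin p.2.1, p.2.2 \notin G p.1.1 & p.2.2 \notin G p.1.2] ==>
  gd p.1.1 p.2.1 o ==> gd p.1.2 (p.2.2 |: p.2.1) o ==> conn o setT p.2.1 (p.2.2 |: p.2.1)].

Lemma joined_prob : 100%:R ^+ 2 + 100%:R ^+ 3 * (l%:R * tau) <= l%:R * eta ->
  Ex (fun o => (~~ joined o)%:R) <= (4 * (2 ^ #|~: Pl| * #|~: Pl|))%N%:R * eta.
Proof.
move=> he; have l0R : 0 < l%:R :> R by rewrite ltr0n.
have eta0 : 0 <= eta.
  rewrite -(ler_pM2l l0R) mulr0; apply: le_trans he.
  by rewrite addr_ge0 ?exprn_ge0 ?ler0n // !mulr_ge0 ?exprn_ge0 ?ler0n // ltW.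
apply: le_trans (@union_bound_all _ _ mu mu_ge0 _ _ _ eta _) _; last first.
  rewrite ler_wpM2r // ler_nat.
  have -> : 4%N = #|[set: bool * bool]| by rewrite cardsT card_prod card_bool.
  rewrite -card_powerset -!cardsX; apply: subset_leq_card; apply/subsetP => -[[c d] [w r]] h.
  by rewrite !in_setX in_setT; exact: h.
move=> [[c d] [w r]] /=; rewrite powersetE => /andP[wP rP].
case: (boolP [&& _, _ & _]) => [/and3P[rw rc rd]|_]; last first.
  by rewrite (eq_Ex mu (g := fun=> 0)) ?Ex_cst.
have [A AG lA] := loc_sub mu S D (G c) w; have [A' AG' lA'] := loc_sub mu S D (G d) (r |: w).
have rwP : r |: w \subset ~: Pl by rewrite subUset sub1set rP.
have AP : A \subset ~: Pl by rewrite -disjoints_subset; apply: disjointWl AG (GP c).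
have AP' : A' \subset ~: Pl by rewrite -disjoints_subset; apply: disjointWl AG' (GP d).
have rP' : r \notin Pl by rewrite inE in rP.
have rS : r \notin S by apply: contra rP' => /(subsetP SP).
have rD : r \notin D by apply: contra rP' => /(subsetP DP).
have dDA (B : {set J}) : B \subset ~: Pl -> [disjoint D & B :|: S].
  move=> BP; rewrite disjoint_sym disjoints_subset subUset; apply/andP; split.
    by apply: subset_trans BP _; rewrite setCS.
  by rewrite -disjoints_subset.
have rU (B : {set J}) f : B \subset G f -> r \notin G f -> r \notin B :|: S.
  by move=> BG rf; rewrite inE negb_or rS andbT; apply: contra rf; apply: (subsetP BG).
have := @join_good R J mu mu_ge0 mu1 mu_indep mu_open (A :|: S) (A' :|: S) D w r tau l tau0 l0 Dl rw
  (rU _ _ AG rc) (rU _ _ AG' rd) rD (dDA _ AP) (dDA _ AP') (dDC wP) (st wP AP) (st rwP AP').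
move/le_trans => /(_ _ he); rewrite ler_pM2l // => h; apply: le_trans h.
apply: Ex_le => // o; rewrite ler_nat /gd lA lA'.
by move: (good _ _ _ _ o) (good _ _ _ _ o) (conn _ _ _ _) => [] [] [].
Qed.

Opaque gd.

(* The row of [L] consists of the vertices [m |: L], [m \in Ms].  Two good ones are joined through
   [m |: (x |: L)], [x |: L] and [m' |: (x |: L)] for the [x] provided by [link]; [share] allows to pass from one
   row to another one. *)
Definition link c L o := [forall (m | m \in Ms), [forall (m' | m' \in Ms :\ m),
  [exists x in Ms :\ m :\ m', [&& gd c (x |: L) o, gd c (m |: (x |: L)) o & gd c (m' |: (x |: L)) o]]]].

Definition share c L d L' o := [exists x in Ms, gd c (x |: L) o && gd d (x |: L') o].

Definition row c L := [&& L \subset ~: Pl, [disjoint Ms & L] &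
  [forall m in Ms, forall m' in Ms, usable mu S D (G c) (m |: (m' |: L))]].

Let row_gd c L m m' : row c L -> m \in Ms -> m' \in Ms ->
  34%:R / 60%:R <= Ex (fun o => (gd c (m |: (m' |: L)) o)%:R).
Proof.
case/and3P => LP _ /forall_inP h mM mM'; apply: gd_prob; last exact: (forall_inP (h m mM)).
have MP' : Ms \subset ~: Pl by rewrite -disjoints_subset.
by rewrite !subUset !sub1set !(subsetP MP') // LP.
Qed.

Let row_gd1 c L m : row c L -> m \in Ms -> 34%:R / 60%:R <= Ex (fun o => (gd c (m |: L) o)%:R).
Proof. by move=> rL mM; have := row_gd rL mM mM; rewrite setUA setUid. Qed.

Let QU_disj c d w w' m : m \in Ms -> (m \in w) != (m \in w') -> [disjoint Q (Uc c) w & Q (Uc d) w'].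
Proof. by move=> mM; apply: Q_disjoint; exact: notU. Qed.

Let disjoint3 (T : finType) (A1 A2 A3 B : {set T}) : [disjoint A1 & B] -> [disjoint A2 & B] ->
  [disjoint A3 & B] -> [disjoint A1 :|: A2 :|: A3 & B].
Proof. by rewrite !disjoints_subset !subUset => -> -> ->. Qed.

(** The subcubes that decide goodness for different [x] differ in the coordinate [x], which is not
    one of their directions. So the attempts are independent, and so are the three events within one
    attempt. *)
Lemma link_prob c L : row c L ->
  Ex (fun o => (~~ link c L o)%:R) <=
  #|Ms|%:R * (#|Ms|%:R * (1 - (34%:R / 60%:R) ^+ 3) ^+ (#|Ms| - 2)).
Proof.
move=> rL; set b := (1 - _) ^+ _.
have c01 : 0 <= ((34%:R / 60%:R) ^+ 3 : R) <= 1.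
  by rewrite exprn_ge0 ?divr_ge0 ?ler0n //= exprn_ile1 ?divr_ge0 ?ler0n // ler_pdivrMr ?ltr0n // mul1r ler_nat.
have b0 : 0 <= b by rewrite exprn_ge0 // subr_ge0; case/andP: c01.
apply: union_bound_all => // m mM.
apply: le_trans (@union_bound_all _ _ mu mu_ge0 _ _ _ b _) _; last first.
  by rewrite ler_wpM2r // ler_nat; apply: subset_leq_card; exact: subD1set.
move=> m'; rewrite in_setD1 => /andP[mm' mM'].
pose W x := Q (Uc c) (x |: L) :|: Q (Uc c) (m |: (x |: L)) :|: Q (Uc c) (m' |: (x |: L)).
pose E x o := [&& gd c (x |: L) o, gd c (m |: (x |: L)) o & gd c (m' |: (x |: L)) o].
have dL := let: And3 _ d _ := and3P rL in d.
have nL x : x \in Ms -> x \notin L by move=> xM; rewrite (disjointFr dL xM).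
have sP x : x \in enum (Ms :\ m :\ m') -> [/\ x \in Ms, x != m & x != m'].
  by rewrite mem_enum !in_setD1 => /and3P[-> -> ->].
have sz : size (enum (Ms :\ m :\ m')) = (#|Ms| - 2)%N.
  rewrite -cardE; have h1 := cardsD1 m Ms; have h2 := cardsD1 m' (Ms :\ m).
  by move: h1 h2; rewrite mM in_setD1 mm' mM' /= => -> ->; rewrite !add1n subn2.
have := @Ex_none R J mu mu_ge0 mu1 mu_indep (enum (Ms :\ m :\ m')) W E ((34%:R / 60%:R) ^+ 3).
rewrite sz -/b => h; apply: le_trans (h _ _ _ _ _); first last.
- move=> x /sP[xM xm xm']; rewrite exprS expr2.
  have mx : (m == x) = false by rewrite eq_sym; exact: negbTE.
  have mx' : (m' == x) = false by rewrite eq_sym; exact: negbTE.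
  have d1 : [disjoint Q (Uc c) (x |: L) & Q (Uc c) (m |: (x |: L)) :|: Q (Uc c) (m' |: (x |: L))].
    rewrite disjoint_sym disjoints_subset subUset -!disjoints_subset.
    rewrite (@QU_disj c c _ _ m) ?(@QU_disj c c _ _ m') //.
      by rewrite !in_setU1 eqxx mx' (negPf (nL _ mM')).
    by rewrite !in_setU1 eqxx mx (negPf (nL _ mM)).
  have d2 : [disjoint Q (Uc c) (m |: (x |: L)) & Q (Uc c) (m' |: (x |: L))].
    apply: (@QU_disj c c _ _ m) => //.
    by rewrite !in_setU1 eqxx (eq_sym m m') (negPf mm') mx (negPf (nL _ mM)).
  have mg w : meas (sq (Q (Uc c) w)) (fun o => (gd c w o)%:R : R).
    by move=> o o' k; rewrite (meas_gd k).
  have E1 : Ex (fun o => (E x o)%:R) = Ex (fun o => (gd c (x |: L) o)%:R *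
      ((gd c (m |: (x |: L)) o)%:R * (gd c (m' |: (x |: L)) o)%:R)).
    by apply: eq_Ex => o; exact: and3_natr.
  rewrite E1 (Ex_indep mu_indep d1 (mg _)); last first.
    move=> o o' k; congr (_ * _); apply: mg; apply: agree_sub k; apply: sqS.
      exact: subsetUl.
    exact: subsetUr.
  rewrite (Ex_indep mu_indep d2 (mg _) (mg _)).
  have p0 : 0 <= 34%:R / 60%:R :> R by rewrite divr_ge0 ?ler0n.
  apply: ler_pM; [exact: p0|exact: mulr_ge0|exact: row_gd1|].
  by apply: ler_pM; [exact: p0|exact: p0|exact: row_gd|exact: row_gd].
- move=> x y /sP[xM xm xm'] /sP[yM ym ym'] xy.
  have xN (z : {set J}) : z \in [:: y |: L; m |: (y |: L); m' |: (y |: L)] -> x \notin z.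
    rewrite !inE => /or3P[]/eqP ->;
      by rewrite !in_setU1 ?(negPf xm) ?(negPf xm') (negPf xy) (negPf (nL _ xM)).
  have dis1 (z z' : {set J}) : x \in z -> z' \in [:: y |: L; m |: (y |: L); m' |: (y |: L)] ->
      [disjoint Q (Uc c) z & Q (Uc c) z'].
    by move=> xz /xN xz'; apply: (@QU_disj c c _ _ x) => //; rewrite xz (negPf xz').
  apply: disjoint3; rewrite disjoint_sym; apply: disjoint3; rewrite disjoint_sym;
    by apply: dis1; rewrite ?in_setU1 ?eqxx ?orbT // !inE eqxx ?orbT.
- move=> x _ o o' k; rewrite /E; congr [&& _, _ & _]; apply: meas_gd; apply: agree_sub k; apply: sqS.
  + by rewrite /W -setUA; exact: subsetUl.
  + by rewrite /W setUAC; exact: subsetUr.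
  + exact: subsetUr.
- exact: enum_uniq.
- by case/andP: c01.
apply: Ex_le => // o; rewrite ler_nat; case: exists_inP => //= nx.
case: allP => // h2; exfalso; apply: h2 => x; rewrite mem_enum => xM.
by apply/negP => Ex; apply: nx; exists x.
Qed.

(** The two events at one position may depend on each other, but each has probability at least
    [34 / 60], more than 1/2; they occur together with probability at least [8 / 60]. *)
Lemma share_prob c L d L' : row c L -> row d L' ->
  Ex (fun o => (~~ share c L d L' o)%:R) <= (1 - 8%:R / 60%:R) ^+ #|Ms|.
Proof.
move=> rL rL'; pose W x := Q (Uc c) (x |: L) :|: Q (Uc d) (x |: L').
pose E x o := gd c (x |: L) o && gd d (x |: L') o.
have dL := let: And3 _ d _ := and3P rL in d; have dL' := let: And3 _ d _ := and3P rL' in d.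
have h := @Ex_none R J mu mu_ge0 mu1 mu_indep (enum Ms) W E (8%:R / 60%:R).
rewrite cardE; apply: le_trans (h _ _ _ _ _); first last.
- move=> x; rewrite mem_enum => xM.
  by apply: le_trans (both_prob mu_ge0 mu1 (row_gd1 rL xM) (row_gd1 rL' xM)); lra.
- move=> x y; rewrite !mem_enum => xM yM xy.
  have nx (K : {set J}) : [disjoint Ms & K] -> x \notin y |: K.
    by move=> dK; rewrite in_setU1 negb_or xy (disjointFr dK xM).
  have xx (K : {set J}) : x \in x |: K by rewrite in_setU1 eqxx.
  rewrite disjoints_subset subUset -!disjoints_subset.
  by rewrite ![[disjoint _ & Q _ _ :|: _]]disjoint_sym !disjoints_subset !subUset -!disjoints_subset
    !(@QU_disj _ _ _ _ x) // xx ?(negPf (nx _ dL)) ?(negPf (nx _ dL')).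
- move=> x _ o o' k; rewrite /E; congr (_ && _); apply: meas_gd; apply: agree_sub k; apply: sqS.
    exact: subsetUl.
  exact: subsetUr.
- exact: enum_uniq.
- by rewrite ler_pdivrMr ?ltr0n // mul1r ler_nat.
apply: Ex_le => // o; rewrite ler_nat /share; case: exists_inP => //= nx.
case: allP => // h2; exfalso; apply: h2 => x; rewrite mem_enum => xM.
by apply/negP => Ex; apply: nx; exists x.
Qed.

Lemma joinedP o c d w r : joined o -> w \subset ~: Pl -> r \notin Pl -> r \notin w -> r \notin G c ->
  r \notin G d -> gd c w o -> gd d (r |: w) o -> conn o setT w (r |: w).
Proof.
move=> /forall_inP h wP rP rw rc rd gw gr; have := h ((c, d), (w, r)); rewrite /= powersetE inE wP rP.
by rewrite rw rc rd gw gr; apply.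
Qed.

Definition rowconn c L d L' o := forall m m', m \in Ms -> m' \in Ms ->
  gd c (m |: L) o -> gd d (m' |: L') o -> conn o setT (m |: L) (m' |: L').

Lemma rowconn_sym c L d L' o : rowconn c L d L' o -> rowconn d L' c L o.
Proof. by move=> h m m' mM mM' g1 g2; rewrite connC; apply: h. Qed.

Let MsPl m : m \in Ms -> m \notin Pl. Proof. by move=> mM; rewrite (disjointFr MP). Qed.
Let MsG c m : m \in Ms -> m \notin G c. Proof. by move=> mM; rewrite (disjointFr (MG c)). Qed.

Lemma row_self c L o : joined o -> row c L -> link c L o -> rowconn c L c L o.
Proof.
move=> jo /and3P[LP dL _] /forall_inP lk m m' mM mM' g1 g2.
have [->|mm'] := eqVneq m' m; first exact: connect0.
have := lk m mM => /forall_inP/(_ m'); rewrite in_setD1 mm' mM' => /(_ isT) /exists_inP[x].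
rewrite !in_setD1 => /and3P[xm' xm xM] /and3P[gx gmx gm'x].
have nL y : y \in Ms -> y \notin L by move=> yM; rewrite (disjointFr dL yM).
have sub y : y \in Ms -> y |: L \subset ~: Pl by move=> yM; rewrite subUset sub1set inE MsPl.
have up y : y \in Ms -> x != y -> gd c (y |: L) o -> gd c (y |: (x |: L)) o ->
    conn o setT (y |: L) (x |: L).
  move=> yM xy gy gyx.
  have nx : x \notin y |: L by rewrite in_setU1 negb_or xy nL.
  have ny : y \notin x |: L by rewrite in_setU1 negb_or eq_sym xy nL.
  have c2 := joinedP jo (sub x xM) (MsPl yM) ny (MsG c yM) (MsG c yM) gx gyx.
  rewrite setUCA in gyx c2.
  have c1 := joinedP jo (sub y yM) (MsPl xM) nx (MsG c xM) (MsG c xM) gy gyx.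
  by rewrite connC in c2; exact: conn_trans c1 c2.
have c1 := up m mM xm g1 gmx; have c2 := up m' mM' xm' g2 gm'x.
by rewrite connC in c2; exact: conn_trans c1 c2.
Qed.

Lemma row_same c L d o : joined o -> row c L -> row d L -> link c L o -> link d L o ->
  share c L d L o -> rowconn c L d L o.
Proof.
move=> jo rc rd lc ld /exists_inP[x xM /andP[gc gd']] m m' mM mM' g1 g2.
exact: conn_trans (row_self jo rc lc mM xM g1 gc) (row_self jo rd ld xM mM' gd' g2).
Qed.

Lemma row_adj c L d r o : joined o -> row c L -> row d (r |: L) -> link c L o -> link d (r |: L) o ->
  share c L d (r |: L) o -> r \notin Pl -> r \notin L -> r \notin G c -> r \notin G d -> r \notin Ms ->
  rowconn c L d (r |: L) o.
Proof.
move=> jo rc rd lc ld /exists_inP[x xM /andP[gc gd']] rP rL rGc rGd rM m m' mM mM' g1 g2.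
have c1 := row_self jo rc lc mM xM g1 gc; have c3 := row_self jo rd ld xM mM' gd' g2.
have rx : r \notin x |: L by rewrite in_setU1 negb_or rL andbT; apply: contraNneq rM => ->.
have xP : x |: L \subset ~: Pl by case/and3P: rc => LP _ _; rewrite subUset sub1set inE MsPl.
rewrite setUCA in gd' c3; have c2 := joinedP jo xP rP rx rGc rGd gc gd'.
exact: conn_trans c1 (conn_trans c2 c3).
Qed.

(** [share] only provides a good vertex in the middle row, through which the two connections are
    composed. *)
Lemma rowconn_trans c L d L' f L'' K o (h : bool) : share d L' h K o ->
  rowconn c L d L' o -> rowconn d L' f L'' o -> rowconn c L f L'' o.
Proof.
move=> /exists_inP[x xM /andP[gx _]] h1 h2 m m' mM mM' g1 g2.
exact: conn_trans (h1 m x mM xM g1 gx) (h2 x m' xM mM' gx g2).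
Qed.

Lemma row_steps c L T o : joined o ->
  (forall T', T' \subset T -> row c (T' :|: L) && link c (T' :|: L) o) ->
  (forall T' T'', T' \subset T -> T'' \subset T -> share c (T' :|: L) c (T'' :|: L) o) ->
  [disjoint T & Pl] -> [disjoint T & L] -> [disjoint T & G c] -> [disjoint T & Ms] ->
  forall T', T' \subset T -> rowconn c L c (T' :|: L) o.
Proof.
move=> jo rl sh dP dL dG dM T'; move: {2}#|T'| (erefl #|T'|) => n.
elim: n T' => [|n IHn] T' cT TT.
  move/eqP: cT; rewrite cards_eq0 => /eqP ->; rewrite set0U.
  by have /andP[] := rl set0 (sub0set _); rewrite set0U; apply: row_self.
have [r rT'] : exists r, r \in T' by apply/set0Pn; rewrite -card_gt0 cT.
have rT := subsetP TT r rT'.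
have sT : T' :\ r \subset T := subset_trans (subD1set _ _) TT.
have E : T' :|: L = r |: (T' :\ r :|: L) by rewrite setUA setD1K.
have IH : rowconn c L c (T' :\ r :|: L) o.
  by apply: IHn => //; move: cT; rewrite (cardsD1 r T') rT' => -[].
apply: (rowconn_trans (sh _ _ sT sT) IH); rewrite E.
have /andP[r1 l1] := rl _ sT; have /andP[r2 l2] := rl _ TT; have s := sh _ _ sT TT.
rewrite E in r2 l2 s; apply: row_adj => //.
- by rewrite (disjointFr dP).
- by rewrite !inE eqxx /= (disjointFr dL).
- by rewrite (disjointFr dG).
- by rewrite (disjointFr dG).
- by rewrite (disjointFr dM).
Qed.

Variables (e : J) (X Y Z : {set J}).
Hypotheses (eM : e \notin Ms) (eG : forall c, e \notin G c) (eP : e \notin Pl).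
Hypotheses (XG : X \subset G false) (YG : Y \subset G false) (ZG : Z \subset G true).
Hypothesis dG : [disjoint G false & G true].

(* The rows leading from [X] to [e |: Y]: the elements of [Z] are added one at a time, then, with the roles of
   the two groups exchanged, [X] is replaced by [Y] and [e] is added, and finally [Z] is removed. *)
Definition rowset : {set bool * {set J}} :=
  [set (false, T :|: X) | T in powerset Z] :|: [set (false, T :|: (e |: Y)) | T in powerset Z] :|:
  [set (true, T :|: Z) | T in powerset (X :|: Y)] :|:
  [set (true, T :|: (e |: Z)) | T in powerset (X :|: Y)].

Hypothesis rows : forall p, p \in rowset -> row p.1 p.2.

Definition sound o := joined o && ([forall (p | p \in rowset), link p.1 p.2 o] &&
  [forall (p | p \in rowset), [forall (q | q \in rowset), share p.1 p.2 q.1 q.2 o]]).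

Lemma card_rowset K : #|X| = K -> #|Y| = K -> #|Z| = K -> (#|rowset| <= 4 * 4 ^ K)%N.
Proof.
move=> cX cY cZ.
have hZ : (#|powerset Z| <= 4 ^ K)%N by rewrite card_powerset cZ (_ : 4 = 2 * 2)%N // expnMn leq_pmull // expn_gt0.
have hXY : (#|powerset (X :|: Y)| <= 4 ^ K)%N.
  rewrite card_powerset (_ : 4 = 2 ^ 2)%N // -expnM leq_exp2l // mulSn mul1n -{1}cX -cY.
  exact: leq_card_setU.
apply: leq_trans (leq_card_setU _ _) _; rewrite (_ : 4 * 4 ^ K = 4 ^ K + 4 ^ K + 4 ^ K + 4 ^ K)%N;
  last by rewrite !mulSn mul0n addn0 !addnA.
apply: leq_add; last exact: leq_trans (leq_imset_card _ _) hXY.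
apply: leq_trans (leq_card_setU _ _) _; apply: leq_add; last exact: leq_trans (leq_imset_card _ _) hXY.
apply: leq_trans (leq_card_setU _ _) _.
by apply: leq_add; apply: leq_trans (leq_imset_card _ _) hZ.
Qed.

Lemma sound_prob (N : nat) : 100%:R ^+ 2 + 100%:R ^+ 3 * (l%:R * tau) <= l%:R * eta ->
  (#|rowset| <= N)%N ->
  Ex (fun o => (~~ sound o)%:R) <= (4 * (2 ^ #|~: Pl| * #|~: Pl|))%N%:R * eta +
   (N%:R * (#|Ms|%:R * (#|Ms|%:R * (1 - (34%:R / 60%:R) ^+ 3) ^+ (#|Ms| - 2))) +
    N%:R * (N%:R * (1 - 8%:R / 60%:R) ^+ #|Ms|)).
Proof.
move=> he hN; have N0 : #|rowset|%:R <= N%:R :> R by rewrite ler_nat.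
apply: le_trans (union_bound2 mu_ge0 _ _) _; apply: lerD; first exact: joined_prob.
have c1 : 0 <= 1 - (34%:R / 60%:R) ^+ 3 :> R.
  by rewrite subr_ge0 exprn_ile1 ?divr_ge0 ?ler0n // ler_pdivrMr ?ltr0n // mul1r ler_nat.
have c2 : 0 <= 1 - 8%:R / 60%:R :> R.
  by rewrite subr_ge0 ler_pdivrMr ?ltr0n // mul1r ler_nat.
apply: le_trans (union_bound2 mu_ge0 _ _) _; apply: lerD.
  apply: le_trans (union_bound_all mu_ge0 (fun p hp => link_prob (rows hp))) _.
  by rewrite ler_wpM2r // !mulr_ge0 ?ler0n ?exprn_ge0.
apply: le_trans (union_bound_all mu_ge0 (fun p hp => union_bound_all mu_ge0
  (fun q hq => share_prob (rows hp) (rows hq)))) _.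
by apply: ler_pM; rewrite ?ler0n ?mulr_ge0 ?exprn_ge0 // ler_wpM2r ?exprn_ge0.
Qed.

Lemma sound_conn o L L' : sound o -> L \in [:: X; e |: Y] -> L' \in [:: X; e |: Y] ->
  rowconn false L false L' o.
Proof.
case/and3P => jo /forall_inP lk /forall_inP sh.
have sh' c K d K' : (c, K) \in rowset -> (d, K') \in rowset -> share c K d K' o.
  by move=> h1 h2; have /forall_inP h := sh _ h1; exact: h h2.
have lk' c K : (c, K) \in rowset -> row c K && link c K o.
  by move=> h; rewrite (rows h) (lk _ h).
have dGG c (A : {set J}) : A \subset G c -> [disjoint A & Pl] /\ [disjoint A & Ms].
  by move=> AG; split; [exact: disjointWl AG (GP c)|apply: disjointWl AG _; rewrite disjoint_sym].
have i1 T : T \subset Z -> (false, T :|: X) \in rowset.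
  by move=> TZ; rewrite !in_setU (imset_f (fun T => (false, T :|: X))) // powersetE.
have i2 T : T \subset Z -> (false, T :|: (e |: Y)) \in rowset.
  by move=> TZ; rewrite !in_setU (imset_f (fun T => (false, T :|: (e |: Y)))) ?orbT // powersetE.
have i3 T : T \subset X :|: Y -> (true, T :|: Z) \in rowset.
  by move=> TZ; rewrite !in_setU (imset_f (fun T => (true, T :|: Z))) ?orbT // powersetE.
have i4 T : T \subset X :|: Y -> (true, T :|: (e |: Z)) \in rowset.
  by move=> TZ; rewrite !in_setU (imset_f (fun T => (true, T :|: (e |: Z)))) ?orbT // powersetE.
have [dZP dZM] := dGG _ _ ZG; have [dXP dXM] := dGG _ _ XG; have [dYP dYM] := dGG _ _ YG.
have XYG : X :|: Y \subset G false by rewrite subUset XG.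
have [dXYP dXYM] := dGG _ _ XYG.
have dZX : [disjoint Z & G false] by rewrite disjoint_sym; apply: disjointWr ZG dG.
have dXYt : [disjoint X :|: Y & G true] by apply: disjointWl XYG dG.
have eZ : e \notin Z by apply: contra (eG true); apply: (subsetP ZG).
have eXY : e \notin X :|: Y by apply: contra (eG false); apply: (subsetP XYG).
have s1 : rowconn false X false (Z :|: X) o.
  apply: (@row_steps false X Z) => // [T TZ|T T' TZ TZ'|]; [exact: lk' (i1 _ TZ)| |].
    exact: sh' (i1 _ TZ) (i1 _ TZ').
  exact: disjointWr XG dZX.
have s6 : rowconn false (e |: Y) false (Z :|: (e |: Y)) o.
  apply: (@row_steps false (e |: Y) Z) => // [T TZ|T T' TZ TZ'|]; [exact: lk' (i2 _ TZ)| |].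
    exact: sh' (i2 _ TZ) (i2 _ TZ').
  rewrite disjoint_sym disjoints_subset subUset sub1set inE eZ /= -disjoints_subset disjoint_sym.
  exact: disjointWr YG dZX.
have s3 T : T \subset X :|: Y -> rowconn true Z true (T :|: Z) o.
  apply: (@row_steps true Z (X :|: Y)) => // [T' TZ|T' T'' TZ TZ'|]; [exact: lk' (i3 _ TZ)| |].
    exact: sh' (i3 _ TZ) (i3 _ TZ').
  exact: disjointWr ZG dXYt.
have iX := i1 Z (subxx _); have iXZ := i3 X (subsetUl _ _); have iYZ := i3 Y (subsetUr _ _).
have iZ := i3 set0 (sub0set _); rewrite set0U in iZ.
have ieYZ := i4 Y (subsetUr _ _); have ieY := i2 Z (subxx _).
have s2 : rowconn false (Z :|: X) true (X :|: Z) o.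
  rewrite (setUC X Z) in iXZ *; have /andP[r1 l1] := lk' _ _ iX; have /andP[r2 l2] := lk' _ _ iXZ.
  by apply: row_same => //; exact: sh'.
have s5 : rowconn true (Y :|: (e |: Z)) false (Z :|: (e |: Y)) o.
  have E : Y :|: (e |: Z) = Z :|: (e |: Y) by rewrite (setUCA Y) (setUCA Z) (setUC Y).
  rewrite E in ieYZ *; have /andP[r1 l1] := lk' _ _ ieYZ; have /andP[r2 l2] := lk' _ _ ieY.
  by apply: row_same => //; exact: sh'.
have s4 : rowconn true (Y :|: Z) true (Y :|: (e |: Z)) o.
  have E : Y :|: (e |: Z) = e |: (Y :|: Z) by rewrite setUCA.
  rewrite E in ieYZ *; have /andP[r1 l1] := lk' _ _ iYZ; have /andP[r2 l2] := lk' _ _ ieYZ.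
  apply: row_adj => //; first exact: sh'.
  rewrite in_setU negb_or eZ andbT; apply: contra eXY; apply: (subsetP (subsetUr _ _)).
(* Add [Z] to [X] in group [false]; in group [true] remove [X], add [Y], then add [e]; in group
   [false] remove [Z] again. No step moves a direction of the group that judges goodness. *)
have s16 : rowconn false X false (e |: Y) o.
  apply: (rowconn_trans (sh' _ _ _ _ iX iX) s1).
  apply: (rowconn_trans (sh' _ _ _ _ iXZ iX) s2).
  apply: (rowconn_trans (sh' _ _ _ _ iZ iX) (rowconn_sym (s3 X (subsetUl _ _)))).
  apply: (rowconn_trans (sh' _ _ _ _ iYZ iX) (s3 Y (subsetUr _ _))).
  apply: (rowconn_trans (sh' _ _ _ _ ieYZ iX) s4).
  exact: (rowconn_trans (sh' _ _ _ _ ieY iX) s5 (rowconn_sym s6)).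
have iX0 := i1 set0 (sub0set _); rewrite (set0U X) in iX0.
have iY0 := i2 set0 (sub0set _); rewrite (set0U (e |: Y)) in iY0.
have sXX : rowconn false X false X o by have /andP[r1 l1] := lk' _ _ iX0; exact: (row_self jo r1 l1).
have sYY : rowconn false (e |: Y) false (e |: Y) o.
  by have /andP[r1 l1] := lk' _ _ iY0; exact: (row_self jo r1 l1).
rewrite !inE => /orP[]/eqP -> /orP[]/eqP ->.
- exact: sXX.
- exact: s16.
- exact: (rowconn_sym s16).
- exact: sYY.
Qed.

End Structure.

Section Rows.
Variables (R : realFieldType) (J : finType) (mu : conf {set J} -> R).
Hypotheses (mu_ge0 : forall o, 0 <= mu o) (mu1 : \sum_o mu o = 1).
Variables (S D Ms Pl : {set J}) (G : bool -> {set J}) (b : nat).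
Hypotheses (D0 : (0 < #|D|)%N).
Hypotheses (MP : [disjoint Ms & Pl]) (GP : forall c, [disjoint G c & Pl]).
Hypotheses (MG : forall c, [disjoint Ms & G c]).
Hypothesis bad_le : forall c w, (#|badset mu S D (G c) w| <= b)%N.

Lemma free_row c (X0 rho : {set J}) : X0 \subset G c -> #|X0| = b.+1 -> [disjoint rho & G c] ->
  rho \subset ~: Pl -> [disjoint Ms & rho] ->
  (forall rho' : {set J}, rho' \subset Ms :|: rho -> forall r, r \in X0 ->
     r \notin badset mu S D (G c) (rho' :|: X0 :\ r)) ->
  row mu S D Ms Pl G c (rho :|: X0).
Proof.
move=> XG Xb dr rP dM free; apply/and3P; split.
- by rewrite subUset rP; apply: subset_trans XG _; rewrite -disjoints_subset.
- rewrite disjoint_sym disjoints_subset subUset -!disjoints_subset disjoint_sym dM /=.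
  by apply: disjointWl XG _; rewrite disjoint_sym.
apply/forall_inP => m mM; apply/forall_inP => m' mM'.
pose rho' := m |: (m' |: rho).
have wE : m |: (m' |: (rho :|: X0)) = rho' :|: X0 by rewrite /rho' -!setUA.
have dr' : [disjoint rho' & G c].
  by rewrite disjoints_subset !subUset !sub1set !inE -disjoints_subset !(disjointFr (MG c)).
have GwE : G c :&: (rho' :|: X0) = X0.
  rewrite setIUr (setIidPr XG); have -> : G c :&: rho' = set0; last by rewrite set0U.
  by apply/eqP; rewrite setIC setI_eq0.
rewrite wE; apply: (free_usable (b := b)) => //; first by rewrite GwE Xb.
rewrite GwE => r rX; rewrite (_ : (rho' :|: X0) :\ r = rho' :|: X0 :\ r).
  apply: free => //; rewrite /rho' !subUset !sub1set !inE mM mM' /=; exact: subsetUr.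
rewrite setDUl; congr (_ :|: _); apply/setDidPl; rewrite disjoint_sym disjoints1.
by rewrite (disjointFl dr') // (subsetP XG).
Qed.

Variables (e : J) (X Y Z : {set J}).
Hypotheses (eM : e \notin Ms) (eG : forall c, e \notin G c) (eP : e \notin Pl).
Hypotheses (XG : X \subset G false) (YG : Y \subset G false) (ZG : Z \subset G true).
Hypotheses (Xb : #|X| = b.+1) (Yb : #|Y| = b.+1) (Zb : #|Z| = b.+1).
Hypothesis dG : [disjoint G false & G true].
Hypothesis freeX : forall rho : {set J}, rho \subset ~: (G false :|: Pl) -> forall r, r \in X ->
  r \notin badset mu S D (G false) (rho :|: X :\ r).
Hypothesis freeY : forall rho : {set J}, rho \subset ~: (G false :|: Pl) -> forall r, r \in Y ->
  r \notin badset mu S D (G false) (rho :|: Y :\ r).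
Hypothesis freeZ : forall rho : {set J}, rho \subset Ms :|: (e |: (X :|: Y)) -> forall r, r \in Z ->
  r \notin badset mu S D (G true) (rho :|: Z :\ r).

Lemma rowset_row p : p \in rowset e X Y Z -> row mu S D Ms Pl G p.1 p.2.
Proof.
have XYG : X :|: Y \subset G false by rewrite subUset XG.
have sP c (A : {set J}) : A \subset G c -> A \subset ~: Pl.
  by move=> AG; rewrite -disjoints_subset; exact: disjointWl AG (GP c).
have dM c (A : {set J}) : A \subset G c -> [disjoint Ms & A].
  by move=> AG; rewrite disjoint_sym; apply: disjointWl AG _; rewrite disjoint_sym.
have eMd (A : {set J}) : [disjoint Ms & A] -> [disjoint Ms & e |: A].
  by move=> dA; rewrite disjoint_sym disjoints_subset subUset sub1set inE eM -disjoints_subset disjoint_sym.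
have ePd (A : {set J}) : A \subset ~: Pl -> e |: A \subset ~: Pl.
  by move=> dA; rewrite subUset sub1set inE eP.
have eGd c (A : {set J}) : [disjoint A & G c] -> [disjoint e |: A & G c].
  by move=> dA; rewrite disjoints_subset subUset sub1set inE eG -disjoints_subset.
have inF (A rho : {set J}) : A \subset e |: Z -> rho \subset Ms :|: A -> rho \subset ~: (G false :|: Pl).
  move=> AZ /subset_trans; apply; apply/subsetP => x; rewrite !inE => /orP[xM|/(subsetP AZ)].
    by rewrite (disjointFr (MG false) xM) (disjointFr MP xM).
  rewrite !inE => /orP[/eqP ->|/(subsetP ZG) xG]; first by rewrite negb_or eG eP.
  by rewrite (disjointFl dG xG) (disjointFr (GP true) xG).
have tF (T : {set J}) : T \subset Z -> [disjoint T & G false].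
  by move=> TZ; rewrite disjoint_sym; apply: disjointWr (subset_trans TZ ZG) dG.
have tT (T : {set J}) : T \subset X :|: Y -> [disjoint T & G true].
  by move=> TZ; apply: disjointWl (subset_trans TZ XYG) dG.
rewrite !in_setU -!orbA => /or4P[] /imsetP[T]; rewrite powersetE => TZ -> /=.
- have TG := subset_trans TZ ZG.
  apply: free_row => //; [exact: tF|exact: sP TG|exact: dM TG|].
  move=> rho hr; apply: freeX; apply: inF hr.
  by apply: subset_trans TZ _; exact: subsetUr.
- have TG := subset_trans TZ ZG; rewrite setUCA setUA.
  apply: free_row => //; [exact: eGd (tF _ TZ)|exact: ePd (sP _ _ TG)|exact: eMd (dM _ _ TG)|].
  by move=> rho hr; apply: freeY; apply: inF hr; apply: setUS.
- have TG := subset_trans TZ XYG.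
  apply: free_row => //; [exact: tT|exact: sP TG|exact: dM TG|].
  move=> rho hr; apply: freeZ; apply: subset_trans hr _; apply: setUS.
  by apply: subset_trans TZ _; exact: subsetUr.
- have TG := subset_trans TZ XYG; rewrite setUCA setUA.
  apply: free_row => //; [exact: eGd (tT _ TZ)|exact: ePd (sP _ _ TG)|exact: eMd (dM _ _ TG)|].
  by move=> rho hr; apply: freeZ; apply: subset_trans hr _; apply: setUS; exact: setUS.
Qed.

End Rows.

Lemma card_bigcup_le (I T : finType) (Q : pred I) (F : I -> {set T}) b :
  (forall i, Q i -> (#|F i| <= b)%N) -> (#|\bigcup_(i | Q i) F i| <= #|Q| * b)%N.
Proof.
move=> h; rewrite -sum_nat_const; elim/big_ind2: _ => [|m A n B hA hB|i Qi]; last exact: h.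
  by rewrite cards0.
by apply: leq_trans (leq_card_setU _ _) _; apply: leq_add.
Qed.

(** The union of the bad sets over all indices and all [rho] is again a bad set of bounded size, so
    [free_set] applies to it. *)
Lemma free_family (I J : finType) (B : I -> {set J} -> {set J}) b K (G U : {set J}) :
  (0 < K)%N -> (forall i w, (#|B i w| <= b)%N) -> (K * (#|I| * (2 ^ #|U| * b)) + K <= #|G|)%N ->
  exists X : {set J}, [/\ X \subset G, #|X| = K &
    forall i (rho : {set J}), rho \subset U -> forall r, r \in X -> r \notin B i (rho :|: X :\ r)].
Proof.
move=> K0 hB hG.
pose C Y := \bigcup_(i : I | true) \bigcup_(rho in powerset U) B i (rho :|: Y).
have hC Y : (#|C Y| <= #|I| * (2 ^ #|U| * b))%N.
  apply: card_bigcup_le => i _; rewrite -card_powerset.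
  by apply: card_bigcup_le => rho _; exact: hB.
have [X [XG XK fX]] := free_set K0 hC hG; exists X; split=> // i rho rU r rX.
apply: contra (fX r rX) => h; apply/bigcupP; exists i => //.
by apply/bigcupP; exists rho; rewrite ?powersetE.
Qed.

Local Close Scope ring_scope.

Lemma layout M N1 N2 Np : exists (Ms Pl : {set option 'I_(M + N1 + N2 + Np)}) (G : bool -> {set option 'I_(M + N1 + N2 + Np)}),
  [/\ [/\ None \notin Ms, None \notin Pl & forall c, None \notin G c],
      [/\ [disjoint Ms & Pl], forall c, [disjoint G c & Pl], forall c, [disjoint Ms & G c] &
          [disjoint G false & G true]],
      [/\ #|Ms| = M, #|G false| = N1, #|G true| = N2 & #|Pl| = Np],
      #|~: Pl| = (1 + M + N1 + N2)%N & #|~: (G false :|: Pl)| = (1 + M + N2)%N].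
Proof.
pose h := (M + N1 + N2 + Np)%N; pose A := [set~ None] : {set option 'I_h}.
have cA : #|A| = h by rewrite cardsC1 card_option card_ord.
have [Ms MA cM] : exists2 D : {set option 'I_h}, D \subset A & #|D| = M.
  by apply: exists_subset_card; rewrite cA /h; lia.
have cAM : #|A :\: Ms| = (N1 + N2 + Np)%N by rewrite cardsD (setIidPr MA) cA cM /h; lia.
have [G1 GA cG1] : exists2 D : {set option 'I_h}, D \subset A :\: Ms & #|D| = N1.
  by apply: exists_subset_card; rewrite cAM; lia.
have cAG : #|A :\: Ms :\: G1| = (N2 + Np)%N by rewrite cardsD (setIidPr GA) cAM cG1; lia.
have [G2 GA2 cG2] : exists2 D : {set option 'I_h}, D \subset A :\: Ms :\: G1 & #|D| = N2.
  by apply: exists_subset_card; rewrite cAG; lia.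
pose Pl := A :\: Ms :\: G1 :\: G2.
have cP : #|Pl| = Np by rewrite /Pl cardsD (setIidPr GA2) cAG cG2; lia.
have inG1 x : x \in G1 -> (x \in A) && (x \notin Ms) by move/(subsetP GA); rewrite !inE andbC.
have inG2 x : x \in G2 -> [&& x \in A, x \notin Ms & x \notin G1].
  by move/(subsetP GA2); rewrite !inE => /and3P[-> -> ->].
have inPl x : x \in Pl -> [&& x \in A, x \notin Ms, x \notin G1 & x \notin G2].
  by rewrite !inE => /and4P[-> -> -> ->].
have NA : None \notin A by rewrite !inE.
have nN (B : {set option 'I_h}) : (forall x, x \in B -> x \in A) -> None \notin B.
  by move=> BA; apply: contra NA; exact: BA.
have dis (B C : {set option 'I_h}) : (forall x, x \in C -> x \notin B) -> [disjoint B & C].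
  by move=> h1; rewrite disjoint_sym disjoints_subset; apply/subsetP => x /h1; rewrite inE.
exists Ms, Pl, (fun c => if c then G2 else G1); split.
- split; first by apply: nN => x; exact: (subsetP MA).
    by apply: nN => x /inPl /andP[].
  by case; apply: nN => x; [case/inG2/andP|case/inG1/andP].
- split; first by apply: dis => x /inPl /and4P[].
  + by case; apply: dis => x /inPl /and4P[].
  + by case; apply: dis => x; [case/inG2/and3P|case/inG1/andP].
  + by apply: dis => x /inG2 /and3P[].
- by [].
- have := cardsC Pl; rewrite cP card_option card_ord /h; lia.
have d12 : [disjoint G1 & Pl] by apply: dis => x /inPl /and4P[].
have := cardsC (G1 :|: Pl); rewrite cardsU (disjoint_setI0 d12) cards0 subn0 cG1 cP card_option card_ord /h.
lia.
Qed.

(** * Renormalization on the quadrant *)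

Section Renormalization.
Variables (bd : nat -> nat -> nat -> Prop) (conn : nat * nat -> nat * nat -> Prop).

Definition spaced a b := (a + 3 <= b) || (b + 3 <= a).

Hypothesis bdS : forall n i j, bd n.+1 i j <-> exists a b c d, [/\ a < 7, b < 7, c < 7 & d < 7] /\
  [/\ spaced a c || spaced b d, bd n (i * 7 + a) (j * 7 + b) & bd n (i * 7 + c) (j * 7 + d)].
Hypothesis conn_sym : forall x y, conn x y -> conn y x.
Hypothesis conn_tr : forall x y z, conn x y -> conn y z -> conn x z.
Hypothesis conn_refl : forall x, conn x x.
Hypothesis conn_h : forall i j, ~ bd 0 i j -> ~ bd 0 i.+1 j -> conn (i, j) (i.+1, j).
Hypothesis conn_v : forall i j, ~ bd 0 i j -> ~ bd 0 i j.+1 -> conn (i, j) (i, j.+1).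

Definition clean_row n i j b := forall a, a < 7 -> ~ bd n (i * 7 + a) (j * 7 + b).
Definition clean_col n i j a := forall b, b < 7 -> ~ bd n (i * 7 + a) (j * 7 + b).

(** A bad sub-box in each of two spaced rows would be a pair of spaced bad sub-boxes. *)
Lemma dirty_rows n i j b d : ~ bd n.+1 i j -> b < 7 -> d < 7 -> spaced b d ->
  clean_row n i j b \/ clean_row n i j d.
Proof.
move=> nb b7 d7 sep; apply: NNPP => /not_or_and[/not_all_ex_not[a ha] /not_all_ex_not[c hc]].
apply: nb; apply/bdS; exists a, b, c, d.
have [a7 ba] := imply_to_and _ _ ha; have [c7 bc] := imply_to_and _ _ hc.
by split=> //; split; [rewrite sep orbT|exact: NNPP|exact: NNPP].
Qed.

Lemma dirty_cols n i j a c : ~ bd n.+1 i j -> a < 7 -> c < 7 -> spaced a c ->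
  clean_col n i j a \/ clean_col n i j c.
Proof.
move=> nb a7 c7 sep; apply: NNPP => /not_or_and[/not_all_ex_not[b hb] /not_all_ex_not[d hd]].
apply: nb; apply/bdS; exists a, b, c, d.
have [b7 bb] := imply_to_and _ _ hb; have [d7 bd'] := imply_to_and _ _ hd.
by split=> //; split; [rewrite sep|exact: NNPP|exact: NNPP].
Qed.

(* Among the three lines 0, 3, 6 each box has at most one dirty line. *)
Lemma common_clean (p q : nat -> Prop) :
  (forall b d, b < 7 -> d < 7 -> spaced b d -> p b \/ p d) ->
  (forall b d, b < 7 -> d < 7 -> spaced b d -> q b \/ q d) ->
  exists b, [/\ b < 7, p b & q b].
Proof.
move=> hp hq; have p03 := hp 0 3 isT isT isT; have p06 := hp 0 6 isT isT isT.
have p36 := hp 3 6 isT isT isT; have q03 := hq 0 3 isT isT isT.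
have q06 := hq 0 6 isT isT isT; have q36 := hq 3 6 isT isT isT.
have [p0|np0] := classic (p 0).
  have [q0|nq0] := classic (q 0); first by exists 0.
  have q3 : q 3 by case: q03.
  have q6 : q 6 by case: q06.
  by case: p36 => ?; [exists 3|exists 6].
have p3 : p 3 by case: p03.
have p6 : p 6 by case: p06.
by case: q36 => ?; [exists 3|exists 6].
Qed.

(** A representative is found by descending, at every level, to the sub-box where a clean column
    crosses a clean row; such a sub-box is never bad. *)
Fixpoint repr n i j x : Prop :=
  if n is n'.+1 then exists a b, [/\ a < 7, b < 7, clean_col n' i j a & clean_row n' i j b] /\
    repr n' (i * 7 + a) (j * 7 + b) x
  else x = (i, j).

Lemma repr_exists n i j : ~ bd n i j -> exists x, repr n i j x.
Proof.
elim: n i j => [|n IHn] i j nb; first by exists (i, j).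
have [a [a7 ca _]] := common_clean (fun b d => @dirty_cols n i j b d nb) (fun b d => @dirty_cols n i j b d nb).
have [b [b7 cb _]] := common_clean (fun b d => @dirty_rows n i j b d nb) (fun b d => @dirty_rows n i j b d nb).
by have [x rx] := IHn _ _ (ca b b7); exists x, a, b.
Qed.

Definition linked n i j i' j' := forall x y, repr n i j x -> repr n i' j' y -> conn x y.

Section Level.
Variable n : nat.
Hypotheses (self : forall i j, ~ bd n i j -> linked n i j i j)
  (right : forall i j, ~ bd n i j -> ~ bd n i.+1 j -> linked n i j i.+1 j)
  (up : forall i j, ~ bd n i j -> ~ bd n i j.+1 -> linked n i j i j.+1).

Lemma row_chain i j m : (forall k, k <= m -> ~ bd n (i + k) j) -> linked n i j (i + m) j.
Proof.
elim: m => [|m IHm] h; first by rewrite addn0; apply: self; have := h 0; rewrite addn0; apply.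
move=> x y rx ry; have nm := h m (leqnSn m); have [z rz] := repr_exists nm.
apply: (@conn_tr _ z); first by apply: IHm rx rz => k km; apply: h; apply: leqW.
by rewrite addnS in ry; apply: (right nm _ rz ry); rewrite -addnS; apply: h.
Qed.

Lemma col_chain i j m : (forall k, k <= m -> ~ bd n i (j + k)) -> linked n i j i (j + m).
Proof.
elim: m => [|m IHm] h; first by rewrite addn0; apply: self; have := h 0; rewrite addn0; apply.
move=> x y rx ry; have nm := h m (leqnSn m); have [z rz] := repr_exists nm.
apply: (@conn_tr _ z); first by apply: IHm rx rz => k km; apply: h; apply: leqW.
by rewrite addnS in ry; apply: (up nm _ rz ry); rewrite -addnS; apply: h.
Qed.

Lemma row_line i j a a' b : a < 7 -> a' < 7 -> clean_row n i j b ->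
  linked n (i * 7 + a) (j * 7 + b) (i * 7 + a') (j * 7 + b).
Proof.
wlog aa : a a' / a <= a'.
  move=> h a7 a7' cr; have [|/ltnW] := leqP a a'; first by move/h; apply.
  by move=> /h hh x y rx ry; apply: conn_sym; apply: hh ry rx.
move=> a7 a7' cr; rewrite -(subnKC aa) addnA; apply: row_chain => k kl.
by rewrite -addnA; apply: cr; lia.
Qed.

Lemma col_line i j a b b' : b < 7 -> b' < 7 -> clean_col n i j a ->
  linked n (i * 7 + a) (j * 7 + b) (i * 7 + a) (j * 7 + b').
Proof.
wlog bb : b b' / b <= b'.
  move=> h b7 b7' cr; have [|/ltnW] := leqP b b'; first by move/h; apply.
  by move=> /h hh x y rx ry; apply: conn_sym; apply: hh ry rx.
move=> b7 b7' cr; rewrite -(subnKC bb) addnA; apply: col_chain => k kl.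
by rewrite -addnA; apply: cr; lia.
Qed.

Lemma self_next i j : ~ bd n.+1 i j -> linked n.+1 i j i j.
Proof.
move=> nb x y [a [b [[a7 b7 ca cb] rx]]] [a' [b' [[a7' b7' ca' cb'] ry]]].
have [z rz] := repr_exists (cb a' a7').
exact: conn_tr (row_line a7 a7' cb rx rz) (col_line b7 b7' ca' rz ry).
Qed.

(** The two boxes have a clean row at the same height, and the passage from one to the other follows
    it. *)
Lemma right_next i j : ~ bd n.+1 i j -> ~ bd n.+1 i.+1 j -> linked n.+1 i j i.+1 j.
Proof.
move=> nb nb' x y [a [b [[a7 b7 ca cb] rx]]] [a' [b' [[a7' b7' ca' cb'] ry]]].
have [c [c7 cc cc']] := common_clean (fun b d => @dirty_rows n i j b d nb)
  (fun b d => @dirty_rows n i.+1 j b d nb').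
have [z rz] := repr_exists (ca c c7); have [z' rz'] := repr_exists (ca' c c7).
apply: conn_tr (col_line b7 c7 ca rx rz) (conn_tr _ (col_line c7 b7' ca' rz' ry)).
have E : i.+1 * 7 + a' = i * 7 + a + (7 + a' - a) by lia.
rewrite E in rz'; apply: row_chain rz rz' => k kl; rewrite -addnA.
have [k7|k7] := ltnP (a + k) 7; first exact: cc.
have -> : i * 7 + (a + k) = i.+1 * 7 + (a + k - 7) by lia.
by apply: cc'; lia.
Qed.

Lemma up_next i j : ~ bd n.+1 i j -> ~ bd n.+1 i j.+1 -> linked n.+1 i j i j.+1.
Proof.
move=> nb nb' x y [a [b [[a7 b7 ca cb] rx]]] [a' [b' [[a7' b7' ca' cb'] ry]]].
have [c [c7 cc cc']] := common_clean (fun b d => @dirty_cols n i j b d nb)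
  (fun b d => @dirty_cols n i j.+1 b d nb').
have [z rz] := repr_exists (cb c c7); have [z' rz'] := repr_exists (cb' c c7).
apply: conn_tr (row_line a7 c7 cb rx rz) (conn_tr _ (row_line c7 a7' cb' rz' ry)).
have E : j.+1 * 7 + b' = j * 7 + b + (7 + b' - b) by lia.
rewrite E in rz'; apply: col_chain rz rz' => k kl; rewrite -addnA.
have [k7|k7] := ltnP (b + k) 7; first exact: cc.
have -> : j * 7 + (b + k) = j.+1 * 7 + (b + k - 7) by lia.
by apply: cc'; lia.
Qed.

End Level.

Lemma linked_neighbours n : [/\ forall i j, ~ bd n i j -> linked n i j i j,
  forall i j, ~ bd n i j -> ~ bd n i.+1 j -> linked n i j i.+1 j &
  forall i j, ~ bd n i j -> ~ bd n i j.+1 -> linked n i j i j.+1].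
Proof.
elim: n => [|n [s r u]].
  by split=> i j nb => [x y -> ->|nb' x y -> ->|nb' x y -> ->]; [|exact: conn_h|exact: conn_v].
by split=> i j; [apply: self_next|apply: right_next|apply: up_next].
Qed.

Lemma repr_fst n i j x : repr n i j x -> i * 7 ^ n <= x.1.
Proof.
elim: n i j => [|n IHn] i j /=; first by move=> ->; rewrite muln1.
case=> a [b [_ /IHn]]; apply: leq_trans; rewrite expnS mulnA leq_pmul2r ?expn_gt0 //; lia.
Qed.

(** The boxes [(u, 0)] with [u < 7] form the bottom row of the box [(0, 0)] one level up, so
    representatives of consecutive levels are joined inside it. At level [N] a representative of
    [(1, 0)] is at least [7 ^ N] away. *)
Lemma escape : (forall n u, u < 7 -> ~ bd n u 0) -> forall N, exists x, N <= x.1 /\ conn (0, 0) x.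
Proof.
move=> h; have all n u x : u < 7 -> repr n u 0 x -> conn (0, 0) x.
  elim: n u x => [|n IHn] u x u7 rx.
    have [s r v] := linked_neighbours 0.
    by apply: (row_chain s r (i := 0) (m := u)) rx => // k ku; rewrite add0n; apply: h; lia.
  have [s r v] := linked_neighbours n; have [s' r' v'] := linked_neighbours n.+1.
  have [z rz] := repr_exists (h n.+1 0 isT).
  apply: (@conn_tr _ z); last first.
    by apply: (row_chain s' r' (i := 0) (m := u)) rz rx => k ku; rewrite add0n; apply: h; lia.
  case: rz => a [b [[a7 b7 ca cb] rz]]; rewrite !mul0n !add0n in rz.
  have [t rt] := repr_exists (h n a a7).
  apply: conn_tr (IHn a t a7 rt) _.
  by apply: (col_line s v (i := 0) (j := 0) (isT : 0 < 7) b7 ca); rewrite ?mul0n ?add0n.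
move=> N; have [x rx] := repr_exists (h N 1 isT); exists x; split; last exact: all rx.
by apply: leq_trans (repr_fst rx); rewrite mul1n ltnW // ltn_expl.
Qed.

End Renormalization.

From mathcomp Require Import all_classical all_reals all_analysis.
Import numFieldNormedType.Exports.
Local Open Scope classical_set_scope.
Local Open Scope ring_scope.

(** * Choice of the constants *)

Section Constants.
Variable R : realType.
Notation c1 := (1 - (34%:R / 60%:R) ^+ 3 : R).
Notation c2 := (1 - 8%:R / 60%:R : R).

Lemma ratio_ge0 : 0 <= c2. Proof. by lra. Qed.
(** Bernoulli's inequality: [1 + 2 / 13] is the inverse of the ratio [52 / 60]. *)
Lemma bernoulli_ratio k : (1 + k%:R * (2 / 13%:R)) * c2 ^+ k <= 1.
Proof.
elim: k => [|k IHk]; first by rewrite mul0r addr0 mul1r.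
rewrite exprS [leLHS]mulrA; apply: (le_trans _ IHk); rewrite ler_wpM2r ?exprn_ge0 ?ratio_ge0 //.
by rewrite -natr1; have := ler0n R k; move: (k%:R : R) => x; lra.
Qed.

Lemma linear_decay k : k%:R * c2 ^+ k <= 13%:R / 2.
Proof.
have := bernoulli_ratio k; have : 0 <= c2 ^+ k by rewrite exprn_ge0 // ratio_ge0.
by move: (c2 ^+ k) (k%:R) => y x y0 h; lra.
Qed.

Definition decay_cst : R := 9%:R * (13%:R / 2) ^+ 3.

(** The exponent [3 k] splits into three powers, each absorbing one factor [k]. *)
Lemma quadratic_decay k : k%:R * ((3 * k)%N%:R * ((3 * k)%N%:R * c2 ^+ (3 * k))) <= decay_cst.
Proof.
have h := linear_decay k; rewrite natrM mulnC exprM !exprS expr0 /decay_cst.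
have y0 : 0 <= c2 ^+ k by rewrite exprn_ge0 // ratio_ge0.
have k0 : 0 <= k%:R :> R by rewrite ler0n.
move: (c2 ^+ k) y0 h => y y0 h.
have -> : k%:R * (3%:R * k%:R * (3%:R * k%:R * (y * (y * (y * 1))))) = 9%:R * (k%:R * y) ^+ 3 by ring.
by rewrite ler_pM2l ?ltr0n //; apply: lerXn2r; rewrite ?nnegrE ?mulr_ge0 // divr_ge0.
Qed.

Lemma total_decay (s t y x del : R) : s <= x * (2 * y) -> t <= x * x * y ->
  (2 * x + x * x + 1) * y <= del -> 0 <= y -> s + t <= del.
Proof. by move=> *; lra. Qed.

Lemma total_decay1 (y x del : R) : (2 * x + x * x + 1) * y <= del -> 0 <= x * y -> 0 <= x * x * y ->
  y <= del.
Proof. by move=> *; lra. Qed.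

Lemma positions (N : nat) (del : R) : 0 < del -> exists M : nat, [/\ (2 <= M)%N,
  N%:R * (M%:R * (M%:R * c1 ^+ (M - 2))) + N%:R * (N%:R * c2 ^+ M) <= del & c2 ^+ M <= del].
Proof.
move=> d0; have C0 : 0 <= decay_cst by rewrite mulr_ge0 ?exprn_ge0 ?divr_ge0 ?ler0n.
pose x := (2 * N%:R + N%:R * N%:R + 1) * decay_cst / del.
have x0 : 0 <= x by rewrite divr_ge0 ?(ltW d0) // mulr_ge0 // !addr_ge0 ?mulr_ge0 ?ler0n.
pose k := (Num.bound x).+1; exists (3 * k)%N.
have kx : x <= k%:R by apply: le_trans (ltW (archi_boundP x0)) _; rewrite ler_nat.
set M := (3 * k)%N; have M2 : (2 <= M)%N by rewrite /M /k mulnS.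
have M1 : 1 <= M%:R :> R by rewrite ler1n ltnW.
have k0 : 0 < k%:R :> R by rewrite ltr0n.
have q := quadratic_decay k; rewrite -/M in q.
set Q := M%:R * (M%:R * c2 ^+ M) in q.
have c20 : 0 <= c2 ^+ M by rewrite exprn_ge0 // ratio_ge0.
have cQ : c2 ^+ M <= Q.
  by rewrite /Q mulrA ler_peMl //; apply: (le_trans M1); rewrite ler_peMl // ler0n.
have Q0 : 0 <= Q := le_trans c20 cQ.
have tot : (2 * N%:R + N%:R * N%:R + 1) * Q <= del.
  rewrite -(ler_pM2l k0); apply: (@le_trans _ _ ((2 * N%:R + N%:R * N%:R + 1) * decay_cst)).
    by rewrite mulrCA ler_wpM2l // !addr_ge0 ?mulr_ge0 ?ler0n.
  by move: kx; rewrite /x ler_pdivrMr.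
have NQ : 0 <= N%:R * Q by apply: mulr_ge0; rewrite ?ler0n.
have NNQ : 0 <= N%:R * N%:R * Q by apply: mulr_ge0; rewrite // mulr_ge0 ?ler0n.
have h1 : M%:R * (M%:R * c1 ^+ (M - 2)) <= 2 * Q.
  have e : c2 ^+ M = c2 ^+ (M - 2) * c2 ^+ 2 by rewrite -exprD subnK.
  have c12 : c1 ^+ (M - 2) <= c2 ^+ (M - 2).
    by apply: lerXn2r; rewrite ?nnegrE ?ratio_ge0 // ?exprS ?expr0; lra.
  have : c2 ^+ (M - 2) <= 2 * c2 ^+ M.
    rewrite e; have : 0 <= c2 ^+ (M - 2) by rewrite exprn_ge0 // ratio_ge0.
    by move: (c2 ^+ (M - 2)) => y y0; rewrite expr2; lra.
  move=> c22; rewrite /Q !mulrA -!(mulrA 2) !mulrA.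
  have := ler_wpM2l (mulr_ge0 (le_trans ler01 M1) (le_trans ler01 M1)) (le_trans c12 c22).
  by rewrite !mulrA [M%:R * M%:R * 2]mulrC !mulrA.
split=> //.
  have h2 : N%:R * (M%:R * (M%:R * c1 ^+ (M - 2))) <= N%:R * (2 * Q) by rewrite ler_wpM2l ?ler0n.
  have h3 : N%:R * (N%:R * c2 ^+ M) <= N%:R * N%:R * Q.
    by rewrite mulrA ler_wpM2l // mulr_ge0 ?ler0n.
  exact: total_decay h2 h3 tot Q0.
exact: le_trans cQ (total_decay1 tot NQ NNQ).
Qed.

(** [eta] is chosen first; then [tau] makes [100 ^ 3 * l * tau] one half of [l * eta] for every [l];
    then [l] makes [100 ^ 2] at most the other half, and [k] exceeds the bound for the pool. *)
Lemma scales (m : nat) (del : R) : 0 < del -> exists tau eta : R, exists l k : nat,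
  [/\ 0 < tau, (0 < l)%N, (4 * (2 ^ m * m))%N%:R * eta <= del,
     100%:R ^+ 2 + 100%:R ^+ 3 * (l%:R * tau) <= l%:R * eta &
     4%:R ^+ m < k%:R * tau ^+ 2].
Proof.
move=> d0; pose A := (4 * (2 ^ m * m))%N%:R + 1 : R.
have A0 : 0 < A by rewrite ltr_wpDl ?ler0n.
pose eta := del / A; have e0 : 0 < eta by rewrite divr_gt0.
pose c : R := 100%:R; have c0 : 0 < c by rewrite ltr0n.
pose tau := eta / (2 * c ^+ 3); have t0 : 0 < tau by rewrite divr_gt0 // mulr_gt0 // exprn_gt0.
have x0 : 0 <= 2 * c ^+ 2 / eta by rewrite divr_ge0 ?(ltW e0) // mulr_ge0 // exprn_ge0 // ltW.
have z0 : 0 <= 4%:R ^+ m / tau ^+ 2 by rewrite divr_ge0 ?exprn_ge0 ?ler0n // ltW.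
exists tau, eta, (Num.bound (2 * c ^+ 2 / eta)).+1, (Num.bound (4%:R ^+ m / tau ^+ 2)); split=> //.
- by rewrite /eta mulrCA ler_piMr ?(ltW d0) // ler_pdivrMr // mul1r lerDl.
- have : 2 * c ^+ 2 / eta <= (Num.bound (2 * c ^+ 2 / eta)).+1%:R.
    by apply: le_trans (ltW (archi_boundP x0)) _; rewrite ler_nat.
  set L := (Num.bound _).+1; rewrite ler_pdivrMr //; clearbody L; move: (L%:R) => l hl.
  have -> : 100%:R ^+ 3 * (l * tau) = l * eta / 2.
    rewrite /tau -/c invfM; have := mulfV (lt0r_neq0 (exprn_gt0 3 c0)); move: (c ^+ 3) => C hC.
    by rewrite -[RHS]mulr1 -hC; ring.
  by rewrite -/c; move: (c ^+ 2) (l * eta) hl => u v *; lra.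
- by rewrite -ltr_pdivrMr ?exprn_gt0 //; exact: archi_boundP.
Qed.

End Constants.

(** * Multiscale percolation *)

Lemma bigsetU_mem (T : Type) (I : finType) (Q : pred I) (F : I -> set T) o :
  (\big[setU/set0]_(i | Q i) F i) o <-> exists2 i, Q i & F i o.
Proof.
split=> [|[i Qi Fi]]; last by rewrite (bigD1 i) //=; left.
by elim/big_ind: _ => [//|A B hA hB [/hA|/hB]|i Qi Fi] //; exists i.
Qed.

Section RealProbability.
Context d (T : measurableType d) (R : realType) (P : probability T R).
Implicit Types (A B : set T).

Definition pr A : R := fine (P A).

Lemma prE A : measurable A -> P A = (pr A)%:E.
Proof. by move=> mA; rewrite fineK // fin_num_measure. Qed.

Lemma pr_ge0 A : 0 <= pr A.
Proof. by rewrite /pr fine_ge0 // measure_ge0. Qed.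

Lemma pr_le A B : measurable A -> measurable B -> A `<=` B -> pr A <= pr B.
Proof. by move=> mA mB AB; rewrite -lee_fin -!prE // le_measure // inE. Qed.

Lemma pr_setU A B : measurable A -> measurable B -> pr (A `|` B) <= pr A + pr B.
Proof.
by move=> mA mB; rewrite -lee_fin EFinD -!prE //; [exact: measureU2|exact: measurableU].
Qed.

Lemma pr_disjU A B : measurable A -> measurable B -> A `&` B = set0 -> pr (A `|` B) = pr A + pr B.
Proof.
move=> mA mB AB; apply: EFin_inj; rewrite EFinD -!prE //; last exact: measurableU.
exact: measureU.
Qed.

Lemma pr_setT : pr [set: T] = 1.
Proof. by rewrite /pr probability_setT. Qed.

Lemma pr_set0 : pr set0 = 0.
Proof. by rewrite /pr measure0. Qed.

Lemma pr_setC A : measurable A -> pr (~` A) = 1 - pr A.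
Proof.
move=> mA; apply: EFin_inj; rewrite EFinB -!prE //; last exact: measurableC.
exact: probability_setC.
Qed.

Lemma measurable_bigU (I : Type) (s : seq I) (Q : pred I) (F : I -> set T) :
  (forall i, Q i -> measurable (F i)) -> measurable (\big[setU/set0]_(i <- s | Q i) F i).
Proof.
move=> mF; elim/big_ind: _ => [|A B mA mB|i Qi]; [exact: measurable0|exact: measurableU|exact: mF].
Qed.

Lemma pr_bigU (I : Type) (s : seq I) (Q : pred I) (F : I -> set T) :
  (forall i, Q i -> measurable (F i)) ->
  pr (\big[setU/set0]_(i <- s | Q i) F i) <= \sum_(i <- s | Q i) pr (F i).
Proof.
move=> mF; elim: s => [|i s IHs]; first by rewrite !big_nil pr_set0.
rewrite !big_cons; case: ifP => // Qi.
apply: le_trans (pr_setU (mF i Qi) (measurable_bigU s mF)) _.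
by rewrite lerD2l.
Qed.

Lemma pr_bigcup_le (F : (set T)^nat) (c : R) : (forall n, measurable (F n)) ->
  (forall N, \sum_(n < N) pr (F n) <= c) -> pr (\bigcup_n F n) <= c.
Proof.
move=> mF hc; have mU : measurable (\bigcup_n F n) by exact: bigcup_measurable.
rewrite -lee_fin -prE //.
apply: le_trans (measure_sigma_subadditive P mF mU (@subset_refl _ _)) _.
apply: lime_le; first by apply: is_cvg_nneseries => n _ _; exact: measure_ge0.
near=> N; rewrite big_mkord (eq_bigr (fun n : 'I_N => (pr (F n))%:E)) => [|n _]; last exact: prE.
by rewrite sumEFin lee_fin hc.
Unshelve. all: by end_near. Qed.

End RealProbability.

Section Renormalization.
Context d (T : measurableType d) (R : realType) (P : probability T R).
Notation pr := (pr P).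
Variables (g : nat -> nat -> set T) (dep : set (nat * nat) -> set (set T)).

Definition far (A B : set (nat * nat)) := forall x y, A x -> B y ->
  (x.1 + 3 <= y.1)%N \/ (y.1 + 3 <= x.1)%N \/ (x.2 + 3 <= y.2)%N \/ (y.2 + 3 <= x.2)%N.

Hypothesis dep_meas : forall A E, dep A E -> measurable E.
Hypothesis depC : forall A E, dep A E -> dep A (~` E).
Hypothesis depU : forall A E F, dep A E -> dep A F -> dep A (E `|` F).
Hypothesis dep0 : forall A, dep A set0.
Hypothesis depS : forall A B E, A `<=` B -> dep A E -> dep B E.
Hypothesis dep_g : forall i j, dep [set (i, j)] (g i j).
Hypothesis dep_far : forall A B E F, far A B -> dep A E -> dep B F -> pr (E `&` F) = pr E * pr F.

Let quad := (('I_7 * 'I_7) * ('I_7 * 'I_7))%type.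
Let sep (p : quad) := spaced p.1.1 p.2.1 || spaced p.1.2 p.2.2.

Fixpoint bad n i j : set T :=
  if n is n'.+1 then \big[setU/set0]_(p : quad | sep p)
    (bad n' (i * 7 + p.1.1) (j * 7 + p.1.2) `&` bad n' (i * 7 + p.2.1) (j * 7 + p.2.2))
  else ~` g i j.

Definition box n i j : set (nat * nat) := [set x | (i * 7 ^ n <= x.1 < i.+1 * 7 ^ n)%N /\
  (j * 7 ^ n <= x.2 < j.+1 * 7 ^ n)%N].

Lemma depI A E F : dep A E -> dep A F -> dep A (E `&` F).
Proof. by move=> hE hF; rewrite -[E `&` F]setCK setCI; apply: depC; apply: depU; exact: depC. Qed.

Lemma sub_box n i j (a b : 'I_7) : box n (i * 7 + a) (j * 7 + b) `<=` box n.+1 i j.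
Proof.
have aux k (c : 'I_7) y : ((k * 7 + c) * 7 ^ n <= y < (k * 7 + c).+1 * 7 ^ n)%N ->
    (k * 7 ^ n.+1 <= y < k.+1 * 7 ^ n.+1)%N.
  case/andP=> h1 h2; rewrite expnS; apply/andP; split.
    by apply: leq_trans h1; rewrite mulnA leq_mul2r leq_addr orbT.
  apply: leq_trans h2 _; rewrite mulnA leq_mul2r; apply/orP; right.
  by rewrite mulSn -addnS addnC leq_add2r.
by move=> x [h1 h2]; split; [exact: aux h1|exact: aux h2].
Qed.

Lemma dep_bad n i j : dep (box n i j) (bad n i j).
Proof.
elim: n i j => [|n IHn] i j /=.
  apply: depC; apply: depS (dep_g i j) => x ->; rewrite /box /= expn0 !muln1.
  by rewrite !leqnn.
elim/big_ind: _ => [|E F|p _]; [exact: dep0|exact: depU|].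
by apply: depI; apply: depS (IHn _ _); exact: sub_box.
Qed.

Lemma far_boxes n i j i' j' : spaced i i' || spaced j j' -> far (box n i j) (box n i' j').
Proof.
have aux k k' (x y : nat) : (k + 3 <= k')%N -> (k * 7 ^ n <= x < k.+1 * 7 ^ n)%N ->
    (k' * 7 ^ n <= y < k'.+1 * 7 ^ n)%N -> (x + 3 <= y)%N.
  move=> kk /andP[_ x2] /andP[y1 _]; apply: leq_trans y1.
  have : ((k + 3) * 7 ^ n <= k' * 7 ^ n)%N by rewrite leq_mul2r kk orbT.
  apply: leq_trans; rewrite mulnDl; have : (0 < 7 ^ n)%N by rewrite expn_gt0.
  by move: x2; rewrite mulSn; move: (7 ^ n)%N (k * 7 ^ n)%N => s t; lia.
move=> sep' x y [x1 x2] [y1 y2].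
case/orP: sep' => /orP[] h.
- by left; exact: aux h x1 y1.
- by right; left; exact: aux h y1 x1.
- by right; right; left; exact: aux h x2 y2.
- by right; right; right; exact: aux h y2 x2.
Qed.

Variable e0 : R.
Hypotheses (e0_ge0 : 0 <= e0) (e0_le : 7%:R ^+ 4 * e0 <= 1 / 2).
Hypothesis pr_g : forall i j, pr (~` g i j) <= e0.

(** A bad box contains one of at most [7 ^ 4] pairs of spaced bad sub-boxes, which are independent.
    So the probability is squared up to [7 ^ 4], and [7 ^ 4 * e0 <= 1 / 2] turns this into a halving
    at each level. *)
Lemma pr_bad n i j : pr (bad n i j) <= e0 * (1 / 2) ^+ n.
Proof.
elim: n i j => [|n IHn] i j; first by rewrite expr0 mulr1; exact: pr_g.
have mb k a b : measurable (bad k a b) := dep_meas (dep_bad k a b).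
apply: le_trans (pr_bigU P _ (fun p _ => measurableI _ _ (mb _ _ _) (mb _ _ _))) _.
apply: (@le_trans _ _ (\sum_(p : quad | sep p) (e0 * (1 / 2) ^+ n) ^+ 2)).
  apply: ler_sum => p sp.
  have sp' : spaced (i * 7 + p.1.1) (i * 7 + p.2.1) || spaced (j * 7 + p.1.2) (j * 7 + p.2.2).
    by move: sp; rewrite /sep /spaced -!addnA !leq_add2l.
  rewrite (dep_far (far_boxes (n := n) sp') (dep_bad _ _ _) (dep_bad _ _ _)).
  by rewrite expr2; apply: ler_pM; rewrite ?pr_ge0.
apply: (@le_trans _ _ (7%:R ^+ 4 * (e0 * (1 / 2) ^+ n) ^+ 2)).
  rewrite sumr_const -[leLHS]mulr_natl ler_wpM2r ?sqr_ge0 // -natrX ler_nat.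
  apply: leq_trans (max_card _) _; rewrite !card_prod !card_ord; by [].
set h := (1 / 2) ^+ n.
have h0 : 0 <= h by rewrite exprn_ge0.
have h1 : h <= 1 by rewrite exprn_ile1 //; lra.
rewrite (exprSr (1 / 2) n) -/h; clearbody h.
apply: (@le_trans _ _ (7%:R ^+ 4 * e0 * (e0 * h ^+ 2))); first by rewrite exprMn (expr2 e0) !mulrA.
have k1 : 7%:R ^+ 4 * e0 * (e0 * h ^+ 2) <= 1 / 2 * (e0 * h ^+ 2).
  by rewrite ler_wpM2r // mulr_ge0 // sqr_ge0.
have k2 : e0 * h ^+ 2 <= e0 * h by rewrite ler_wpM2l // expr2 ler_piMl.
apply: le_trans k1 _; apply: (@le_trans _ _ (1 / 2 * (e0 * h))); first by rewrite ler_wpM2l.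
by rewrite mulrC -mulrA.
Qed.

Lemma pr_all_good : 14%:R * e0 < 1 -> 0 < pr (~` (\bigcup_n \big[setU/set0]_(u < 7) bad n u 0)).
Proof.
move=> he; have mb k a b : measurable (bad k a b) := dep_meas (dep_bad k a b).
have mB n : measurable (\big[setU/set0]_(u < 7) bad n u 0) by exact: measurable_bigU.
rewrite pr_setC; last exact: bigcup_measurable.
rewrite subr_gt0; apply: le_lt_trans he; apply: pr_bigcup_le => // N.
apply: (@le_trans _ _ (\sum_(n < N) 7%:R * (e0 * (1 / 2) ^+ n))).
  apply: ler_sum => n _; apply: le_trans (pr_bigU P _ (fun u _ => mb n _ _)) _.
  rewrite mulr_natl -[X in _ *+ X]card_ord -sumr_const.
  by apply: ler_sum => u _; exact: pr_bad.
have -> : \sum_(n < N) 7%:R * (e0 * (1 / 2) ^+ n) = 14%:R * e0 * (1 - (1 / 2) ^+ N).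
  elim: N => [|N IHN]; first by rewrite big_ord0 expr0; ring.
  by rewrite big_ord_recr /= IHN exprSr; field.
rewrite ler_piMr ?mulr_ge0 // lerBlDr lerDl exprn_ge0 //.
Qed.

Lemma badS o n i j : bad n.+1 i j o <-> exists a b c d, [/\ (a < 7)%N, (b < 7)%N, (c < 7)%N & (d < 7)%N] /\
  [/\ spaced a c || spaced b d, bad n (i * 7 + a) (j * 7 + b) o & bad n (i * 7 + c) (j * 7 + d) o].
Proof.
split=> [/bigsetU_mem[p sp [h1 h2]]|[a [b [c [d' [[a7 b7 c7 d7] [sp h1 h2]]]]]]].
  exists p.1.1, p.1.2, p.2.1, p.2.2; split; first by split; exact: ltn_ord.
  by split.
apply/bigsetU_mem.
by exists ((Ordinal a7, Ordinal b7), (Ordinal c7, Ordinal d7)).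
Qed.

Lemma bad_escape o (conn : nat * nat -> nat * nat -> Prop) :
  (~` (\bigcup_n \big[setU/set0]_(u < 7) bad n u 0)) o ->
  (forall x, conn x x) -> (forall x y, conn x y -> conn y x) ->
  (forall x y z, conn x y -> conn y z -> conn x z) ->
  (forall i j, g i j o -> g i.+1 j o -> conn (i, j) (i.+1, j)) ->
  (forall i j, g i j o -> g i j.+1 o -> conn (i, j) (i, j.+1)) ->
  forall N, exists x, (N <= x.1)%N /\ conn (0%N, 0%N) x.
Proof.
move=> ho cr cs ct ch cv.
apply: (@escape (fun n i j => bad n i j o)) => //.
- by move=> n i j; exact: badS.
- by move=> i j /= /contrapT h /contrapT h'; exact: ch.
- by move=> i j /= /contrapT h /contrapT h'; exact: cv.
move=> n u u7 hb; apply: ho; exists n => //; apply/bigsetU_mem.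
by exists (Ordinal u7).
Qed.


End Renormalization.

(** * Finite marginals of a percolation model *)

Section Events.
Variables (R : realType) (G : graph) (P : model R G).
Notation pr := (pr P).
Implicit Types (W : set (vertex G)) (E F : set (spanning G)) (H : spanning G).

Definition within W : set (edge G) := [set e | \val e `<=` W].
Definition ev W : set (set (spanning G)) := sigma_states (within W).

Lemma ev0 W : ev W set0.
Proof. by have [] := smallest_sigma_algebra [set: spanning G] (open_events (within W)). Qed.

Lemma evC W E : ev W E -> ev W (~` E).
Proof.
have [_ h _] := smallest_sigma_algebra [set: spanning G] (open_events (within W)).
by move=> /h; rewrite setTD.
Qed.

Lemma ev_bigcup W (F : nat -> set (spanning G)) : (forall n, ev W (F n)) -> ev W (\bigcup_n F n).
Proof. by have [_ _ h] := smallest_sigma_algebra [set: spanning G] (open_events (within W)); apply: h. Qed.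

Lemma evU W E F : ev W E -> ev W F -> ev W (E `|` F).
Proof.
move=> hE hF; rewrite -bigcup2E; apply: ev_bigcup => -[//|[//|n]] /=; exact: ev0.
Qed.

Lemma evI W E F : ev W E -> ev W F -> ev W (E `&` F).
Proof. by move=> hE hF; rewrite -[E `&` F]setCK setCI; apply: evC; apply: evU; exact: evC. Qed.

Lemma sigma_states_sub (S S' : set (edge G)) : S `<=` S' -> sigma_states S `<=` sigma_states S'.
Proof.
move=> SS; apply: smallest_sub; first exact: smallest_sigma_algebra.
by move=> _ [e /SS Se <-]; apply: sub_sigma_algebra; exists e.
Qed.

Lemma ev_sub W W' E : W `<=` W' -> ev W E -> ev W' E.
Proof. by move=> WW; apply: sigma_states_sub => e eW x /eW /WW. Qed.

Lemma ev_meas W E : ev W E -> measurable (E : set (config G)).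
Proof. by apply: sigma_states_sub. Qed.

Lemma ev_adj W u v : W u -> W v -> ev W [set H | sub_adj H u v].
Proof.
move=> Wu Wv; have [[e eE]|ne] := pselect (exists e : edge G, \val e = [set u; v]).
  have -> : [set H | sub_adj H u v] = is_open e.
    apply/seteqP; split=> H /=; last by move=> He; apply/asboolP; exists e.
    by move/asboolP => [e' [He' e'E]]; have <- : e' = e by apply: val_inj; rewrite e'E eE.
  by apply: sub_sigma_algebra; exists e => // x; rewrite eE => -[->|->].
have -> : [set H | sub_adj H u v] = set0; last exact: ev0.
by rewrite -subset0 => H /= /asboolP [e [_ eE]]; apply: ne; exists e.
Qed.

Lemma ev_big W (I : finType) (Q : pred I) (F : I -> set (spanning G)) :
  (forall i, Q i -> ev W (F i)) -> ev W (\big[setU/set0]_(i | Q i) F i).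
Proof. by move=> h; elim/big_ind: _ => [|? ?|]; [exact: ev0|exact: evU|]. Qed.

Lemma ev_ffun W (I : finType) (b : I -> spanning G -> bool) (a : pred {ffun I -> bool}) :
  (forall i, ev W [set H | b i H]) -> ev W [set H | a [ffun i => b i H]].
Proof.
move=> hb.
have -> : [set H | a [ffun i => b i H]] = \big[setU/set0]_(f : {ffun I -> bool} | a f)
    (~` \big[setU/set0]_i [set H | b i H != f i]).
  apply/seteqP; split=> H /=.
    move=> aH; apply/bigsetU_mem; exists [ffun i => b i H] => // /bigsetU_mem[i _] /=.
    by rewrite ffunE eqxx.
  move=> /bigsetU_mem[f af nf]; have <- // : f = [ffun i => b i H].
  apply/ffunP => i; rewrite ffunE; apply/esym/eqP; rewrite -[_ == _]negbK; apply/negP => h.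
  by apply: nf; apply/bigsetU_mem; exists i.
apply: ev_big => f _; apply: evC; apply: ev_big => i _.
case: (f i).
  have -> : [set H | b i H != true] = ~` [set H | b i H] by apply/seteqP; split=> H /=; case: (b i H).
  exact: evC.
by have -> : [set H | b i H != false] = [set H | b i H] by apply/seteqP; split=> H /=; case: (b i H).
Qed.

Hypothesis P1 : one_independent P.

Lemma pr_indep W W' E F : W `&` W' = set0 -> ev W E -> ev W' F -> pr (E `&` F) = pr E * pr F.
Proof.
move=> WW hE hF.
have ne (e : edge G) : exists x, \val e x.
  by have := set_valP e => -[x [y [_ eE]]]; exists x; rewrite eE; left.
have := P1 (S1 := within W) (S2 := within W') _ _ hE hF => h.
have mE := ev_meas hE; have mF := ev_meas hF.
apply: EFin_inj; rewrite EFinM -!prE //; last exact: measurableI.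
apply: h.
  rewrite -subset0 => e [e1 e2]; have [x ex] := ne e.
  have : (W `&` W') x by [split; [exact: e1|exact: e2]].
  by rewrite WW.
move=> e f e1 f2 [x [ex fx]]; have : (W `&` W') x by [split; [exact: e1|exact: f2]].
by rewrite WW.
Qed.

Section Trace.
Variables (V : finType) (ka : V -> vertex G).

Definition trace H : conf V := [ffun p : V * V => sub_adj H (ka p.1) (ka p.2)].

Lemma ev_trace W (A : {set V}) (a : pred (conf V)) : meas (sq A) a -> (forall x, x \in A -> W (ka x)) ->
  ev W [set H | a (trace H)].
Proof.
move=> ma AW.
pose b (p : V * V) H := (p.1 \in A) && (p.2 \in A) && sub_adj H (ka p.1) (ka p.2).
have -> : [set H | a (trace H)] = [set H | a [ffun p => b p H]].
  apply/seteqP; split=> H /=; rewrite (ma (trace H) [ffun p => b p H]) //;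
    apply/agreeP => x y /andP[xA yA]; rewrite /op !ffunE /b /= xA yA //.
apply: ev_ffun => -[x y]; rewrite /b /=; case: (boolP (x \in A)) => xA; last first.
  by rewrite (_ : [set H | _] = set0); [exact: ev0|apply/seteqP; split].
case: (boolP (y \in A)) => yA; last first.
  by rewrite (_ : [set H | _] = set0); [exact: ev0|apply/seteqP; split].
exact: ev_adj (AW x xA) (AW y yA).
Qed.

Lemma ev_traceT (a : pred (conf V)) : ev setT [set H | a (trace H)].
Proof. by apply: ev_ffun => p; exact: ev_adj. Qed.

Definition law (o : conf V) : R := pr [set H | trace H == o].

Lemma Ex_law (a : pred (conf V)) : Ex law (fun o => (a o)%:R) = pr [set H | a (trace H)].
Proof.
have ms s : measurable ([set H | trace H \in s] : set (config G)).
  exact: ev_meas (ev_traceT (fun o => o \in s)).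
have mo o : measurable ([set H | trace H == o] : set (config G)).
  exact: ev_meas (ev_traceT (fun o' => o' == o)).
have key s : uniq s -> pr [set H | trace H \in s] = \sum_(o <- s) law o.
  elim: s => [|o s IHs] /=.
    by move=> _; rewrite big_nil (_ : [set H | _] = set0) ?pr_set0 //; apply/seteqP; split.
  case/andP => os us; rewrite big_cons -IHs // -pr_disjU //.
    by congr pr; apply/seteqP; split=> H /=; rewrite inE; [case/orP; [left|right]|case=> ->; rewrite ?orbT].
  by rewrite -subset0 => H /= [/eqP -> ]; rewrite (negPf os).
rewrite /Ex; transitivity (\sum_(o | a o) law o).
  by rewrite [RHS]big_mkcond; apply: eq_bigr => o _; case: (a o); rewrite ?mulr1 ?mulr0.
rewrite -big_enum /= -key ?enum_uniq //.
by congr pr; apply/seteqP; split=> H /=; rewrite mem_enum.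
Qed.

Lemma law_ge0 o : 0 <= law o. Proof. exact: pr_ge0. Qed.

Lemma law1 : \sum_o law o = 1.
Proof.
have := Ex_law predT; rewrite (_ : [set H | _] = setT) ?pr_setT; last by apply/seteqP; split.
by move=> <-; apply: eq_bigr => o _; rewrite mulr1.
Qed.

Hypothesis ka_inj : injective ka.

(** Since [ka] is injective, disjoint sets have disjoint images, and edges inside these share no
    vertex. *)
Lemma law_indep : indep_on_disjoint law.
Proof.
move=> A B a b dAB ma mb; rewrite !Ex_law.
have -> : [set H | a (trace H) && b (trace H)] = [set H | a (trace H)] `&` [set H | b (trace H)].
  by apply/seteqP; split=> H /=; [case/andP|case=> -> ->].
apply: (@pr_indep (ka @` [set` A]) (ka @` [set` B])).
- rewrite -subset0 => _ [[x xA <-] [y yB /ka_inj yx]].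
  by move: xA yB => /= xA; rewrite yx (disjointFr dAB xA).
- by apply: (ev_trace ma) => x xA; exists x.
- by apply: (ev_trace mb) => x xA; exists x.
Qed.

End Trace.

Lemma law_open (J : finType) (ka : {set J} -> vertex G) : D_ge (p0 R) P ->
  (forall (w : {set J}) r, r \notin w -> adj (ka w) (ka (r |: w)%SET)) -> cube_open (law ka).
Proof.
move=> [_ hP] hadj w r rw; rewrite (Ex_law ka (fun o => op o w (r |: w)%SET)).
have eP : edge_set G [set ka w; ka (r |: w)%SET] by exists (ka w), (ka (r |: w)%SET); split=> //; exact: hadj.
pose e : edge G := SigSub (mem_set eP).
have mo : measurable (is_open e : set (config G)).
  by apply: sub_sigma_algebra; exists e.
have := hP e; rewrite (prE P mo) lee_fin => h; apply: le_trans h _.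
apply: pr_le => //; first exact: ev_meas (ev_traceT ka (fun o => op o w (r |: w)%SET)).
by move=> H He /=; rewrite /op !ffunE /=; apply/orP; left; apply/asboolP; exists e.
Qed.

End Events.

(** * Cubes over the edges of the square lattice *)

Section OpenPaths.
Variables (G : graph) (H : spanning G).

Lemma sub_adjC (u v : vertex G) : sub_adj H u v = sub_adj H v u.
Proof. by rewrite /sub_adj [in LHS]setUC. Qed.

Lemma component_refl u : component H u u. Proof. by exists [::]. Qed.

Lemma component_trans u v w : component H u v -> component H v w -> component H u w.
Proof.
move=> [s [ps ls]] [t [pt lt]]; exists (s ++ t); rewrite cat_path last_cat ps ls; by split.
Qed.

Lemma component1 u v : sub_adj H u v -> component H u v.
Proof. by move=> uv; exists [:: v]; rewrite /= uv. Qed.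

Lemma component_sym u v : component H u v -> component H v u.
Proof.
move=> [s [ps <-]]; elim: s u ps => [|x s IHs] u /=; first by move=> _; exact: component_refl.
case/andP => ux ps; apply: component_trans (IHs x ps) _.
by apply: component1; rewrite sub_adjC.
Qed.

Lemma component_trace (V : finType) (ka : V -> vertex G) (x y : V) :
  conn (trace ka H) finset.setT x y -> component H (ka x) (ka y).
Proof.
case/connectP => s ps ->; elim: s x ps => [|z s IHs] x /=; first by move=> _; exact: component_refl.
case/andP => /andP[_ xz] ps; apply: component_trans (IHs z ps); apply: component1.
by move: xz; rewrite /op !ffunE /= (sub_adjC (ka z)) orbb.
Qed.

End OpenPaths.

Section Vertices.
Variables (R : realType) (h : nat).
Local Notation LG := (lattice R h.+2).

Definition vtx (x : int * int) (w : {set 'I_h}) : vertex LG :=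
  \row_(i < h.+2) match val i with
  | 0%N => x.1 | 1%N => x.2 | k.+2 => ((k \in map val (enum w)) : nat)%:Z end.

Let two_lt (j : 'I_h) : (j.+2 < h.+2)%N. Proof. by rewrite !ltnS. Qed.

Lemma vtx_fst x w : (vtx x w : 'rV[int]_h.+2) ord0 ord0 = x.1.
Proof. by rewrite mxE. Qed.

Lemma vtx_snd x w : (vtx x w : 'rV[int]_h.+2) ord0 (Ordinal (isT : 1 < h.+2)%N) = x.2.
Proof. by rewrite mxE. Qed.

Lemma vtx_mem x w (j : 'I_h) : (vtx x w : 'rV[int]_h.+2) ord0 (Ordinal (two_lt j)) = (j \in w : nat)%:Z.
Proof. by rewrite mxE /= mem_map ?mem_enum //; exact: val_inj. Qed.

Lemma vtx_inj x w x' w' : vtx x w = vtx x' w' -> x = x' /\ w = w'.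
Proof.
move=> e; split.
  have e1 := vtx_fst x w; have e2 := vtx_snd x w; rewrite e vtx_fst in e1; rewrite e vtx_snd in e2.
  by move: e1 e2; case: x {e}; case: x' => /= a b c d -> ->.
apply/setP => j; have := vtx_mem x w j; rewrite e vtx_mem.
by case: (j \in w); case: (j \in w').
Qed.

Lemma dist_one n (u v : 'rV[int]_n) i0 : (forall i, i != i0 -> u ord0 i = v ord0 i) ->
  `|u ord0 i0 - v ord0 i0| = 1 -> euclid_dist R u v = 1.
Proof.
move=> same one; rewrite /euclid_dist (bigD1 i0) //= big1 => [|i ni]; last first.
  by rewrite same // subrr expr0n.
rewrite addr0 -rmorphB /= -[X in Num.sqrt X]real_normK ?num_real //.
by rewrite -intr_norm one expr1n sqrtr1.
Qed.

Definition shift (d : bool) (x : int * int) := if d then (x.1, x.2 + 1) else (x.1 + 1, x.2).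

Definition down (w : {set option 'I_h}) : {set 'I_h} := finset (fun i => Some i \in w).

(* The cube [s = (x, d)] lies over the edge of the square lattice leaving [x] in direction [d]: its coordinate
   [None] moves along this edge, and the others are the last [h] coordinates. *)
Definition emb (s : (int * int) * bool) (w : {set option 'I_h}) : vertex LG :=
  vtx (if None \in w then shift s.2 s.1 else s.1) (down w).

Lemma shift_neq d x : shift d x <> x.
Proof. by case: d; case: x => a b [] /eqP; rewrite -subr_eq0 addrC addKr. Qed.

Lemma emb_inj s : injective (emb s).
Proof.
move=> w w' /vtx_inj[e1 e2]; apply/setP => -[i|].
  by move/setP/(_ i): e2; rewrite !inE.
move: e1; case: (None \in w); case: (None \in w') => //; first by move/shift_neq.
by move=> /esym /shift_neq.
Qed.

Lemma emb_adj s (w : {set option 'I_h}) r : r \notin w -> adj (emb s w) (emb s (r |: w)%SET).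
Proof.
move=> rw; case: r rw => [j|] rw.
  apply: (@dist_one _ _ _ (Ordinal (two_lt j))).
    move=> i ij; rewrite !mxE; case: i ij => -[|[|k]] //= kh kj.
      by rewrite in_setU1 /=.
      by rewrite in_setU1 /=.
    do 2 f_equal; apply/idP/idP => /mapP[j' j'w kE]; apply/mapP; exists j' => //;
      move: j'w; rewrite !mem_enum !inE ?eqxx //=.
      by move=> ->; rewrite orbT.
    case/orP => // /eqP [jj]; exfalso; move: kj; rewrite -val_eqE /= kE jj eqxx.
    by [].
  have -> : emb s w ord0 (Ordinal (two_lt j)) = 0.
    by rewrite /emb vtx_mem inE (negPf rw).
  have -> : emb s (Some j |: w)%SET ord0 (Ordinal (two_lt j)) = 1.
    by rewrite /emb vtx_mem !inE eqxx.
  by rewrite sub0r normrN normr1.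
pose i0 : 'I_h.+2 := if s.2 then Ordinal (isT : 1 < h.+2)%N else ord0.
have dE : down (None |: w)%SET = down w by apply/setP => i; rewrite !inE.
apply: (@dist_one _ _ _ i0).
  move=> i; rewrite /emb dE in_setU1 eqxx (negPf rw) /= !mxE /i0 /shift {i0 dE}.
  by case: i; case: s rw => x [] rw /=; case=> [|[|k]] //= ki; rewrite -val_eqE.
rewrite /emb dE in_setU1 eqxx (negPf rw) /= /i0 /shift {i0 dE}; case: s rw => x [] rw /=.
  by rewrite !vtx_snd /= opprD addrA subrr add0r normrN normr1.
by rewrite !vtx_fst /= opprD addrA subrr add0r normrN normr1.
Qed.

End Vertices.

Section FiniteEvents.
Variables (R : realType) (G : graph) (P : model R G).
Notation pr := (pr P).
Implicit Types (W : set (vertex G)) (H : spanning G).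

Lemma ev_forall W (I : finType) (b : I -> spanning G -> bool) :
  (forall i, ev W [set H | b i H]) -> ev W [set H | [forall i, b i H]].
Proof.
move=> hb; have := ev_ffun (fun f : {ffun I -> bool} => [forall i, f i]) hb.
by congr (ev W _); apply/seteqP; split=> H /= /forallP h; apply/forallP => i; have := h i; rewrite ffunE.
Qed.

Lemma ev_exists W (I : finType) (b : I -> spanning G -> bool) :
  (forall i, ev W [set H | b i H]) -> ev W [set H | [exists i, b i H]].
Proof.
move=> hb; have := ev_ffun (fun f : {ffun I -> bool} => [exists i, f i]) hb.
by congr (ev W _); apply/seteqP; split=> H /= /existsP[i h]; apply/existsP; exists i; move: h; rewrite ffunE.
Qed.

Lemma ev_andb W (b c : spanning G -> bool) : ev W [set H | b H] -> ev W [set H | c H] ->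
  ev W [set H | b H && c H].
Proof.
move=> hb hc; rewrite (_ : [set H | _] = [set H | b H] `&` [set H | c H]); first exact: evI.
by apply/seteqP; split=> H /=; [case/andP|case=> -> ->].
Qed.

Lemma ev_negb W (b : spanning G -> bool) : ev W [set H | b H] -> ev W [set H | ~~ b H].
Proof.
move=> hb; rewrite (_ : [set H | _] = ~` [set H | b H]); first exact: evC.
by apply/seteqP; split=> H /=; [move/negP|move=> ?; apply/negP].
Qed.

Lemma ev_all W (I : eqType) (s : seq I) (b : I -> spanning G -> bool) :
  (forall i, i \in s -> ev W [set H | b i H]) -> ev W [set H | all (fun i => b i H) s].
Proof.
elim: s => [|i s IHs] hb /=.
  by rewrite (_ : [set H | _] = ~` set0); [apply: evC; exact: ev0|rewrite setC0; apply/seteqP; split].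
apply: ev_andb; first by apply: hb; rewrite mem_head.
by apply: IHs => j js; apply: hb; rewrite inE js orbT.
Qed.

Lemma ev_trace_in W (V : finType) (ka : V -> vertex G) (a : pred (conf V)) :
  (forall x, W (ka x)) -> ev W [set H | a (trace ka H)].
Proof. by move=> hW; apply: ev_ffun => p; exact: ev_adj. Qed.

Hypothesis P1 : one_independent P.

Lemma pr_none (I : eqType) (s : seq I) (W : I -> set (vertex G)) (b : I -> spanning G -> bool) (c : R) :
  c <= 1 -> uniq s -> (forall i, i \in s -> ev (W i) [set H | b i H]) ->
  (forall i j, i \in s -> j \in s -> i != j -> W i `&` W j = set0) ->
  (forall i, i \in s -> c <= pr [set H | b i H]) ->
  pr [set H | all (fun i => ~~ b i H) s] <= (1 - c) ^+ size s.
Proof.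
move=> c1; elim: s => [|i s IHs] /= us hb dW hc.
  by rewrite expr0 (_ : [set H | _] = setT) ?pr_setT //; apply/seteqP; split.
case/andP: us => iS us; have tl j : j \in s -> j \in i :: s by rewrite inE orbC => ->.
rewrite (_ : [set H | _] = [set H | ~~ b i H] `&` [set H | all (fun i => ~~ b i H) s]); last first.
  by apply/seteqP; split=> H /=; [case/andP|case=> -> ->].
have hbi : ev (W i) [set H | b i H] by apply: hb; rewrite mem_head.
pose U := \bigcup_(j in [set` s]) W j.
rewrite (pr_indep P1 (W := W i) (W' := U)).
- rewrite exprS; apply: ler_pM; rewrite ?pr_ge0 //.
    rewrite (_ : [set H | _] = ~` [set H | b i H]); last first.
      by apply/seteqP; split=> H /=; [move/negP|move=> ?; apply/negP].
    by rewrite pr_setC ?lerD2l ?lerN2 ?hc ?mem_head //; exact: ev_meas hbi.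
  apply: IHs => // [j js|j k js ks|j js]; [exact: hb (tl j js)|exact: dW (tl j js) (tl k ks)|exact: hc (tl j js)].
- rewrite -subset0 => v [vi [j /= js vj]].
  have ij : i != j by apply: contraNneq iS => ->.
  by have : (W i `&` W j) v by [split]; rewrite (dW i j (mem_head _ _) (tl j js) ij).
- exact: ev_negb.
- apply: ev_all => j js; apply: ev_negb; apply: ev_sub (hb j (tl j js)).
  by move=> v vj; exists j.
Qed.

End FiniteEvents.

Local Notation disj A B := (fintype.disjoint (mem A) (mem B)).

Definition unshift (d : bool) (x : int * int) := if d then (x.1, x.2 - 1) else (x.1 - 1, x.2).

Lemma unshiftK d x : shift d (unshift d x) = x.
Proof. by case: d; case: x => a b; rewrite /shift /unshift /= subrK. Qed.

Lemma shiftK d x : unshift d (shift d x) = x.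
Proof. by case: d; case: x => a b; rewrite /shift /unshift /= addrK. Qed.

(* The four structures meeting a site [x]: [(d, false)] is the one leaving [x] in direction [d],
   and [(d, true)] the one arriving at [x]. *)
Definition inc (x : int * int) (k : bool * bool) := (if k.2 then unshift k.1 x else x, k.1).

Definition toint (i j : nat) : int * int := (i%:Z, j%:Z).

Lemma inc_near i j k (b : bool) (y := if b then shift (inc (toint i j) k).2 (inc (toint i j) k).1
    else (inc (toint i j) k).1) : `|y.1 - i%:Z| <= 1 /\ `|y.2 - j%:Z| <= 1.
Proof.
rewrite {}/y /toint; move: i%:Z j%:Z => u v.
by case: b; case: k => -[] [] /=; rewrite ?subrK ?subrr ?normr0; lia.
Qed.

(** * Gluing the structures at the sites of the square lattice *)

Section Percolation.
Variables (R : realType) (h : nat) (P : model R (lattice R h.+2)).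
Notation LG := (lattice R h.+2).
Notation J := (option 'I_h).
Notation pr := (pr P).
Hypothesis P1 : one_independent P.
Notation mu s := (law P (emb R s)).
Variables (Ms Pl : {set J}) (G : bool -> {set J}) (tau eta del : R) (l : nat).
Variables (S D Z : (int * int) * bool -> {set J}) (X : int * int -> {set J}).
Hypothesis mu_open : forall s, cube_open (mu s).
Hypotheses (NM : None \notin Ms) (NP : None \notin Pl) (NG : forall c, None \notin G c).
Hypotheses (tau0 : 0 < tau) (l0 : (0 < l)%N) (Dl : forall s, #|D s| = (l * l).*2).
Hypotheses (SP : forall s, S s \subset Pl) (DP : forall s, D s \subset Pl)
  (dSD : forall s, disj (S s) (D s)).
Hypotheses (MP : disj (Ms) (Pl)) (GP : forall c, disj (G c) (Pl)).
Hypotheses (MG : forall c, disj (Ms) (G c)) (dG : disj (G false) (G true)).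
Hypothesis st : forall s (w A : {set J}), w \subset (~: Pl)%SET -> A \subset (~: Pl)%SET ->
  stable (mu s) tau (A :|: S s)%SET (D s) w.
Hypotheses (XG : forall x, X x \subset G false) (ZG : forall s, Z s \subset G true).
Hypothesis rows : forall s p, p \in rowset None (X s.1) (X (shift s.2 s.1)) (Z s) ->
  row (mu s) (S s) (D s) Ms Pl G p.1 p.2.

Definition soundat s H := sound (mu s) (S s) (D s) Ms Pl G None (X s.1) (X (shift s.2 s.1)) (Z s)
  (trace (emb R s) H).

Hypothesis sound_le : forall s, pr [set H | ~~ soundat s H] <= del.
Hypothesis ratio_le : (1 - 8%:R / 60%:R) ^+ #|Ms| <= del.

(** A structure arriving at [x] has this site at the far end of its edge, where [None] is set. All
    four structures use the same [X x], so position [m] is the same lattice vertex [spotv x m] for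
    each. *)
Definition spot (x : int * int) (k : bool * bool) : {set J} := if k.2 then (None |: X x)%SET else X x.

Definition gv x k m H := gd (mu (inc x k)) (S (inc x k)) (D (inc x k)) G false (m |: spot x k)%SET
  (trace (emb R (inc x k)) H).

(** The second condition provides vertices that are good for two structures at once, where paths can
    pass from one to the other. *)
Definition site_ok x H := [forall k, soundat (inc x k) H] &&
  [forall k, [forall k', [exists m in Ms, gv x k m H && gv x k' m H]]].

Definition spotv x m : vertex LG := vtx R x (down (m |: X x)%SET).

Let NX x : None \notin X x. Proof. by apply: contra (NG false); apply: (fintype.subsetP (XG x)). Qed.

Let emb_spot x k m : m \in Ms -> emb R (inc x k) (m |: spot x k)%SET = spotv x m.
Proof.
move=> mM; have mN : (None == m) = false by case: (m) mM => // mM0; have := NM; rewrite mM0.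
rewrite /emb /inc /spot /spotv; case: k => d [] /=.
  rewrite !inE eqxx orbT unshiftK; congr (vtx R x _).
  by apply/setP => i; rewrite !inE /=.
by rewrite !inE mN (negPf (NX x)).
Qed.

Let spot_in x k : spot x k \in [:: X (inc x k).1; (None |: X (shift (inc x k).2 (inc x k).1))%SET].
Proof. by rewrite /spot /inc; case: k => d [] /=; rewrite ?unshiftK !inE eqxx ?orbT. Qed.

Let sc s L L' H m m' : soundat s H -> L \in [:: X s.1; (None |: X (shift s.2 s.1))%SET] ->
  L' \in [:: X s.1; (None |: X (shift s.2 s.1))%SET] -> m \in Ms -> m' \in Ms ->
  gd (mu s) (S s) (D s) G false (m |: L)%SET (trace (emb R s) H) ->
  gd (mu s) (S s) (D s) G false (m' |: L')%SET (trace (emb R s) H) ->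
  component H (emb R s (m |: L)%SET) (emb R s (m' |: L')%SET).
Proof.
move=> so hL hL' mM mM' g1 g2; apply: component_trace.
exact: (@sound_conn _ _ (mu s) (S s) (D s) Ms Pl G MP GP MG None (X s.1) (X (shift s.2 s.1)) (Z s)
  NM NG NP (XG _) (XG _) (ZG s) dG (@rows s) (trace (emb R s) H) L L' so hL hL' m m' mM mM' g1 g2).
Qed.

Lemma ok_same x H k k' m m' : site_ok x H -> m \in Ms -> m' \in Ms -> gv x k m H -> gv x k' m' H ->
  component H (spotv x m) (spotv x m').
Proof.
case/andP => /forallP so /forallP id mM mM' g1 g2.
have /forallP/(_ k')/exists_inP[z zM /andP[gk gk']] := id k.
apply: (@component_trans _ _ _ (spotv x z)).
  by rewrite -(emb_spot x k mM) -(emb_spot x k zM); apply: sc (so k) _ _ _ _ g1 gk; rewrite ?spot_in.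
by rewrite -(emb_spot x k' mM') -(emb_spot x k' zM); apply: sc (so k') _ _ _ _ gk' g2; rewrite ?spot_in.
Qed.

Lemma ok_adj x d H m m' : site_ok x H -> m \in Ms -> m' \in Ms -> gv x (d, false) m H ->
  gv (shift d x) (d, true) m' H -> component H (spotv x m) (spotv (shift d x) m').
Proof.
case/andP => /forallP so _ mM mM' g1 g2.
rewrite -(emb_spot x (d, false) mM) -(emb_spot (shift d x) (d, true) mM').
have E : inc (shift d x) (d, true) = inc x (d, false) by rewrite /inc /= shiftK.
have s2 := spot_in (shift d x) (d, true); rewrite /gv E in g2 s2 *.
by apply: sc (so (d, false)) _ _ _ _ g1 g2; rewrite ?spot_in.
Qed.

(** The default value lies over [x] as well, so the first coordinate is known even where the site
    fails. *)
Definition rep x H : vertex LG :=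
  if [pick p : J * (bool * bool) | (p.1 \in Ms) && gv x p.2 p.1 H] is Some p then spotv x p.1
  else spotv x None.

Lemma rep_fst x H : (rep x H : 'rV[int]_h.+2) ord0 ord0 = x.1.
Proof. by rewrite /rep; case: pickP => [p _|_]; rewrite /spotv vtx_fst. Qed.

Lemma ok_rep x H k : site_ok x H -> exists m, [/\ m \in Ms, gv x k m H & component H (rep x H) (spotv x m)].
Proof.
move=> ok; have /andP[_ /forallP/(_ k)/forallP/(_ k)/exists_inP[m mM /andP[gm _]]] := ok.
exists m; split=> //; rewrite /rep; case: pickP => [[m' k'] /= /andP[mM' gm']|none].
  exact: ok_same ok mM' mM gm' gm.
by have := none (m, k); rewrite /= mM gm.
Qed.

Lemma rep_adj x d H : site_ok x H -> site_ok (shift d x) H -> component H (rep x H) (rep (shift d x) H).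
Proof.
move=> ok ok'; have [m [mM gm cm]] := ok_rep (d, false) ok; have [m' [mM' gm' cm']] := ok_rep (d, true) ok'.
apply: component_trans cm (component_trans _ (component_sym cm')).
exact: ok_adj gm gm'.
Qed.

Let row_spot x k : row (mu (inc x k)) (S (inc x k)) (D (inc x k)) Ms Pl G false (spot x k).
Proof.
set s := inc x k; have hin := spot_in x k; rewrite -/s !inE in hin.
have h1 : (false, X s.1) \in rowset None (X s.1) (X (shift s.2 s.1)) (Z s).
  rewrite !finset.in_setU; apply/orP; left; apply/orP; left; apply/orP; left.
  by apply/imsetP; exists finset.set0; rewrite ?finset.powersetE ?finset.sub0set ?finset.setU0 ?finset.set0U.
have h2 : (false, None |: X (shift s.2 s.1))%SET \in rowset None (X s.1) (X (shift s.2 s.1)) (Z s).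
  rewrite !finset.in_setU; apply/orP; left; apply/orP; left; apply/orP; right.
  by apply/imsetP; exists finset.set0; rewrite ?finset.powersetE ?finset.sub0set ?finset.setU0 ?finset.set0U.
by case/orP: hin => /eqP ->; [exact: (rows h1)|exact: (rows h2)].
Qed.

Lemma gv_prob x k m : m \in Ms -> 34%:R / 60%:R <= pr [set H | gv x k m H].
Proof.
move=> mM; have /and3P[LP _ /forall_inP us] := row_spot x k.
have u := forall_inP (us m mM) m mM; rewrite finset.setUA finset.setUid in u.
have wP : (m |: spot x k)%SET \subset (~: Pl)%SET.
  by rewrite finset.subUset finset.sub1set finset.in_setC (disjointFr MP mM).
have := gd_prob (law_ge0 P (emb R (inc x k))) (law1 P (emb R (inc x k)))
  (law_indep P1 (@emb_inj R h (inc x k))) (mu_open (inc x k)) l0 (Dl _) (SP _) (DP _) (dSD _) GP wP u.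
by rewrite (Ex_law P (emb R (inc x k)) (fun o => gd _ _ _ _ _ _ o)).
Qed.

(* Good vertices at different positions [m] depend on disjoint sets of vertices. *)
Definition posv m : set (vertex LG) := [set v | exists y w, v = vtx R y w /\
  forall j, Some j \in Ms -> (j \in w) = (Some j == m)].

Lemma gv_ev x k m : m \in Ms -> ev (posv m) [set H | gv x k m H].
Proof.
move=> mM; apply: (ev_trace (@meas_gd R _ (mu (inc x k)) (S (inc x k)) (D (inc x k)) G false
  (m |: spot x k)%SET)) => w wQ.
have /and3P[_ dL _] := row_spot x k.
rewrite /emb; set y := (if _ then _ else _); exists y, (down w); split=> // j jM.
rewrite inE (Q_out wQ).
  by rewrite finset.in_setU1 (disjointFr dL jM) orbF.
rewrite !finset.in_setU !negb_or (disjointFr (MG false) jM) /=; have jP := disjointFr MP jM.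
apply/andP; split; apply/negP => hj.
  by move: jP; rewrite (fintype.subsetP (SP (inc x k)) _ hj).
by move: jP; rewrite (fintype.subsetP (DP (inc x k)) _ hj).
Qed.

Lemma pr_both (A B : set (spanning LG)) : measurable (A : set (config LG)) ->
  measurable (B : set (config LG)) -> pr A + pr B - 1 <= pr (A `&` B).
Proof.
move=> mA mB; have := pr_setU P (measurableC mA) (measurableC mB).
rewrite -setCI !pr_setC //; last exact: measurableI.
by move: (pr _) (pr _) (pr _) => a b c; lra.
Qed.

Lemma pos_prob x k k' : pr [set H | ~~ [exists m in Ms, gv x k m H && gv x k' m H]] <= del.
Proof.
apply: le_trans ratio_le; rewrite cardE.
have -> : [set H | ~~ [exists m in Ms, gv x k m H && gv x k' m H]] =
    [set H | all (fun m => ~~ (gv x k m H && gv x k' m H)) (enum Ms)].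
  apply/seteqP; split=> H /=.
    by move/exists_inP => n; apply/allP => m; rewrite mem_enum => mM; apply/negP => g; apply: n; exists m.
  by move/allP => n; apply/exists_inP => -[m mM g]; have := n m; rewrite mem_enum mM g => /(_ isT).
apply: (pr_none P1 (W := posv)) => //.
- by rewrite ler_pdivrMr ?ltr0n // mul1r ler_nat.
- exact: enum_uniq.
- by move=> m; rewrite mem_enum => mM; apply: ev_andb; exact: gv_ev.
- move=> m m'; rewrite !mem_enum => mM mM' mm'.
  rewrite -subset0 => v [[y [w [-> hw]]] [y' [w' [/vtx_inj[_ ww] hw']]]].
  case: m mM mm' hw => [j|] jM mm' hw; last by have := NM; rewrite jM.
  by have := hw j jM; rewrite ww hw' // eqxx (negPf mm').
move=> m; rewrite mem_enum => mM.
have e1 := ev_meas (gv_ev x k mM); have e2 := ev_meas (gv_ev x k' mM).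
rewrite (_ : [set H | _] = [set H | gv x k m H] `&` [set H | gv x k' m H]); last first.
  by apply/seteqP; split=> H /=; [case/andP|case=> -> ->].
apply: le_trans (pr_both e1 e2); have := gv_prob x k mM; have := gv_prob x k' mM.
by move: (pr _) (pr _) => a b; lra.
Qed.

(** Four structures may be unsound and sixteen ordered pairs of them may lack a common position,
    whence 20. *)
Lemma site_prob x : pr [set H | ~~ site_ok x H] <= 20%:R * del.
Proof.
have ms k : measurable ([set H | ~~ soundat (inc x k) H] : set (config LG)).
  by apply: (@ev_meas _ setT); apply: ev_negb; exact: ev_trace_in.
have me (p : (bool * bool) * (bool * bool)) :
    measurable ([set H | ~~ [exists m in Ms, gv x p.1 m H && gv x p.2 m H]] : set (config LG)).
  apply: (@ev_meas _ setT); apply: ev_negb; apply: ev_exists => m; case: (boolP (m \in Ms)) => mM /=.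
    by apply: ev_andb; exact: ev_sub (gv_ev _ _ mM).
  by rewrite (_ : [set H | _] = set0); [exact: ev0|apply/seteqP; split].
pose U1 := \big[setU/set0]_(k : bool * bool) [set H | ~~ soundat (inc x k) H].
pose U2 := \big[setU/set0]_(p : (bool * bool) * (bool * bool))
  [set H | ~~ [exists m in Ms, gv x p.1 m H && gv x p.2 m H]].
have mU1 : measurable (U1 : set (config LG)) by exact: measurable_bigU.
have mU2 : measurable (U2 : set (config LG)) by exact: measurable_bigU.
have sub : [set H | ~~ site_ok x H] `<=` U1 `|` U2.
  move=> H /=; rewrite /site_ok negb_and => /orP[|] /forallPn[k hk].
    by left; apply/bigsetU_mem; exists k.
  by have /forallPn[k' hk'] := hk; right; apply/bigsetU_mem; exists (k, k').
have mok : measurable ([set H | ~~ site_ok x H] : set (config LG)).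
  rewrite (_ : [set H | _] = U1 `|` U2); first exact: measurableU.
  apply/seteqP; split=> // H [] /bigsetU_mem[k _] /= hk; rewrite /site_ok negb_and; apply/orP.
    by left; apply/forallPn; exists k.
  by right; apply/forallPn; exists k.1; apply/forallPn; exists k.2.
apply: le_trans (pr_le P mok (measurableU _ _ mU1 mU2) sub) _.
apply: le_trans (pr_setU P mU1 mU2) _.
have h1 : pr U1 <= 4%:R * del.
  apply: le_trans (pr_bigU P _ (fun k _ => ms k)) _.
  rewrite mulr_natl (_ : 4%N = #|{: bool * bool}|); last by rewrite card_prod card_bool.
  by rewrite -sumr_const; apply: ler_sum => k _; exact: sound_le.
have h2 : pr U2 <= 16%:R * del.
  apply: le_trans (pr_bigU P _ (fun p _ => me p)) _.
  rewrite mulr_natl (_ : 16%N = #|{: (bool * bool) * (bool * bool)}|); last first.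
    by rewrite !card_prod card_bool.
  by rewrite -sumr_const; apply: ler_sum => p _; exact: pos_prob.
by move: (pr U1) (pr U2) h1 h2 => a b h1 h2; lra.
Qed.

(** The structures meeting a site stay within 1 of it in the first two coordinates; the spacing 3 of
    the renormalization makes such neighbourhoods disjoint. *)
Definition around (A : set (nat * nat)) : set (vertex LG) := [set v | exists a y w,
  [/\ A a, v = vtx R y w, `|y.1 - a.1%:Z| <= 1 & `|y.2 - a.2%:Z| <= 1]].

Lemma around_emb i j k w : around [set (i, j)] (emb R (inc (toint i j) k) w).
Proof.
have [h1 h2] := inc_near i j k (None \in w).
by exists (i, j); eexists; exists (down w).
Qed.

Lemma site_ev i j : ev (around [set (i, j)]) [set H | site_ok (toint i j) H].
Proof.
apply: ev_andb; first by apply: ev_forall => k; apply: ev_trace_in => w; exact: around_emb.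
apply: ev_forall => k; apply: ev_forall => k'; apply: ev_exists => m.
case: (m \in Ms) => /=; last by rewrite (_ : [set H | _] = set0); [exact: ev0|apply/seteqP; split].
by apply: ev_andb; apply: ev_trace_in => w; exact: around_emb.
Qed.

Lemma around_far A B : far A B -> around A `&` around B = set0.
Proof.
move=> AB; rewrite -subset0 => v [[a [y [w [Aa -> h1 h2]]]] [b [y' [w' [Bb /vtx_inj[<- _] h3 h4]]]]].
have := AB a b Aa Bb; move: h1 h2 h3 h4; case: a {Aa} => a1 a2; case: b {Bb} => b1 b2 /=.
by case: y => y1 y2 /=; lia.
Qed.

Lemma infinite_by_fst (A : set (vertex LG)) :
  (forall N : nat, exists2 v, A v & N%:Z <= (v : 'rV[int]_h.+2) ord0 ord0) -> infinite_set A.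
Proof.
move=> hA /finite_seqP[s sE].
have [v Av] := hA (\sum_(u <- s) `|(u : 'rV[int]_h.+2) ord0 ord0|%N).+1.
have vs : v \in s by move: Av; rewrite sE.
rewrite (big_rem v vs) /=; move: ((v : 'rV[int]_h.+2) ord0 ord0) => z.
by move: (\sum_(u <- rem v s) _)%N => t; lia.
Qed.

Lemma percolation : 7%:R ^+ 4 * (20%:R * del) <= 1 / 2 -> 14%:R * (20%:R * del) < 1 ->
  exists O : set (spanning LG), [/\ measurable (O : set (config LG)), 0 < pr O &
    O `<=` has_infinite_component LG].
Proof.
move=> d1 d2; pose g i j := [set H | site_ok (toint i j) H].
pose dep A : set (set (config LG)) := ev (around A).
have depS A B E : A `<=` B -> dep A E -> dep B E.
  move=> AB; apply: ev_sub => v [a [y [w [Aa vE h1 h2]]]].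
  by exists a, y, w; split=> //; exact: AB.
have dfar A B E F : far A B -> dep A E -> dep B F -> pr (E `&` F) = pr E * pr F.
  by move=> AB hE hF; apply: (pr_indep P1 _ hE hF); exact: around_far.
have gE i j : ~` g i j = [set H | ~~ site_ok (toint i j) H].
  by apply/seteqP; split=> H /=; [move/negP|move=> ?; apply/negP].
have gle i j : pr (~` g i j) <= 20%:R * del by rewrite gE; exact: site_prob.
have e0 : 0 <= 20%:R * del := le_trans (pr_ge0 P _) (gle 0%N 0%N).
have dmeas A E : dep A E -> measurable E by exact: ev_meas.
have all := @pr_all_good _ (config LG) R P g dep dmeas (fun A E => @evC LG (around A) E)
  (fun A E F => @evU LG (around A) E F) (fun A => @ev0 LG (around A)) depS site_ev dfar
  (20%:R * del) e0 d1 gle d2.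
set O := ~` _ in all; exists O; split=> //.
  apply: measurableC; apply: bigcup_measurable => n _; apply: measurable_bigU => u _.
  exact: dmeas (@dep_bad _ (config LG) g dep (fun A E => @evC LG (around A) E)
    (fun A E F => @evU LG (around A) E F) (fun A => @ev0 LG (around A)) depS site_ev n u 0%N).
move=> H OH; pose ver (x : nat * nat) := rep (toint x.1 x.2) H.
have esc := @bad_escape _ (config LG) g H (fun x y => component H (ver x) (ver y)) OH
  (fun x => component_refl H (ver x)) (fun x y => @component_sym LG H (ver x) (ver y))
  (fun x y z => @component_trans LG H (ver x) (ver y) (ver z)).
exists (ver (0%N, 0%N)); apply: infinite_by_fst => N.
have [||x [Nx cx]] := esc _ _ N.
- move=> i j gi gi'; have := @rep_adj (toint i j) false H gi; rewrite /shift /=.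
  have -> : (i%:Z + 1, j%:Z) = toint i.+1 j by rewrite /toint -PoszD addn1.
  by apply.
- move=> i j gi gi'; have := @rep_adj (toint i j) true H gi; rewrite /shift /=.
  have -> : (i%:Z, j%:Z + 1) = toint i j.+1 by rewrite /toint -PoszD addn1.
  by apply.
by exists (ver x) => //; rewrite /ver rep_fst /toint /= lez_nat.
Qed.

End Percolation.

Lemma card_setU1U (J : finType) (A X Y : {set J}) e M K : #|A| = M -> #|X| = K -> #|Y| = K ->
  (#|A :|: (e |: (X :|: Y))|%SET <= M + (1 + (K + K)))%N.
Proof.
move=> <- XK YK; apply: leq_trans (leq_card_setU _ _) _; rewrite leq_add2l.
apply: leq_trans (leq_card_setU _ _) _; rewrite cards1 leq_add2l.
by apply: leq_trans (leq_card_setU _ _) _; rewrite XK YK.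
Qed.

Lemma high_dim_percolates (R : realType) : exists h, forall P : model R (lattice R h.+2),
  D_ge (p0 R) P -> exists O : set (spanning (lattice R h.+2)),
  [/\ measurable (O : set (config (lattice R h.+2))), 0 < pr P O & O `<=` has_infinite_component _].
Proof.
pose del : R := 1 / (2 * 20%:R * 7%:R ^+ 4).
have d74 : 0 < 7%:R ^+ 4 :> R by rewrite exprn_gt0.
have d0 : 0 < del / 2 by rewrite !divr_gt0 // !mulr_gt0.
have dle : del / 2 <= del by rewrite ler_pdivrMr // mulr_natr mulr2n lerDl -(pmulr_lge0 _ (_ : 0 < 2^-1)) ?ltW // invr_gt0.
have ds1 : 7%:R ^+ 4 * (20%:R * del) <= 1 / 2.
  have -> : 7%:R ^+ 4 * (20%:R * del) = 1 / 2; last by [].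
  by rewrite /del; move: (7%:R ^+ 4) d74 => x x0; field; rewrite gt_eqF.
have ds2 : 14%:R * (20%:R * del) < 1.
  have : 14%:R * 7%:R <= 7%:R ^+ 4 :> R by rewrite -!natrM -natrX ler_nat.
  have : 0 < 20%:R * del by rewrite mulr_gt0 // -(pmulr_lgt0 _ (_ : 0 < 2^-1)) // invr_gt0.
  by move: (7%:R ^+ 4) (20%:R * del) ds1 => x y; nra.
have e10 := eps1_gt0 R.
(* [b] bounds all bad sets. Neither it nor any later size depends on the model, so one dimension
   serves all models. *)
pose b := Num.bound (eps1 R)^-1; pose K := b.+1; pose N := (4 * 4 ^ K)%N.
have b1 : 1 < b%:R * eps1 R by rewrite -ltr_pdivrMr // div1r; apply: archi_boundP; rewrite invr_ge0 ltW.
have [M [M2 pos rat]] := positions N d0.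
(* [N2] precedes [N1]: [Z] has to be free only relative to [Ms], [None], [X] and [Y], at most
   [M + 1 + 2 K] directions, while [X] has to be free relative to all of [G true]. The 4 in [N1]
   counts the structures at a site. *)
pose N2 := (K * (1 * (2 ^ (M + (1 + (K + K))) * b)) + K)%N.
pose N1 := (K * (4 * (2 ^ (1 + M + N2) * b)) + K)%N.
have [tau [eta [l [k [tau0 l0 eta_le join_le pool_le]]]]] := scales (1 + M + N1 + N2) d0.
pose q := (l * l).*2; have q0 : (0 < q)%N by rewrite double_gt0 muln_gt0 l0.
have [Ms [Pl [G [[NM NP NG] [MP GP MG dG] [cM cG1 cG2 cP] cPl cGPl]]]] := layout M N1 N2 (q ^ k).
set h := (M + N1 + N2 + q ^ k)%N in Ms Pl G NM NP NG MP GP MG dG cM cG1 cG2 cP cPl cGPl.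
exists h => P DP; have [P1 _] := DP.
pose mu s := law P (emb R (h := h) s).
have mu0 s := law_ge0 P (emb R (h := h) s); have mu1 s := law1 P (emb R (h := h) s).
have mu_open s : cube_open (mu s) := law_open DP (fun w r => @emb_adj R h s w r).
have qP : (q ^ k <= #|Pl|)%N by rewrite cP.
have cPk : 4%:R ^+ #|~: Pl| < k%:R * tau ^+ 2 by rewrite cPl.
have [SD hSD] := @boolp.choice _ _ (fun s (SD : {set option 'I_h} * {set option 'I_h}) =>
    [/\ SD.1 \subset Pl, SD.2 \subset Pl, fintype.disjoint (mem SD.1) (mem SD.2), #|SD.2| = q
    & forall w A : {set option 'I_h}, w \subset (~: Pl)%SET -> A \subset (~: Pl)%SET ->
      stable (mu s) tau (A :|: SD.1)%SET SD.2 w]) (fun s =>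
  let: ex_intro S' (ex_intro D hyp) := pool_choice (mu0 s) (mu1 s) tau0 qP cPk in
  ex_intro _ (S', D) hyp).
pose S s := (SD s).1; pose D s := (SD s).2.
have SP s : S s \subset Pl by have [] := hSD s.
have DPl s : D s \subset Pl by have [] := hSD s.
have dSD s : fintype.disjoint (mem (S s)) (mem (D s)) by have [] := hSD s.
have Dq s : #|D s| = q by have [] := hSD s.
have st s (w A : {set option 'I_h}) : w \subset (~: Pl)%SET -> A \subset (~: Pl)%SET -> stable (mu s) tau (A :|: S s)%SET (D s) w.
  by have [_ _ _ _ ] := hSD s; apply.
have D0 s : (0 < #|D s|)%N by rewrite Dq.
have bad_le s c w : (#|badset (mu s) (S s) (D s) (G c) w| <= b)%N.
  have := card_badset (mu0 s) (mu1 s) (S s) (G c) w (D0 s).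
  rewrite -/(mu s) -(ler_nat R) => le1; rewrite -(ler_pM2r e10); exact: le_trans le1 (ltW b1).
have K0 : (0 < K)%N by [].
have GX : (K * (#|{: bool * bool}| * (2 ^ #|~: (G false :|: Pl)|%SET * b)) + K <= #|G false|)%N.
  by rewrite cG1 card_prod card_bool cGPl.
(* One set serves all four structures meeting at [x], as the gluing requires. *)
have [X hX] := @boolp.choice _ _ (fun x (X : {set option 'I_h}) => [/\ X \subset G false, #|X| = K &
    forall k (rho : {set option 'I_h}), rho \subset (~: (G false :|: Pl))%SET -> forall r, r \in X ->
    r \notin badset (mu (inc x k)) (S (inc x k)) (D (inc x k)) (G false) (rho :|: X :\ r)%SET])
  (fun x => free_family (B := fun k => badset (mu (inc x k)) (S (inc x k)) (D (inc x k)) (G false))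
    K0 (fun k => bad_le (inc x k) false) GX).
have XG x : X x \subset G false by have [] := hX x.
have XK x : #|X x| = K by have [] := hX x.
have GZ s : (K * (#|{: unit}| * (2 ^ #|Ms :|: (None |: (X s.1 :|: X (shift s.2 s.1)))|%SET * b)) + K <= #|G true|)%N.
  rewrite cG2 card_unit leq_add2r leq_mul2l /= !mul1n leq_mul2r; apply/orP; right.
  by rewrite leq_exp2l // card_setU1U.
have [Z hZ] := @boolp.choice _ _ (fun s (Z : {set option 'I_h}) => [/\ Z \subset G true, #|Z| = K &
    forall (u : unit) (rho : {set option 'I_h}), rho \subset (Ms :|: (None |: (X s.1 :|: X (shift s.2 s.1))))%SET ->
    forall r, r \in Z -> r \notin badset (mu s) (S s) (D s) (G true) (rho :|: Z :\ r)%SET])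
  (fun s => free_family (B := fun u : unit => badset (mu s) (S s) (D s) (G true)) K0 (fun u => bad_le s true) (GZ s)).
have ZG s : Z s \subset G true by have [] := hZ s.
have ZK s : #|Z s| = K by have [] := hZ s.
have rows s p : p \in rowset None (X s.1) (X (shift s.2 s.1)) (Z s) ->
    row (mu s) (S s) (D s) Ms Pl G p.1 p.2.
  apply: (rowset_row (D0 s) MP GP MG (bad_le s) NM NG NP (XG _) (XG _) (ZG s) (XK _) (XK _) (ZK s) dG).
  - move=> rho hr r rX; have [_ _ fX] := hX s.1.
    by have := fX (s.2, false) rho hr r rX; rewrite /inc; case: (s).
  - move=> rho hr r rX; have [_ _ fX] := hX (shift s.2 s.1).
    by have := fX (s.2, true) rho hr r rX; rewrite /inc /= shiftK; case: (s).
  by move=> rho hr r rZ; have [_ _ fZ] := hZ s; exact: fZ tt rho hr r rZ.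
have sound_le s : pr P [set H | ~~ soundat P Ms Pl G S D Z X s H] <= del.
  have := sound_prob (mu0 s) (mu1 s) (law_indep P1 (@emb_inj R h s)) (mu_open s) tau0 l0 (Dq s) (SP s)
    (DPl s) (dSD s) MP GP MG (st s) (@rows s) join_le (card_rowset None (XK _) (XK _) (ZK s)).
  rewrite cPl cM (Ex_law P (emb R s) (fun o => ~~ sound _ _ _ _ _ _ _ _ _ _ o)) => /le_trans; apply.
  apply: le_trans (lerD eta_le pos) _; by rewrite -splitr.
apply: (percolation P1 mu_open NM NP NG tau0 l0 Dq SP DPl dSD MP GP MG dG XG ZG rows sound_le) => //.
by rewrite cM; exact: le_trans rat dle.
Qed.

(** * Measurability and restriction to a hyperplane *)

Section Measurability.
Variables (R : realType) (n : nat).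
Notation L := (lattice R n).
Notation V := 'rV[int]_n.

Lemma measurable_andP (E : set (config L)) (Q : Prop) : measurable E -> measurable [set H | E H /\ Q].
Proof.
move=> mE; have [q|nq] := pselect Q.
  by rewrite (_ : [set H | _] = E) //; apply/seteqP; split=> // H [].
by rewrite (_ : [set H | _] = set0) //; apply/seteqP; split=> // H [].
Qed.

Lemma measurable_path (x : V) (s : seq V) :
  measurable ([set H : spanning L | path (sub_adj H : rel V) x s] : set (config L)).
Proof.
apply: (@ev_meas L setT); elim: s x => [|y s IHs] x /=.
  rewrite (_ : [set H | _] = ~` (set0 : set (spanning L))); first exact: (@evC L setT set0 (@ev0 L setT)).
  by apply/seteqP; split=> H //= _ [].
rewrite (_ : [set H | _] = [set H : spanning L | sub_adj H x y] `&`
    [set H : spanning L | path (sub_adj H : rel V) y s]).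
  by apply: evI => //; exact: ev_adj.
by apply/seteqP; split=> H /=; [case/andP|case=> -> ->].
Qed.

Lemma measurable_component (x y : V) : measurable ([set H : spanning L | component H x y] : set (config L)).
Proof.
rewrite (_ : [set H | _] = \bigcup_(s : seq V)
    [set H : spanning L | path (sub_adj H : rel V) x s /\ last x s = y]).
  apply: countable_bigcupT_measurable => [|s]; first exact: countableP.
  by apply: measurable_andP; exact: measurable_path.
by apply/seteqP; split=> H [s]; [move=> h; exists s|move=> _ h; exists s].
Qed.

(** A component is infinite when no finite list exhausts it, and there are only countably many
    vertices and lists. *)
Lemma measurable_infinite_component : measurable (has_infinite_component L : set (config L)).
Proof.
have -> : has_infinite_component L = \bigcup_(x : V) ~` \bigcup_(s : seq V)
    ~` \bigcup_(y : V) [set H : spanning L | component H x y /\ y \notin s].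
  apply/seteqP; split=> H [x].
    move=> hx; exists x => // -[s _]; apply; apply: contrapT => none; apply: hx.
    apply: (@sub_finite_set _ _ [set` (s : seq V)]); last exact: finite_seq.
    by move=> y xy /=; apply: contrapT => /negP ys; apply: none; exists y.
  move=> _ hx; exists x => /(@finite_seqP V)[s sE]; apply: hx; exists s => // -[y _ [xy /= ys]].
  by move: ys; have := xy; rewrite /= sE /= => ->.
apply: countable_bigcupT_measurable => [|x]; first exact: countableP.
apply: measurableC; apply: countable_bigcupT_measurable => [|s]; first exact: countableP.
apply: measurableC; apply: countable_bigcupT_measurable => [|y]; first exact: countableP.
by apply: measurable_andP; exact: measurable_component.
Qed.

End Measurability.

Section Restriction.
Variables (R : realType) (G G' : graph) (f : vertex G -> vertex G').
Hypotheses (f_inj : injective f) (f_adj : forall x y, adj x y -> adj (f x) (f y)).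

Lemma edge_image (e : edge G) : edge_set G' (f @` \val e).
Proof.
have [x [y [xy ->]]] := set_valP e; exists (f x), (f y); split; first exact: f_adj.
by rewrite image_setU !image_set1.
Qed.

Definition up (e : edge G) : edge G' := SigSub (mem_set (edge_image e)).

Lemma val_up e : \val (up e) = f @` \val e. Proof. by []. Qed.

Definition restrict (H : config G') : config G := up @^-1` H.

Lemma restrict_states (S : set (edge G)) A : sigma_states S A -> sigma_states (up @` S) (restrict @^-1` A).
Proof.
apply: (@smallest_sub _ _ _ (fun A => sigma_states (up @` S) (restrict @^-1` A))) => [|_ [e Se <-]].
  have [s0 sC sU] := smallest_sigma_algebra [set: spanning G'] (open_events (up @` S)).
  split=> [|B hB|F hF]; first exact: s0.
    by rewrite setTD preimage_setC -setTD; exact: sC.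
  by rewrite preimage_bigcup; exact: sU.
by apply: sub_sigma_algebra; exists (up e) => //; exists e.
Qed.

Lemma restrict_measurable : measurable_fun setT restrict.
Proof.
move=> _ A mA; rewrite setTI; apply: (@sigma_states_sub G' (up @` setT) setT) => //.
exact: restrict_states.
Qed.

HB.instance Definition _ := isMeasurableFun.Build _ _ _ _ restrict restrict_measurable.

Variable P : model R G'.

Definition marginal : model R G := distribution P restrict.

Lemma marginalE A : marginal A = P (restrict @^-1` A). Proof. by []. Qed.

Lemma marginal_D_ge p : D_ge p P -> D_ge p marginal.
Proof.
move=> [ind op]; split=> [S1 S2 S12 far A B hA hB|e]; last exact: op.
have share e e' : share_vertex (up e) (up e') -> share_vertex e e'.
  move=> [_ [[x ex <-] [y ey /f_inj xy]]]; exists x; split=> //.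
  by rewrite -xy.
rewrite !marginalE preimage_setI; apply: (ind (up @` S1) (up @` S2)); try exact: restrict_states.
  rewrite -subset0 => _ [[e Se <-] [e' Se' ee']]; apply: (far e e' Se Se'); apply: share.
  have [x [y [_ eE]]] := set_valP e; exists (f x).
  by split; [|rewrite ee']; rewrite val_up eE; exists x => //; left.
by move=> _ _ [e Se <-] [e' Se' <-] /share; exact: far.
Qed.

Lemma component_restrict (H : config G') x y : component (restrict H) x y -> component H (f x) (f y).
Proof.
move=> [s [ps <-]]; elim: s x ps => [|z s IHs] x /=; first by move=> _; exact: component_refl.
case/andP => /asboolP[e [He eE]] ps; apply: component_trans (IHs z ps); apply: component1.
by apply/asboolP; exists (up e); rewrite val_up eE image_setU !image_set1.
Qed.

Lemma infinite_restrict H : has_infinite_component G (restrict H) -> has_infinite_component G' H.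
Proof.
move=> [x hx]; exists (f x); apply: contra_not hx => fin.
apply: (@sub_finite_set _ _ (f @^-1` component H (f x))) => [y|]; first exact: component_restrict.
by apply: finite_preimage fin => y z _ _; exact: f_inj.
Qed.

Lemma marginal_percolates : measurable (has_infinite_component G : set (config G)) ->
  measurable (has_infinite_component G' : set (config G')) -> percolates marginal -> percolates P.
Proof.
move=> mG mG'; rewrite /percolates marginalE => /lt_le_trans; apply; apply: le_measure.
- by rewrite inE -[X in measurable X]setTI; exact: restrict_measurable.
- by rewrite inE.
- exact: infinite_restrict.
Qed.

End Restriction.

(** * Dependence of the critical value on the dimension *)

Section Pmax.
Variable R : realType.
Notation L := (lattice R).

Definition nonpercolating n : set R :=
  [set p | 0 <= p <= 1 /\ exists P : model R (L n), D_ge p P /\ ~ percolates P].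

Definition hyperplane n (x : 'rV[int]_n) : 'rV[int]_n.+1 := \row_j oapp (x ord0) 0 (unlift ord0 j).

Lemma hyperplaneE n (x : 'rV[int]_n) i : hyperplane x ord0 (lift ord0 i) = x ord0 i.
Proof. by rewrite mxE liftK. Qed.

Lemma hyperplane_inj n : injective (@hyperplane n).
Proof. by move=> x y xy; apply/rowP => i; rewrite -(hyperplaneE x) -(hyperplaneE y) xy. Qed.

Lemma hyperplane_adj n (x y : 'rV[int]_n) : @adj (L n) x y -> @adj (L n.+1) (hyperplane x) (hyperplane y).
Proof.
move=> xy; rewrite /= -[RHS]xy /euclid_dist; congr Num.sqrt.
rewrite big_ord_recl !mxE unlift_none subrr expr0n add0r.
by apply: eq_bigr => i _; rewrite !hyperplaneE.
Qed.

Lemma nonpercolating_sub n : nonpercolating n.+1 `<=` nonpercolating n.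
Proof.
move=> p [p01 [P [DP nP]]]; split=> //.
have inj : injective (@hyperplane n : vertex (L n) -> vertex (L n.+1)) by exact: hyperplane_inj.
exists (@marginal R (L n) (L n.+1) (@hyperplane n) (@hyperplane_adj n) P).
split; first exact: marginal_D_ge inj _ _ _ DP.
by apply: contra_not nP; apply: (marginal_percolates inj); exact: measurable_infinite_component.
Qed.

Lemma nonpercolating_ub n : has_ubound (nonpercolating n).
Proof. by exists 1 => p [/andP[]]. Qed.

Lemma pmax_ge0 n : 0 <= pmax R (L n).
Proof.
have [[p hp]|/set0P/negP/negPn/eqP e] := pselect (nonpercolating n !=set0); last first.
  by rewrite /pmax -/(nonpercolating n) e sup0.
have [/andP[p0 _] _] := hp.
exact: le_trans p0 (ub_le_sup (@nonpercolating_ub n) hp).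
Qed.

Lemma pmax_noninc : nonincreasing_seq (fun n => pmax R (L n)).
Proof.
apply/nonincreasing_seqP => n.
have [ne|/set0P/negP/negPn/eqP e] := pselect (nonpercolating n.+1 !=set0); last first.
  by rewrite {1}/pmax -/(nonpercolating n.+1) e sup0 pmax_ge0.
apply: ge_sup => // p hp; apply: (ub_le_sup (@nonpercolating_ub n)); exact: nonpercolating_sub hp.
Qed.

Lemma pmax_high_dim : exists n, pmax R (L n) <= p0 R.
Proof.
have [h hh] := high_dim_percolates R; exists h.+2.
have [ne|/set0P/negP/negPn/eqP e] := pselect (nonpercolating h.+2 !=set0); last first.
  by rewrite /pmax -/(nonpercolating h.+2) e sup0 /p0 divr_ge0.
(* A non-percolating model for some [p > p0] would belong to the class of [p0], where percolation is
   known. *)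
apply: ge_sup => // p [p01 [P [[ind op] nP]]]; rewrite leNgt; apply/negP => pp.
have DP : D_ge (p0 R) P by split=> // e; apply: le_trans (op e); rewrite lee_fin ltW.
have [E [mE E0 EI]] := hh P DP; apply: nP; rewrite /percolates.
apply: (@lt_le_trans _ _ (P E)); first by rewrite (prE P mE) lte_fin.
by apply: le_measure => //; rewrite inE //; exact: measurable_infinite_component.
Qed.

End Pmax.

Theorem theorem1p4 (R : realType) :
  cvgn (fun n : nat => pmax R (lattice R n)) /\
  limn (fun n : nat => pmax R (lattice R n)) <= 5847%:R / 10000%:R.
Proof.
have cv : cvgn (fun n : nat => pmax R (lattice R n)).
  apply: nonincreasing_is_cvgn; first exact: pmax_noninc.
  by exists 0 => _ [n _ <-]; exact: pmax_ge0.
split=> //; have [n hn] := pmax_high_dim R.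
(* The limit of a nonincreasing sequence is at most each of its terms, so a single dimension
   suffices. *)
apply: le_trans (nonincreasing_cvgn_ge (pmax_noninc R) cv n) (le_trans hn _).
by rewrite /p0; lra.
Qed.
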